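(* Let assumptions (A0)–(A5) from the context hold. Then for any $h,\tau>0$ and any choice of initial values $\rho_{h,0},\eta_{h,0}\in\mathcal V_h$, the fully discrete Problem (P) from the context has at least one solution $(\rho_{h,\tau},\eta_{h,\tau},\bar\mu_{\rho,h,\tau},\bar\mu_{\eta,h,\tau})$. Moreover, any such discrete solution satisfies $$\frac{d}{dt}\int_\Omega \rho_{h,\tau}=0 \qquad\text{and}\qquad \mathcal E(\rho_{h,\tau},\eta_{h,\tau})\Big|_{t^{n-1}}^{t^n}=-\int_{t^{n-1}}^{t^n}\mathcal D_{\bar\rho_{h,\tau},\bar\eta_{h,\tau}}(\bar\mu_{\rho,h,\tau},\bar\mu_{\eta,h,\tau})\,ds$$ for all time steps $1\le n\le N$, i.e. mass is conserved and energy is dissipated.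
   Context: Assumptions and notation. (A0) $\Omega\subset\mathbb R^d$, $d=2,3$, is a cube identified with the $d$-dimensional torus; all functions on $\Omega$ are periodic, and $L^p(\Omega)$, $H^k(\Omega)$, $W^{k,p}(\Omega)$ are spaces of periodic functions. $\langle u,v\rangle=\int_\Omega u\cdot v$. $T>0$ is a fixed final time. (A1) $\gamma_\rho,\gamma_\eta>0$ are constants. (A2) For $\omega=(\rho,\eta,\nabla\rho,\nabla\eta)$ the mobility matrix $\mathbf L(\omega)=\begin{pmatrix}\mathbf L_{11}&\mathbf L_{12}\\ \mathbf L_{12}^\top&\mathbf L_{22}\end{pmatrix}(\omega)\in\mathbb R^{(d+1)\times(d+1)}$ (blocks $\mathbf L_{11}\in\mathbb R^{d\times d}$, $\mathbf L_{12}\in\mathbb R^d$, $\mathbf L_{22}\in\mathbb R$) is symmetric with $\lambda_1|\xi|^2\le\xi^\top\mathbf L(\omega)\xi\le\lambda_2|\xi|^2$ for all $\xi\in\mathbb R^{d+1}$ and all $\omega$, with constants $0<\lambda_1\le\lambda_2$. Every component of $\mathbf L(\cdot)$ is a $C^2$ function of $\omega$ with derivatives uniformly bounded by a constant $\lambda_3$. (A3) $f:\mathbb R^2\to\mathbb R$ is smooth, $f\ge0$, and $\left|\frac{\partial^{k+\ell}f(\rho,\eta)}{\partial\rho^k\partial\eta^\ell}\right|\le C_1(|\rho|^{4-k}+|\eta|^{4-\ell})+C_2$ for all $0\le k,\ell,k+\ell\le4$. Furthermore $f(\rho,\eta)+\frac\alpha2(|\rho|^2+|\eta|^2)$ is strictly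 convex for some $\alpha>0$. Write $f_\rho=\partial_\rho f$, $f_\eta=\partial_\eta f$. (A4) $\mathcal T_h$ is a geometrically conforming quasi-uniform partition of $\Omega$ into simplices that can be extended periodically: there is $\sigma>0$ with $\sigma h\le\rho_K\le h_K\le h$ for all $K\in\mathcal T_h$, where $\rho_K,h_K$ are the inner-circle radius and diameter of $K$ and $h$ is the maximal diameter. $\mathcal V_h=\{v\in H^1(\Omega):v|_K\in P_2(K)\ \forall K\in\mathcal T_h\}$. (A5) $\mathcal I_\tau=\{t^0,\dots,t^N\}$, $t^n=n\tau$, $\tau=T/N$. $I_n=(t^{n-1},t^n)$. $P_k(\mathcal I_\tau;X)$ denotes (discontinuous) piecewise polynomials in time of degree $\le k$ over the grid with values in $X$; $P_k^c(\mathcal I_\tau;X)=P_k(\mathcal I_\tau;X)\cap C([0,T];X)$. $\bar u=\bar\pi^0_\tau u$ denotes the $L^2$-orthogonal projection in time to piecewise constants. $\langle a,b\rangle^n=\int_{I_n}\langle a(s),b(s)\rangle\,ds$. Energy: $\mathcal E(\rho,\eta)=\int_\Omega\frac{\gamma_\rho}2|\nabla\rho|^2+\frac{\gamma_\eta}2|\nabla\eta|^2+f(\rho,\eta)$. Problem (P): Given $\rho_{h,0},\eta_{h,0}\in\mathcal V_h$, find $\rho_{h,\tau},\eta_{h,\tau}\in P_1^c(\mathcal I_\tau;\mathcal V_h)$ and $\bar\mu_{\rho,h,\tau},\bar\mu_{\eta,h,\tau}\in P_0(\mathcal I_\tau;\mathcal V_h)$ with $\rho_{h,\tau}(0)=\rho_{h,0}$,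 $\eta_{h,\tau}(0)=\eta_{h,0}$ such that for all $1\le n\le N$ and all $\bar v_1,\bar v_2,\bar w_1,\bar w_2\in P_0(I_n;\mathcal V_h)$ $$\langle\partial_t\rho_{h,\tau},\bar v_1\rangle^n+\langle\mathbf L_{11}(\bar\omega_{h,\tau})\nabla\bar\mu_{\rho,h,\tau}+\bar\mu_{\eta,h,\tau}\mathbf L_{12}(\bar\omega_{h,\tau}),\nabla\bar v_1\rangle^n=0,$$ $$\langle\partial_t\eta_{h,\tau},\bar v_2\rangle^n+\langle\mathbf L_{12}(\bar\omega_{h,\tau})\cdot\nabla\bar\mu_{\rho,h,\tau}+\mathbf L_{22}(\bar\omega_{h,\tau})\bar\mu_{\eta,h,\tau},\bar v_2\rangle^n=0,$$ $$\langle\bar\mu_{\rho,h,\tau},\bar w_1\rangle^n-\gamma_\rho\langle\nabla\bar\rho_{h,\tau},\nabla\bar w_1\rangle^n-\langle f_\rho(\rho_{h,\tau},\eta_{h,\tau}),\bar w_1\rangle^n=0,$$ $$\langle\bar\mu_{\eta,h,\tau},\bar w_2\rangle^n-\gamma_\eta\langle\nabla\bar\eta_{h,\tau},\nabla\bar w_2\rangle^n-\langle f_\eta(\rho_{h,\tau},\eta_{h,\tau}),\bar w_2\rangle^n=0,$$ where $\omega_{h,\tau}=(\rho_{h,\tau},\eta_{h,\tau},\nabla\rho_{h,\tau},\nabla\eta_{h,\tau})$ and $\bar\omega_{h,\tau}=\bar\pi_\tau^0\omega_{h,\tau}$. Dissipation functional: $\mathcal D_{\rho,\eta}(\mu_\rho,\mu_\eta)=\left\langle\begin{pmatrix}\nabla\mu_\rho\\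 \mu_\eta\end{pmatrix},\mathbf L(\rho,\eta,\nabla\rho,\nabla\eta)\begin{pmatrix}\nabla\mu_\rho\\ \mu_\eta\end{pmatrix}\right\rangle$; in particular $\mathcal D_{\bar\rho_{h,\tau},\bar\eta_{h,\tau}}$ uses $\mathbf L(\bar\omega_{h,\tau})$. *)

(* Defs.v *)
From HB Require Import structures.
From mathcomp Require Import all_boot all_order all_algebra.
From mathcomp Require Import all_classical all_reals all_analysis.

Set Implicit Arguments.
Unset Strict Implicit.
Unset Printing Implicit Defensive.

Import Order.TTheory GRing.Theory Num.Theory.
Import numFieldNormedType.Exports.

Local Open Scope classical_set_scope.
Local Open Scope ring_scope.

(* Product sigma-algebra on 'rV[R]_n: generated by the coordinates, as the
   library does for tuples; it is the Borel sigma-algebra of R^n. *)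
Definition rV_display : measure_display. Proof. exact. Qed.

Section measurable_rV.
Variables (R : realType) (n : nat).

Let coors : 'I_n -> 'rV[R]_n -> measurableTypeR R := fun i x => x 0 i.

Let rV_set0 : g_sigma_preimage coors set0.
Proof. exact: sigma_algebra0. Qed.

Let rV_setC A : g_sigma_preimage coors A -> g_sigma_preimage coors (~` A).
Proof. exact: sigma_algebraC. Qed.

Let rV_bigcup (F : (set 'rV[R]_n)^nat) :
  (forall i, g_sigma_preimage coors (F i)) ->
  g_sigma_preimage coors (\bigcup_i (F i)).
Proof. exact: sigma_algebra_bigcup. Qed.

HB.instance Definition _ := @isMeasurable.Build rV_display
  'rV[R]_n (g_sigma_preimage coors) rV_set0 rV_setC rV_bigcup.

End measurable_rV.

Section lebesgue_rV.
Variable R : realType.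

Lemma measurable_coord n (i : 'I_n) :
  measurable_fun setT (fun x : 'rV[R]_n => x 0 i : measurableTypeR R).
Proof.
move=> _ Y mY; rewrite setTI; apply: sub_sigma_algebra => /=.
rewrite -bigcup_seq/=; exists i => /=; first by rewrite mem_index_enum.
by exists Y => //; rewrite setTI.
Qed.

Lemma measurable_fun_rV d (S : measurableType d) n (F : S -> 'rV[R]_n) :
  (forall i, measurable_fun setT (fun s => F s 0 i : measurableTypeR R)) ->
  measurable_fun setT F.
Proof.
move=> mF.
have -> : F = (fun s => \row_i tnth [tuple F s 0 j | j < n] i).
  by apply/funext => s; apply/rowP => i; rewrite mxE tnth_mktuple.
move=> _ A mA; rewrite setTI.
suff : measurable `<=` [set A : set 'rV[R]_n | measurable (F @^-1` A)].
  move=> /(_ A mA) /=; congr measurable; apply/funext => s /=.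
  congr (A _); apply/rowP => i; by rewrite mxE tnth_mktuple.
apply: smallest_sub.
  split => /=.
  - by rewrite preimage_set0.
  - by move=> B mB; rewrite setTD preimage_setC; exact: measurableC.
  - by move=> B mB; rewrite preimage_bigcup; exact: bigcup_measurable.
rewrite -bigcup_seq; apply: bigcup_sub => i _ _ [B mB <-] /=.
by rewrite setTI -[X in measurable X]setTI; exact: mF.
Qed.

Definition rV_rcons n (p : 'rV[R]_n * measurableTypeR R) : 'rV[R]_n.+1 :=
  \row_i (if unlift ord_max i is Some j then p.1 0 j else p.2).

Lemma measurable_rV_rcons n : measurable_fun setT (@rV_rcons n).
Proof.
apply: measurable_fun_rV => i; rewrite /rV_rcons.
case E : (unlift ord_max i) => [j|].
  rewrite (_ : (fun _ => _) = (fun x : 'rV[R]_n => x 0 j : measurableTypeR R) \o fst).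
    exact: (measurableT_comp (measurable_coord j) measurable_fst).
  by apply/funext => s; rewrite mxE E.
rewrite (_ : (fun _ => _) = snd) //; last by apply/funext => s; rewrite mxE E.
Qed.

Definition lebesgue_step n (mu : {measure set 'rV[R]_n -> \bar R}) :
    set 'rV[R]_n.+1 -> \bar R :=
  pushforward (mu \x (@lebesgue_measure R))%E (@rV_rcons n).

HB.instance Definition _ n (mu : {measure set 'rV[R]_n -> \bar R}) :=
  Measure.copy (lebesgue_step mu)
    (measure_function_pushforward__canonical__measure_function_Measure
      (mu \x (@lebesgue_measure R))%E (@measurable_rV_rcons n)).

(* n-dimensional Lebesgue measure, R^(n+1) being identified with R^n x R. *)
Fixpoint lebesgue_rV (n : nat) : {measure set 'rV[R]_n -> \bar R} :=
  if n is m.+1 then lebesgue_step (lebesgue_rV m)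
  else dirac (0 : 'rV[R]_0).

Lemma measurable_box n (a b : 'rV[R]_n) :
  measurable [set x : 'rV[R]_n | forall i, a 0 i <= x 0 i <= b 0 i].
Proof.
rewrite (_ : [set x | _] =
    \bigcap_(i in [set: 'I_n])
      ((fun x : 'rV[R]_n => x 0 i) @^-1` `[a 0 i, b 0 i])).
  apply: fin_bigcap_measurable => // i _; rewrite -[X in measurable X]setTI.
  by apply: measurable_coord => //; exact: measurable_itv.
apply/seteqP; split => x /= H i.
  by move=> _; rewrite /= in_itv; exact: H.
by have := H i I; rewrite /= in_itv.
Qed.

Lemma lebesgue_rV_box n (a b : 'rV[R]_n) : (forall i, a 0 i <= b 0 i) ->
  lebesgue_rV n [set x : 'rV[R]_n | forall i, a 0 i <= x 0 i <= b 0 i] =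
  (\prod_i (b 0 i - a 0 i))%:E.
Proof.
elim: n a b => [|m IH] a b ab.
  by rewrite big_ord0 /= diracE mem_set //= => -[].
pose a' : 'rV[R]_m := \row_i a 0 (lift ord_max i).
pose b' : 'rV[R]_m := \row_i b 0 (lift ord_max i).
rewrite /= /lebesgue_step /pushforward.
set B := (X in _ X = _).
have -> : B = [set x : 'rV[R]_m | forall i, a' 0 i <= x 0 i <= b' 0 i] `*`
              `[a 0 ord_max, b 0 ord_max].
  apply/seteqP; split => [[x y] /= H|[x y] /= [H1 H2] i].
    split.
      move=> i; have := H (lift ord_max i).
      by rewrite !mxE liftK.
    by have := H ord_max; rewrite !mxE unlift_none /= in_itv /=.
  rewrite mxE; case: unliftP => [j ->|->] /=; last by move: H2; rewrite in_itv.
  by have := H1 j; rewrite !mxE.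
rewrite product_measure1E //; last exact: measurable_box.
rewrite IH; last by move=> i; rewrite !mxE.
have E : (@lebesgue_measure R) `[a 0 ord_max, b 0 ord_max] =
    (b 0 ord_max - a 0 ord_max)%:E.
  rewrite lebesgue_measure_itv /= lte_fin.
  by case: ltgtP (ab ord_max) => // -> _; rewrite subrr.
rewrite [X in (_ * X)%E]E.
rewrite -EFinM; congr EFin; rewrite big_ord_recr /=; congr (_ * _).
apply: eq_bigr => i _; rewrite !mxE.
by have -> : lift ord_max i = widen_ord (leqnSn m) i
  by apply: val_inj; rewrite /= /bump leqNgt ltn_ord.
Qed.

End lebesgue_rV.

Section calculus.
Variables (R : realType) (n : nat).

Definition pderiv (i : 'I_n) (g : 'rV[R]_n -> R) : 'rV[R]_n -> R :=
  fun x => 'D_(delta_mx 0 i) g x.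

(* For s = [:: i1; ...; ik], the partial derivative d_{i1} ... d_{ik} g. *)
Definition pderivs (s : seq 'I_n) (g : 'rV[R]_n -> R) : 'rV[R]_n -> R :=
  foldr pderiv g s.

Definition Ck (k : nat) (g : 'rV[R]_n -> R) : Prop :=
  forall s : seq 'I_n, (size s <= k)%N ->
    continuous (pderivs s g) /\
    ((size s < k)%N ->
      forall i x, derivable (pderivs s g) x (delta_mx 0 i)).

Definition smooth (g : 'rV[R]_n -> R) : Prop := forall k, Ck k g.

Definition dotv (u v : 'rV[R]_n) : R := \sum_i u 0 i * v 0 i.

Definition enorm (v : 'rV[R]_n) : R := Num.sqrt (dotv v v).

End calculus.

(* Functions on the torus are l-periodic functions on R^d; integrals are taken
   over the cell a + [0, l]^d. *)
Section torus.
Variables (R : realType) (d : nat) (a : 'rV[R]_d) (l : R).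
Local Notation Rd := 'rV[R]_d.

Definition cube : set Rd :=
  [set x | forall i, a 0 i <= x 0 i <= (a + const_mx l) 0 i].

Definition mu_cube : {measure set Rd -> \bar R} :=
  mrestr (lebesgue_rV R d) (measurable_box a (a + const_mx l)).

Definition periodic (v : Rd -> R) : Prop :=
  forall x i, v (x + l *: delta_mx 0 i) = v x.

Definition L2per : set (Rd -> R) :=
  [set v | v \in Lfun mu_cube 2%:E /\ periodic v].

Definition ip (u v : Rd -> R) : R := \int[mu_cube]_x (u x * v x).

Definition is_weak_pderiv (i : 'I_d) (v g : Rd -> R) : Prop :=
  L2per g /\
  forall phi : Rd -> R, smooth phi -> periodic phi ->
    ip v (pderiv i phi) = - ip g phi.

Definition H1per : set (Rd -> R) :=
  [set v | L2per v /\ forall i, exists g, is_weak_pderiv i v g].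

(* A chosen representative of the weak derivative (which is unique a.e.). *)
Definition weak_pderiv (i : 'I_d) (v : Rd -> R) : Rd -> R :=
  xget (cst 0) [set g | is_weak_pderiv i v g].

Definition grad (v : Rd -> R) (x : Rd) : Rd := \row_i weak_pderiv i v x.

Definition H1norm (v : Rd -> R) : R :=
  Num.sqrt (ip v v + \int[mu_cube]_x dotv (grad v x) (grad v x)).

End torus.

Section mesh.
Variables (R : realType) (d : nat).
Local Notation Rd := 'rV[R]_d.

Definition affinely_independent (v : 'I_d.+1 -> Rd) : Prop :=
  forall c : 'I_d.+1 -> R,
    \sum_j c j = 0 -> \sum_j c j *: v j = 0 -> forall j, c j = 0.

(* Convex hull of the vertices with index in S; empty if S is empty. *)
Definition face (v : 'I_d.+1 -> Rd) (S : {set 'I_d.+1}) : set Rd :=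
  [set x | exists c : 'I_d.+1 -> R,
    [/\ forall j, 0 <= c j, forall j, j \notin S -> c j = 0,
        \sum_j c j = 1 & x = \sum_j c j *: v j]].

Definition simplex (v : 'I_d.+1 -> Rd) : set Rd := face v [set: 'I_d.+1]%SET.

Definition diameter (A : set Rd) : R :=
  sup [set r | exists x y, [/\ A x, A y & r = enorm (x - y)]].

Definition inradius (A : set Rd) : R :=
  sup [set r | 0 <= r /\
    exists x, forall y, enorm (y - x) <= r -> A y].

Variables (a : Rd) (l : R) (K : finType) (vtx : K -> 'I_d.+1 -> Rd).

Definition translate (z : 'rV[int]_d) (v : 'I_d.+1 -> Rd) : 'I_d.+1 -> Rd :=
  fun j => v j + l *: map_mx intr z.

(* The last field says that the mesh together with all its translates by
   l Z^d is conforming: two cells meet in a common (possibly empty) face. *)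
Record periodic_conforming_partition : Prop := PeriodicConformingPartition {
  cells_nondegenerate : forall k, affinely_independent (vtx k);
  cells_distinct : injective (fun k => simplex (vtx k));
  cells_cover : \bigcup_(k in [set: K]) simplex (vtx k) = cube a l;
  cells_conforming : forall k k' (z : 'rV[int]_d),
    exists S S' : {set 'I_d.+1},
      simplex (vtx k) `&` simplex (translate z (vtx k')) = face (vtx k) S /\
      simplex (vtx k) `&` simplex (translate z (vtx k')) =
        face (translate z (vtx k')) S'
}.

Definition quasi_uniform (h sigma : R) : Prop :=
  [/\ 0 < sigma,
      exists k, diameter (simplex (vtx k)) = h &
      forall k, [/\ sigma * h <= inradius (simplex (vtx k)),
        inradius (simplex (vtx k)) <= diameter (simplex (vtx k)) &
        diameter (simplex (vtx k)) <= h]].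

Definition is_P2_on (A : set Rd) (v : Rd -> R) : Prop :=
  exists (c : R) (b : 'rV[R]_d) (q : 'M[R]_d),
    forall x, A x ->
      v x = c + \sum_i b 0 i * x 0 i + \sum_i \sum_j q i j * x 0 i * x 0 j.

(* Each class of a.e. equal functions is represented by its unique element that
   is quadratic on every closed cell. *)
Definition Vh : set (Rd -> R) :=
  [set v | H1per a l v /\ forall k, is_P2_on (simplex (vtx k)) v].

End mesh.

(* Functions of time and space are maps R -> ('rV[R]_d -> R); only their values
   for times in [0, T] matter, and for elements of Pk only those for times in
   the open intervals of the grid. *)
Section time.
Variables (R : realType) (d : nat) (a : 'rV[R]_d) (l : R).
Variables (T : R) (N : nat).
Local Notation F := ('rV[R]_d -> R).

Definition tgrid (n : nat) : R := n%:R * (T / N%:R).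

Definition Itv (n : nat) : set R := `]tgrid n.-1, tgrid n[.

Definition Pk_on (k : nat) (X : set F) (n : nat) (u : R -> F) : Prop :=
  exists c : 'I_k.+1 -> F, (forall j, X (c j)) /\
    forall t, Itv n t -> u t = fun x => \sum_(j < k.+1) t ^+ j * c j x.

Definition Pk (k : nat) (X : set F) (u : R -> F) : Prop :=
  forall n, (0 < n <= N)%N -> Pk_on k X n u.

(* Intended for subspaces X of H1, with the H1 norm. *)
Definition Ctime (X : set F) (u : R -> F) : Prop :=
  forall t, t \in `[0, T] -> X (u t) /\
    H1norm a l (fun x => u s x - u t x) @[s --> within `[0, T] (nbhs t)] --> 0.

Definition Pkc (k : nat) (X : set F) (u : R -> F) : Prop :=
  Pk k X u /\ Ctime X u.

Definition ipI (n : nat) (u v : R -> F) : R :=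
  \int[@lebesgue_measure R]_(s in Itv n) ip a l (u s) (v s).

Definition is_L2proj0 (u ub : R -> F) : Prop :=
  Pk 0 (L2per a l) ub /\
  forall n, (0 < n <= N)%N -> forall w, Pk_on 0 (L2per a l) n w ->
    ipI n (fun s x => u s x - ub s x) w = 0.

(* L2-orthogonal projection in time onto piecewise constants (unique a.e.),
   and its componentwise extension to vector-valued functions. *)
Definition bar (u : R -> F) : R -> F :=
  xget (fun _ => cst 0) [set ub | is_L2proj0 u ub].

Definition barv m (u : R -> 'rV[R]_d -> 'rV[R]_m) : R -> 'rV[R]_d -> 'rV[R]_m :=
  fun t x => \row_j bar (fun s y => u s y 0 j) t x.

Definition dt (u : R -> F) : R -> F := fun t x => derive1 (fun s => u s x) t.

End time.

Section model.
Variables (R : realType) (d : nat).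

Definition pt2 (x y : R) : 'rV[R]_2 := \row_(i < 2) (if i == 0 then x else y).

Variable L : 'rV[R]_(1 + 1 + d + d) -> 'M[R]_(d + 1).

Definition L11 w : 'M[R]_d := ulsubmx (L w).
Definition L12 w : 'cV[R]_d := ursubmx (L w).
Definition L22 w : R := drsubmx (L w) 0 0.

Definition mobility_assumption (lam1 lam2 lam3 : R) : Prop :=
  [/\ 0 < lam1 <= lam2,
      forall w, (L w)^T = L w,
      forall w (xi : 'cV[R]_(d + 1)),
        lam1 * \sum_i xi i 0 ^+ 2 <= (xi^T *m L w *m xi) 0 0
          <= lam2 * \sum_i xi i 0 ^+ 2,
      forall i j, Ck 2 (fun w => L w i j) &
      forall i j s w, (0 < size s <= 2)%N ->
        `|pderivs s (fun w => L w i j) w| <= lam3].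

Variable f : 'rV[R]_2 -> R.

Definition f_rho : 'rV[R]_2 -> R := pderiv 0 f.
Definition f_eta : 'rV[R]_2 -> R := pderiv 1 f.

Definition strictly_convex (g : 'rV[R]_2 -> R) : Prop :=
  forall x y t, x != y -> 0 < t < 1 ->
    g (t *: x + (1 - t) *: y) < t * g x + (1 - t) * g y.

Definition potential_assumption (alpha C1 C2 : R) : Prop :=
  [/\ smooth f,
      forall z, 0 <= f z,
      forall (k m : nat) (r e : R), (k + m <= 4)%N ->
        `|pderivs (nseq k 0 ++ nseq m 1) f (pt2 r e)|
          <= C1 * (`|r| ^+ (4 - k) + `|e| ^+ (4 - m)) + C2,
      0 < alpha &
      strictly_convex
        (fun z => f z + alpha / 2 * (`|z 0 0| ^+ 2 + `|z 0 1| ^+ 2))].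

End model.

Section scheme.
Variables (R : realType) (d : nat) (a : 'rV[R]_d) (l : R).
Variables (K : finType) (vtx : K -> 'I_d.+1 -> 'rV[R]_d).
Variables (gamma_rho gamma_eta : R).
Variable L : 'rV[R]_(1 + 1 + d + d) -> 'M[R]_(d + 1).
Variable f : 'rV[R]_2 -> R.
Variables (T : R) (N : nat).
Local Notation F := ('rV[R]_d -> R).
Local Notation grad := (grad a l).
Local Notation V := (Vh a l vtx).
Local Notation mu := (mu_cube a l).
Local Notation ipI := (ipI a l T N).

Definition omega (r e : F) (x : 'rV[R]_d) : 'rV[R]_(1 + 1 + d + d) :=
  row_mx (row_mx (row_mx (r x)%:M (e x)%:M) (grad r x)) (grad e x).

Definition energy (r e : F) : R :=
  \int[mu]_x (gamma_rho / 2 * dotv (grad r x) (grad r x)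
            + gamma_eta / 2 * dotv (grad e x) (grad e x)
            + f (pt2 (r x) (e x))).

Definition dissipation (r e mr me : F) : R :=
  \int[mu]_x
    let xi : 'cV[R]_(d + 1) := col_mx (grad mr x)^T (me x)%:M in
    (xi^T *m (L (omega r e x) *m xi)) 0 0.

Definition omega_bar (rho eta : R -> F) : R -> 'rV[R]_d -> 'rV[R]_(1 + 1 + d + d) :=
  barv a l T N (fun t => omega (rho t) (eta t)).

Definition gradI (n : nat) (g : R -> 'rV[R]_d -> 'rV[R]_d) (v : R -> F) : R :=
  \int[@lebesgue_measure R]_(s in Itv T N n)
    \int[mu]_x dotv (g s x) (grad (v s) x).

Definition flux (rho eta mr me : R -> F) : R -> 'rV[R]_d -> 'rV[R]_d :=
  fun t x => let w := omega_bar rho eta t x in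
    (L11 L w *m (grad (mr t) x)^T + me t x *: L12 L w)^T.

Definition source (rho eta mr me : R -> F) : R -> F :=
  fun t x => let w := omega_bar rho eta t x in
    ((L12 L w)^T *m (grad (mr t) x)^T) 0 0 + L22 L w * me t x.

Record is_solution (rho0 eta0 : F) (rho eta mr me : R -> F) : Prop := IsSolution {
  sol_rho : Pkc a l T N 1 V rho;
  sol_eta : Pkc a l T N 1 V eta;
  sol_mu_rho : Pk T N 0 V mr;
  sol_mu_eta : Pk T N 0 V me;
  sol_rho0 : rho 0 = rho0;
  sol_eta0 : eta 0 = eta0;
  sol_eq_rho : forall n v, (0 < n <= N)%N -> Pk_on T N 0 V n v ->
    ipI n (dt rho) v + gradI n (flux rho eta mr me) v = 0;
  sol_eq_eta : forall n v, (0 < n <= N)%N -> Pk_on T N 0 V n v ->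
    ipI n (dt eta) v + ipI n (source rho eta mr me) v = 0;
  sol_eq_mu_rho : forall n w, (0 < n <= N)%N -> Pk_on T N 0 V n w ->
    ipI n mr w
    - gamma_rho * gradI n (fun t => grad (bar a l T N rho t)) w
    - ipI n (fun t x => f_rho f (pt2 (rho t x) (eta t x))) w = 0;
  sol_eq_mu_eta : forall n w, (0 < n <= N)%N -> Pk_on T N 0 V n w ->
    ipI n me w
    - gamma_eta * gradI n (fun t => grad (bar a l T N eta t)) w
    - ipI n (fun t x => f_eta f (pt2 (rho t x) (eta t x))) w = 0
}.

End scheme.

(* Main.v *)
Require Import Defs.
From mathcomp Require Import all_boot all_order all_algebra.
From mathcomp Require Import all_classical all_reals all_analysis.
From mathcomp Require Import measurable_realfun ring lra.

Set Implicit Arguments.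
Unset Strict Implicit.
Unset Printing Implicit Defensive.

Import Order.TTheory GRing.Theory Num.Theory.
Import numFieldNormedType.Exports.

Local Open Scope classical_set_scope.
Local Open Scope ring_scope.

(** The scheme couples two consecutive time intervals only through the values of
    rho and eta at their common node, so a solution is a chain of solutions of one
    time step, and both conservation statements can be read off a single step.

    Solvability of a step.  The finite element space is finite dimensional, because
    a function that is quadratic on each of finitely many cells is determined by its
    coefficients; let b be an orthonormal basis of it.  Take for unknown the vector
    z of coordinates of the two time derivatives.  The equations for the chemical
    potentials give the coordinates of the latter as a continuous function G(z),
    and the two evolution equations become z = T(z) with T(z) = - A(z) G(z), where
    A(z) is the matrix, at the midpoint state, of the mobility form in the fields
    (grad b_i, 0) and (0, b_i).  Two facts give an a priori bound.  As A(z) is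
    symmetric, nonnegative and bounded, |T(z)|^2 <= - C <G(z), T(z)>
    ([dissipation_controls]).  And the step length times <G(z), z> is the increment
    of the energy along the step, which is at least minus the initial energy
    because f is nonnegative ([potentials_coercive]).  If z = t T(z) with 0 < t < 1,
    these two inequalities bound |z|, and Brouwer's theorem in Schaefer's form gives
    a fixed point ([dissipative_fixpoint]).  Brouwer's theorem is obtained from the
    Poincare-Miranda theorem, hence from a labelling lemma on the cubical grid, for
    which the count mod 2 of the cells carrying all labels is written as a cup
    product and computed by a discrete Stokes formula ([boxsum_cup],
    [bichromatic_cell]).

    Conservation.  On each time interval any solution is affine in time.  The
    gradient part of the energy is quadratic, so that its increment is exactly the
    power at the midpoint, which is where the projection in time evaluates the
    gradients; the increment of the potential part is the integral in time of the
    power, by the chain rule.  Testing the equations for the potentials with the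
    time derivatives and the evolution equations with the potentials turns the sum
    of the two into minus the dissipation ([step_energy]).  Testing the first
    equation with a constant gives conservation of mass ([step_mass]).

    The weak derivatives and the projection in time are chosen representatives of
    almost everywhere classes, so that everything above rests on their uniqueness.
    For weak derivatives this is [orth_ae0]: a square-integrable function orthogonal
    to all smooth periodic functions vanishes almost everywhere.  For the projection
    it is [bar_affine], which identifies it with the value at the midpoint.  Lastly,
    continuity in time with values in H1 identifies the traces of the affine pieces
    with the values at the nodes ([node_match]); conversely the interpolant of the
    nodal values is continuous ([Pkc_interp]). *)

(** * A cup product on the cubical grid *)

Section CubicalCup.
Variables (n p : nat).
Local Notation X := {ffun 'I_n -> nat}.
Variable lab : 'I_n -> X -> 'F_2.

(** Points of the grid are functions with values in [nat]; a cell is named by its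
    lowest corner, and [lab i] is a two-valued label for the i-th direction. *)
Definition up (j : 'I_n) (x : X) : X := [ffun k => (x k + (k == j))%N].
Definition upd (j : 'I_n) (m : nat) (x : X) : X :=
  [ffun k => if k == j then m else x k].

(** This is the cup product of the cochains d(lab i), for i in s, evaluated on the
    subcube of the cell x spanned by the directions in D: each factor is evaluated on an edge
    and the remaining ones on the opposite subcube, in all possible orders of the
    directions.  Signs disappear because the coefficients are in F_2. *)
Fixpoint cup (s : seq 'I_n) (D : {set 'I_n}) (x : X) : 'F_2 :=
  if s is i :: s' then
    \sum_(j in D) (lab i (up j x) + lab i x) * cup s' (D :\ j) (up j x)
  else 1.

Fixpoint boxsum (s : seq 'I_n) (G : X -> 'F_2) (x : X) : 'F_2 :=
  if s is i :: s' then \sum_(k < p) boxsum s' G (upd i k x) else G x.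

Lemma addF2 (u : 'F_2) : u + u = 0.
Proof. by rewrite -mulr2n; case: u => -[|[|?]] ? //; apply/val_inj. Qed.

Lemma upC i j x : up i (up j x) = up j (up i x).
Proof. by apply/ffunP => k; rewrite !ffunE addnAC. Qed.

Lemma sum_offdiag_sym (D : {set 'I_n}) (F : 'I_n -> 'I_n -> 'F_2) :
  (forall i j, F i j = F j i) ->
  \sum_(i in D) \sum_(j in D :\ i) F i j = 0.
Proof.
move=> Fsym.
have split2 i : i \in D -> \sum_(j in D :\ i) F i j =
    \sum_(j in D | (i < j)%N) F i j + \sum_(j in D | (j < i)%N) F i j.
  move=> iD; rewrite (bigID (fun j : 'I_n => (i < j)%N)) /=; congr (_ + _).
    apply: eq_bigl => j; rewrite !inE; case: (ltnP i j) => //; rewrite ?andbT ?andbF//.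
    by move=> ij; rewrite -val_eqE /= gtn_eqF.
  apply: eq_bigl => j; rewrite !inE -val_eqE /= -leqNgt.
  by case: ltngtP => //; rewrite ?andbT ?andbF.
rewrite (eq_bigr _ split2) big_split /=.
have -> : \sum_(i in D) \sum_(j in D | (j < i)%N) F i j =
          \sum_(i in D) \sum_(j in D | (i < j)%N) F i j.
  rewrite (exchange_big_dep (mem D)) /=; last by move=> i j _ /andP[].
  apply: eq_bigr => j jD; under eq_bigr do rewrite Fsym.
  by apply: eq_bigl => i; rewrite jD.
exact: addF2.
Qed.

Lemma sum_offdiagC (D : {set 'I_n}) (F : 'I_n -> 'I_n -> 'F_2) :
  \sum_(i in D) \sum_(j in D :\ i) F i j = \sum_(i in D) \sum_(j in D :\ i) F j i.
Proof.
rewrite (exchange_big_dep (mem D)) /=; last first.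
  by move=> i j _; rewrite !inE => /andP[].
apply: eq_bigr => j jD; apply: eq_bigl => i.
by rewrite !inE jD andbT eq_sym andbC.
Qed.

Lemma sum_offdiagD (D : {set 'I_n}) (F G : 'I_n -> 'I_n -> 'F_2) :
  \sum_(i in D) \sum_(j in D :\ i) (F i j + G i j) =
  \sum_(i in D) \sum_(j in D :\ i) F i j + \sum_(i in D) \sum_(j in D :\ i) G i j.
Proof. by rewrite -big_split; apply: eq_bigr => i _; rewrite -big_split. Qed.

(** The cup product of the exact cochains d(lab i) is closed: in the expansion of its
    coboundary the terms that are symmetric in two directions cancel mod 2. *)
Lemma cup_closed s (D : {set 'I_n}) x :
  \sum_(j in D) (cup s (D :\ j) (up j x) + cup s (D :\ j) x) = 0.
Proof.
elim: s D x => [|i s IH] D x /=.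
  by rewrite big1 // => j _; exact: addF2.
have DC (j k : 'I_n) : D :\ j :\ k = D :\ k :\ j.
  by apply/setP => m; rewrite !inE andbCA.
set W := cup s.
pose A j k := lab i (up k (up j x)) * W (D :\ j :\ k) (up k (up j x)).
pose B j k := lab i (up j x) * W (D :\ j :\ k) (up k (up j x)).
pose C j k := lab i (up k x) * W (D :\ j :\ k) (up k x).
pose B' j k := lab i (up j x) * W (D :\ j :\ k) (up j x).
pose E j k := lab i x * W (D :\ j :\ k) (up k x).
pose E' j k := lab i x * W (D :\ j :\ k) x.
transitivity (\sum_(j in D) \sum_(k in D :\ j) (A j k + B j k + (C j k + E j k))).
  apply: eq_bigr => j _; rewrite -big_split; apply: eq_bigr => k _ /=.
  by rewrite /A /B /C /E !mulrDl.
transitivity (\sum_(j in D) \sum_(k in D :\ j) (B j k + B' j k)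
            + \sum_(j in D) \sum_(k in D :\ j) (E j k + E' j k)).
  rewrite !sum_offdiagD.
  rewrite (@sum_offdiag_sym _ A) ?add0r; last by move=> j k; rewrite /A upC DC.
  rewrite (@sum_offdiag_sym _ E') ?addr0; last by move=> j k; rewrite /E' DC.
  rewrite -addrA; congr (_ + (_ + _)).
  by rewrite sum_offdiagC; apply: eq_bigr => j _; apply: eq_bigr => k _; rewrite /C /B' DC.
rewrite !big1 ?addr0 // => j _.
  transitivity (lab i x * \sum_(k in D :\ j) (W (D :\ j :\ k) (up k x) + W (D :\ j :\ k) x)).
    by rewrite mulr_sumr; apply: eq_bigr => k _; rewrite mulrDr.
  by rewrite IH mulr0.
transitivity (lab i (up j x) * \sum_(k in D :\ j)
    (W (D :\ j :\ k) (up k (up j x)) + W (D :\ j :\ k) (up j x))).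
  by rewrite mulr_sumr; apply: eq_bigr => k _; rewrite mulrDr.
by rewrite IH mulr0.
Qed.

Lemma boxsum_ext (s : seq 'I_n) (G H : X -> 'F_2) (x : X) :
  (forall y : X, (forall j, j \notin s -> y j = x j) ->
     (forall j, j \in s -> (y j < p)%N) -> G y = H y) ->
  boxsum s G x = boxsum s H x.
Proof.
elim: s x => [|i s IH] x GH /=; first by apply: GH.
apply: eq_bigr => k _; apply: IH => y yx ys; apply: GH => j.
  rewrite inE negb_or => /andP[ji js]; rewrite yx // ffunE (negbTE ji) //.
rewrite inE; case: (boolP (j \in s)) => [js _|js]; first exact: ys.
by rewrite orbF => /eqP ->; case: (boolP (i \in s)) => [/ys//|ns]; rewrite yx // ffunE eqxx.
Qed.

Lemma boxsum0 (s : seq 'I_n) (x : X) : boxsum s (fun=> 0) x = 0.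
Proof. by elim: s x => //= i s IH x; rewrite big1. Qed.

Lemma boxsumD (s : seq 'I_n) (G H : X -> 'F_2) (x : X) :
  boxsum s (fun y => G y + H y) x = boxsum s G x + boxsum s H x.
Proof.
by elim: s x => //= i s IH x; under eq_bigr do rewrite IH; rewrite big_split.
Qed.

Lemma boxsum_sum (s : seq 'I_n) (D : {set 'I_n}) (G : 'I_n -> X -> 'F_2) x :
  boxsum s (fun y => \sum_(j in D) G j y) x = \sum_(j in D) boxsum s (G j) x.
Proof.
elim: s x => //= i s IH x; under eq_bigr do rewrite IH.
by rewrite exchange_big.
Qed.

Lemma boxsum_up (s : seq 'I_n) i (G : X -> 'F_2) (x : X) : i \notin s ->
  boxsum s (fun y => G (up i y)) x = boxsum s G (up i x).
Proof.
elim: s x => //= j s IH x; rewrite inE negb_or => /andP[ij js].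
apply: eq_bigr => k _; rewrite IH //; congr (boxsum _ _ _).
apply/ffunP => m; rewrite !ffunE; case: (eqVneq m j) => // ->.
by rewrite eq_sym (negbTE ij) addn0.
Qed.

Lemma boxsum_head (s : seq 'I_n) i (G : X -> 'F_2) (x : X) : i \notin s ->
  boxsum (i :: s) (fun y => G (up i y) + G y) x =
  boxsum s G (upd i p x) + boxsum s G (upd i 0%N x).
Proof.
move=> ns /=.
under eq_bigr => k _ do rewrite boxsumD boxsum_up //.
have E (k : nat) : up i (upd i k x) = upd i k.+1 x.
  by apply/ffunP => m; rewrite !ffunE; case: eqP; rewrite ?addn1 ?addn0.
under eq_bigr => k _ do rewrite E.
rewrite -(big_mkord xpredT (fun k => boxsum s G (upd i k.+1 x) + boxsum s G (upd i k x))).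
elim: (p) => [|q IH]; first by rewrite big_nil addF2.
by rewrite big_nat_recr //= IH [X in _ + X]addrC addrACA addF2 add0r addrC.
Qed.

(** Along a direction the sum of a coboundary telescopes to its two end faces. *)
Lemma boxsum_tele0 (s : seq 'I_n) i (G : X -> 'F_2) (x : X) : i \in s -> uniq s ->
  (forall y : X, y i = 0%N \/ y i = p -> G y = 0) ->
  boxsum s (fun y => G (up i y) + G y) x = 0.
Proof.
move=> is_ us G0; elim: s x is_ us => // j s IH x.
rewrite inE cons_uniq => /orP[/eqP <-|is_] /andP[js us].
  have Z m : m = 0%N \/ m = p -> boxsum s G (upd i m x) = 0.
    move=> mE; rewrite -[RHS](boxsum0 s (upd i m x)); apply: boxsum_ext => y yx _.
    by apply: G0; rewrite yx // ffunE eqxx.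
  by rewrite boxsum_head // !Z ?addr0; [|left|right].
by rewrite [LHS]big1 // => k _; exact: IH.
Qed.

Hypothesis lab0 : forall i (x : X), x i = 0%N -> lab i x = 0.
Hypothesis lab1 : forall i (x : X), x i = p -> lab i x = 1.

(** On a face of the box orthogonal to i the label i is constant, so that the
    factor d(lab i) vanishes on it. *)
Lemma cup_face s (D : {set 'I_n}) i (x : X) : i \in s -> i \notin D ->
  x i = 0%N \/ x i = p -> cup s D x = 0.
Proof.
elim: s D x => // j s IH D x; rewrite inE => + iD xi /=.
have upE k : k \in D -> up k x i = x i.
  by move=> kD; rewrite ffunE; case: eqP iD => [->|_ _]; rewrite ?kD ?addn0.
case/orP=> [/eqP <-|is_]; apply: big1 => k kD.
  by case: xi => xi; [rewrite !lab0 ?upE // addr0 mul0r|rewrite !lab1 ?upE // addF2 mul0r].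
rewrite (IH _ (up k x)) ?mulr0 ?upE //.
by rewrite !inE negb_and iD orbT.
Qed.

(** The cup product is the coboundary of lab i times the product of the other
    factors.  By the discrete Stokes formula only the faces of the box contribute; the
    side faces give 0 by [cup_face], the face where lab i = 0 gives 0, and the face
    where lab i = 1 is the same sum in one dimension less. *)
Lemma boxsum_cup s x : uniq s -> boxsum s (cup s [set j in s]) x = 1.
Proof.
elim: s x => // i s IH x us; have /andP[ns us'] := us.
set D := [set j in i :: s].
pose H j y := lab i y * cup s (D :\ j) y.
have iD : i \in D by rewrite !inE eqxx.
have Di : D :\ i = [set j in s].
  by apply/setP => j; rewrite !inE; case: eqP => // ->; rewrite (negbTE ns).
transitivity (boxsum (i :: s) (fun y =>
    (H i (up i y) + H i y) + \sum_(j in D :\ i) (H j (up j y) + H j y)) x).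
  apply: boxsum_ext => y _ _; rewrite -(big_setD1 i) //=.
  transitivity (\sum_(j in D) (H j (up j y) + H j y) +
    lab i y * \sum_(j in D) (cup s (D :\ j) (up j y) + cup s (D :\ j) y)).
    rewrite mulr_sumr -big_split; apply: eq_bigr => j _ /=.
    rewrite /H mulrDl mulrDr -!addrA; congr (_ + _).
    by rewrite [RHS]addrCA addF2 addr0.
  by rewrite cup_closed mulr0 addr0.
rewrite boxsumD boxsum_head // boxsum_sum big1 ?addr0; last first.
  move=> j; rewrite Di inE => js; apply: boxsum_tele0 => // [|y yj].
    by rewrite inE js orbT.
  by rewrite /H (@cup_face s _ j) ?mulr0 // !inE eqxx.
rewrite -[RHS]addr0; congr (_ + _).
  rewrite -(IH (upd i p x)) //; apply: boxsum_ext => y yx _.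
  by rewrite /H lab1 ?mul1r ?Di // yx // ffunE eqxx.
rewrite -[RHS](boxsum0 s (upd i 0%N x)); apply: boxsum_ext => y yx _.
by rewrite /H lab0 ?mul0r // yx // ffunE eqxx.
Qed.

Lemma boxsum_neq0 (s : seq 'I_n) (G : X -> 'F_2) (x : X) : boxsum s G x != 0 ->
  exists y : X, [/\ G y != 0, forall j, j \in s -> (y j < p)%N &
                forall j, j \notin s -> y j = x j].
Proof.
move=> nz; apply: contrapT => nE; move/eqP: nz; apply.
rewrite -[RHS](boxsum0 s x); apply: boxsum_ext => y yx ys.
by apply/eqP/negPn/negP => Gy; apply: nE; exists y; split.
Qed.

(** A nonzero product has a nonzero factor d(lab i), hence an edge of the cell on
    which the label i changes. *)
Lemma cup_neq0 s (D : {set 'I_n}) y i : i \in s -> cup s D y != 0 ->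
  exists z z' : X, [/\ forall j, (y j <= z j <= (y j).+1)%N,
    forall j, (y j <= z' j <= (y j).+1)%N, lab i z = 0 & lab i z' = 1].
Proof.
move=> is_ nz.
suff : exists z z' : X, [/\ forall j, (y j <= z j <= y j + (j \in D))%N,
    forall j, (y j <= z' j <= y j + (j \in D))%N & lab i z != lab i z'].
  move=> [z [z' [hz hz' ne]]].
  have hS u : (forall j, (y j <= u j <= y j + (j \in D))%N) ->
      forall j, (y j <= u j <= (y j).+1)%N.
    move=> hu j; case/andP: (hu j) => -> /= h; apply: leq_trans h _.
    by rewrite -addn1 leq_add2l; case: (j \in D).
  have F2 (u : 'F_2) : u = 0 \/ u = 1.
    by case: u => -[|[|?]] ? //; [left|right]; apply/val_inj.
  case: (F2 (lab i z)) (F2 (lab i z')) => e [] e'; move: ne; rewrite e e' ?eqxx // => _.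
    by exists z, z'; split => //; exact: hS.
  by exists z', z; split => //; exact: hS.
elim: s D y is_ nz => // j s IH D y; rewrite inE => is_ /=.
have [/existsP[k /andP[kD nz]] _|/existsPn allz] :=
    boolP [exists k, (k \in D) && ((lab j (up k y) + lab j y) * cup s (D :\ k) (up k y) != 0)];
  last first.
  move=> /eqP[]; apply: big1 => k kD; apply/eqP/negPn.
  by have := allz k; rewrite kD.
move: nz; rewrite mulf_eq0 negb_or => /andP[nz1 nz2].
have upb m : (y m <= up k y m <= y m + (m \in D))%N.
  by rewrite ffunE leq_addr leq_add2l; case: eqP => // ->; rewrite kD.
case/orP: is_ => [/eqP ->|is_].
  exists (up k y), y; split => // [m|]; first by rewrite leqnn leq_addr.
  by apply/negP => /eqP e; rewrite e addF2 eqxx in nz1.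
have [z [z' [hz hz' ne]]] := IH _ _ is_ nz2.
have aux u : (forall m, (up k y m <= u m <= up k y m + (m \in D :\ k))%N) ->
   forall m, (y m <= u m <= y m + (m \in D))%N.
  move=> hu m; have := hu m; rewrite !ffunE !inE; case: eqP => [->|_] /=.
    by rewrite kD addn0 => /andP[h ->]; rewrite (leq_trans _ h) // leq_addr.
  by rewrite addn0.
by exists z, z'; split => //; exact: aux.
Qed.

(** Kuhn's cubical form of Sperner's lemma: the number of cells carrying a nonzero cup
    product is odd by [boxsum_cup]. *)
Lemma bichromatic_cell : exists y : X, (forall i, (y i < p)%N) /\
  forall i, exists z z' : X, [/\ forall j, (y j <= z j <= (y j).+1)%N,
    forall j, (y j <= z' j <= (y j).+1)%N, lab i z = 0 & lab i z' = 1].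
Proof.
have := boxsum_cup [ffun=> 0%N] (enum_uniq 'I_n).
move=> e; have : boxsum (enum 'I_n) (cup (enum 'I_n) [set j in enum 'I_n]) [ffun=> 0%N] != 0.
  by rewrite e oner_eq0.
move=> /boxsum_neq0[y [nz yp _]]; exists y; split=> [i|i].
  by apply: yp; rewrite mem_enum.
by apply: cup_neq0 nz; rewrite mem_enum.
Qed.

End CubicalCup.

(** * Zeros and fixed points of continuous maps *)

Section FixedPoints.
Variable R : realType.

Lemma cvg_sumr (U : Type) (F : set_system U) (FF : Filter F) (I : Type) (s : seq I)
    (f : I -> U -> R) (l : I -> R) :
  (forall i, f i x @[x --> F] --> l i) ->
  \sum_(i <- s) f i x @[x --> F] --> \sum_(i <- s) l i.
Proof.
move=> fl; elim: s => [|i s IH].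
  by rewrite big_nil; under eq_fun do rewrite big_nil; exact: cvg_cst.
by rewrite big_cons; under eq_fun do rewrite big_cons; exact: cvgD.
Qed.

Lemma continuous_sumr (X : topologicalType) (I : Type) (s : seq I)
    (f : I -> X -> R) :
  (forall i, continuous (f i)) -> continuous (fun x => \sum_(i <- s) f i x).
Proof. by move=> fc x; apply: cvg_sumr => i; exact: fc. Qed.

Lemma continuous_nbhs_gt0 (X : topologicalType) (g : X -> R) (x : X) :
  continuous g -> 0 < g x -> nbhs x [set y | 0 < g y].
Proof. by move=> gc gx; exact: (gc x _ (lt_nbhsr gx)). Qed.

Lemma continuous_truncation (X : topologicalType) (s : X -> R) (r : R) :
  0 < r -> continuous s -> continuous (fun x => r / Num.max r (s x)).
Proof.
move=> r0 sc x; apply: (cvgM (cvg_cst r)).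
apply: cvgV; first by rewrite gt_eqF // lt_max r0.
by apply: (@continuous_max _ _ (cst r)); [exact: cst_continuous|exact: sc].
Qed.

Lemma affine_segment (r u : R) : 0 < r -> 0 <= u <= 1 -> `|- r + 2 * r * u| <= r.
Proof. by move=> r0 /andP[u0 u1]; rewrite ler_norml; apply/andP; split; nra. Qed.

Definition grid_point n (r : R) (p : nat) (y : {ffun 'I_n -> nat}) : 'rV[R]_n :=
  \row_i (- r + 2 * r * ((y i)%:R / p%:R)).

(** Label a grid point by the signs of the f i; a cell on which every label
    takes both values exists on each grid, and a cluster point of such cells, as the
    grid is refined, is a common zero. *)
Lemma poincare_miranda n (r : R) (f : 'I_n -> 'rV[R]_n -> R) : 0 < r ->
  (forall i, continuous (f i)) ->
  (forall i (x : 'rV[R]_n), (forall j, `|x 0 j| <= r) -> x 0 i = - r -> f i x <= 0) ->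
  (forall i (x : 'rV[R]_n), (forall j, `|x 0 j| <= r) -> x 0 i = r -> 0 <= f i x) ->
  exists x, forall i, f i x = 0.
Proof.
move=> r0 fc fm fp.
have /choice[y_ yP] : forall q, exists y : {ffun 'I_n -> nat},
   (forall i, (y i < q.+1)%N) /\
   forall i, exists z z' : {ffun 'I_n -> nat},
    [/\ forall j, (y j <= z j <= (y j).+1)%N,
    forall j, (y j <= z' j <= (y j).+1)%N,
    f i (grid_point r q.+1 z) <= 0 & 0 <= f i (grid_point r q.+1 z')].
  move=> q.
  (* On the two faces orthogonal to i the label is prescribed, which agrees with the
     sign conditions there. *)
  pose lab i (x : {ffun 'I_n -> nat}) : 'F_2 :=
    if x i == 0%N then 0 else if x i == q.+1 then 1
    else if 0 < f i (grid_point r q.+1 x) then 1 else 0.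
  have lab0 i (x : {ffun 'I_n -> nat}) : x i = 0%N -> lab i x = 0 by rewrite /lab => ->.
  have lab1 i (x : {ffun 'I_n -> nat}) : x i = q.+1 -> lab i x = 1 by rewrite /lab => ->; rewrite eqxx.
  have [y [yq yz]] := bichromatic_cell lab0 lab1.
  exists y; split => // i; have [z [z' [hz hz' e e']]] := yz i.
  have inb (u : {ffun 'I_n -> nat}) : (forall j, (y j <= u j <= (y j).+1)%N) ->
      forall j, `|grid_point r q.+1 u 0 j| <= r.
    move=> hu j; rewrite mxE.
    have : (u j <= q.+1)%N by case/andP: (hu j) => _ /leq_trans; apply.
    rewrite -(ler_nat R) => uq.
    by apply: affine_segment => //; rewrite divr_ge0 //= ler_pdivrMr ?ltr0n // mul1r.
  exists z, z'; split => //.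
    move: e; rewrite /lab; case: eqP => [zi _|_].
      by apply: fm; [exact: inb|rewrite mxE zi mul0r mulr0 addr0].
    by case: eqP => // _; case: ltP.
  move: e'; rewrite /lab; case: eqP => // _; case: eqP => [zi _|_].
    by apply: fp; [exact: inb|rewrite mxE zi divff // mulr1; lra].
  by case: ltP => // /ltW.
pose A := [set v : 'rV[R]_n | forall i, `[- r, r]%classic (v ord0 i)].
have cA : compact A by apply: (@rV_compact _ _ (fun=> `[- r, r]%classic)) => _; exact: segment_compact.
pose x_ q := grid_point r q.+1 (y_ q).
have xA q : A (x_ q).
  move=> i; rewrite mxE /= in_itv /=.
  have := (yP q).1 i; rewrite -(ltr_nat R) => /ltW yq.
  rewrite -ler_norml; apply: affine_segment => //.
  by rewrite divr_ge0 //= ler_pdivrMr ?ltr0n // mul1r.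
have [x [_ xcl]] := cA (x_ @ \oo) _ (filterE _ xA).
exists x => i.
have key (B : set 'rV[R]_n) : nbhs x B -> exists z z' : 'rV[R]_n,
    [/\ B z, B z', f i z <= 0 & 0 <= f i z'].
  move=> /nbhs_ballP[e /= e0 xB].
  have [q0 q0e] : exists q0 : nat, forall q, (q0 <= q)%N -> 2 * r / q.+1%:R < e / 2.
    exists (Num.truncn (2 * r / (e / 2))) => q hq.
    rewrite ltr_pdivrMr ?ltr0n // [ltRHS]mulrC -ltr_pdivrMr ?divr_gt0 //.
    by apply: lt_le_trans (truncnS_gt _) _; rewrite ler_nat.
  have e20 : 0 < e / 2 by rewrite divr_gt0.
  have [|w [[q /= q0q <-]]] := (xcl (x_ @` [set q | (q0 <= q)%N]) (ball x (e / 2)) _ (nbhsx_ballx _ _ e20)).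
    by exists q0 => // q /= ?; exists q.
  move=> xq; have [z [z' [hz hz' e1 e2]]] := (yP q).2 i.
  exists (grid_point r q.+1 z), (grid_point r q.+1 z').
  have inB (u : {ffun 'I_n -> nat}) : (forall j, (y_ q j <= u j <= (y_ q j).+1)%N) -> B (grid_point r q.+1 u).
    move=> hu; apply: xB; rewrite [e]splitr; apply: ball_triangle xq _.
    split; first by rewrite divr_gt0.
    move=> i0 j; rewrite /ball /= !mxE.
    apply: le_lt_trans (q0e _ q0q).
    rewrite opprD addrACA subrr add0r -mulrBr -mulrBl normrM (gtr0_norm (mulr_gt0 _ r0)) //.
    rewrite ler_pM2l ?mulr_gt0 // normrM [X in _ * X]ger0_norm ?invr_ge0 //.
    rewrite -[leRHS]mul1r ler_wpM2r ?invr_ge0 //.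
    have /andP[] := hu j; rewrite -(ler_nat R) -(ler_nat R (u j)) -natr1 => h1 h2.
    by rewrite ler_norml; lra.
  by split => //; exact: inB.
apply/eqP; rewrite eq_le; apply/andP; split; rewrite leNgt; apply/negP => fx.
  have /key[z [z' [Bz _ ez _]]] := continuous_nbhs_gt0 (fc i) fx.
  by move: Bz; rewrite /= ltNge ez.
have fN : continuous (fun y => - f i y) by move=> y; exact: (cvgN (fc i y)).
have fx' : 0 < - f i x by rewrite oppr_gt0.
have /key[z [z' [_ Bz _ ez]]] := continuous_nbhs_gt0 fN fx'.
by move: Bz; rewrite /= oppr_gt0 ltNge ez.
Qed.

Lemma dotv_ge0 n (u : 'rV[R]_n) : 0 <= dotv u u.
Proof. by apply: sumr_ge0 => i _; rewrite -expr2 sqr_ge0. Qed.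

Lemma dotvZ n (c : R) (u : 'rV[R]_n) : dotv (c *: u) (c *: u) = c ^+ 2 * dotv u u.
Proof. by rewrite /dotv mulr_sumr; apply: eq_bigr => i _; rewrite !mxE; ring. Qed.

Lemma sqr_coord_le_dotv n (u : 'rV[R]_n) i : (u 0 i) ^+ 2 <= dotv u u.
Proof.
rewrite /dotv (bigD1 i) //= expr2 lerDl; apply: sumr_ge0 => j _.
by rewrite -expr2 sqr_ge0.
Qed.

(** The map z |-> c(z) T(z), truncated to the ball of radius r, has a fixed point by
    [poincare_miranda] applied to z - c(z) T(z).  Where the truncation is active the
    fixed point is z = c T(z) with |z| = r and 0 < c < 1, which is excluded. *)
Lemma schaefer_fixpoint n (T : 'rV[R]_n -> 'rV[R]_n) (r : R) : 0 < r ->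
  (forall i, continuous (fun z => T z 0 i)) ->
  (forall z t, 0 < t < 1 -> z = t *: T z -> dotv z z < r ^+ 2) ->
  exists z, z = T z.
Proof.
move=> r0 Tc bd.
pose s z := Num.sqrt (dotv (T z) (T z)).
have s0 z : 0 <= s z by exact: sqrtr_ge0.
pose c z := r / Num.max r (s z).
have m0 z : 0 < Num.max r (s z) by rewrite lt_max r0.
have c0 z : 0 < c z by rewrite divr_gt0.
have sc : continuous s.
  move=> z; apply: (@continuous_comp _ _ _ (fun z => dotv (T z) (T z)) Num.sqrt); last exact: sqrt_continuous.
  rewrite /dotv; apply: continuous_sumr => i y.
  exact: (cvgM (Tc i y) (Tc i y)).
have cc : continuous c by exact: continuous_truncation.
have cTr z i : `|c z * T z 0 i| <= r.
  rewrite normrM gtr0_norm // /c mulrAC ler_pdivrMr // ler_pM2l //.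
  rewrite le_max; apply/orP; right.
  by rewrite -sqrtr_sqr ler_wsqrtr // sqr_coord_le_dotv.
have [|||z zP] := @poincare_miranda n r (fun i z => z 0 i - c z * T z 0 i) r0.
- by move=> i z; exact: (cvgB (@coord_continuous _ _ _ 0 i z) (cvgM (cc z) (Tc i z))).
- by move=> i z _ ->; have := cTr z i; rewrite ler_norml => /andP[h1 h2]; lra.
- by move=> i z _ ->; have := cTr z i; rewrite ler_norml => /andP[h1 h2]; lra.
have zE : z = c z *: T z by apply/rowP => i; rewrite mxE; apply/eqP; rewrite -subr_eq0 zP.
have [sr|rs] := leP (s z) r.
  by exists z; rewrite {1}zE /c max_l // divff ?scale1r // gt_eqF.
have sz0 : 0 < s z by exact: lt_trans rs.
have cE : c z = r / s z by rewrite /c max_r // ltW.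
have : dotv z z < r ^+ 2.
  by apply: (bd z (c z)) => //; rewrite c0 cE ltr_pdivrMr // mul1r.
rewrite {1 2}zE dotvZ -[dotv (T z) (T z)]sqr_sqrtr ?dotv_ge0 // -/(s z) cE.
by rewrite -exprMn divfK ?gt_eqF // ltxx.
Qed.

(** For z = t T(z) the two inequalities combine to |z|^2 <= t C E0, the bound that
    [schaefer_fixpoint] asks for. *)
Lemma dissipative_fixpoint n (T G : 'rV[R]_n -> 'rV[R]_n) (C E0 : R) :
  (forall i, continuous (fun z => T z 0 i)) -> 0 <= C -> 0 <= E0 ->
  (forall z, dotv (T z) (T z) <= - C * dotv (G z) (T z)) ->
  (forall z, - E0 <= dotv (G z) z) ->
  exists z, z = T z.
Proof.
move=> Tc C0 E00 TG GE.
have CE : 0 <= C * E0 by rewrite mulr_ge0.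
apply: (@schaefer_fixpoint n T (C * E0 + 1)) => //; first lra.
move=> z t /andP[t0 t1] zE.
have e : dotv z z = t ^+ 2 * dotv (T z) (T z) by rewrite {1 2}zE dotvZ.
have e2 : dotv (G z) z = t * dotv (G z) (T z).
  by rewrite {2}zE /dotv mulr_sumr; apply: eq_bigr => i _; rewrite mxE; ring.
have h1 := TG z; have h2 := GE z; rewrite e2 in h2.
have h3 : t ^+ 2 * dotv (T z) (T z) <= t * (C * E0).
  have -> : t * (C * E0) = t ^+ 2 * (C * (E0 / t)) by field; rewrite gt_eqF.
  rewrite ler_wpM2l ?sqr_ge0 // (le_trans h1) // mulNr -mulrN ler_wpM2l //.
  by rewrite ler_pdivlMr // mulNr mulrC; lra.
rewrite e; nra.
Qed.

End FixedPoints.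

(** * Real-valued integrals and square-integrable functions *)

Section SquareIntegrable.
Context d (X : measurableType d) (R : realType) (mu : {measure set X -> \bar R}).
Implicit Types f g : X -> R.

Definition Rintegrable f : Prop := mu.-integrable setT (EFin \o f).

Lemma Rint_measurable f : Rintegrable f -> measurable_fun setT f.
Proof. by move=> /integrableP[/measurable_EFinP]. Qed.

Lemma RintD f g : Rintegrable f -> Rintegrable g -> Rintegrable (fun x => f x + g x).
Proof.
move=> hf hg; rewrite /Rintegrable; have := integrableD measurableT hf hg.
by apply: eq_integrable.
Qed.

Lemma RintZ c f : Rintegrable f -> Rintegrable (fun x => c * f x).
Proof.
move=> hf; rewrite /Rintegrable; have := integrableZl measurableT c hf.
by apply: eq_integrable.
Qed.

Lemma Rint0 : Rintegrable (fun=> 0).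
Proof. exact: integrable0. Qed.

Lemma Rint_sum (I : Type) (s : seq I) (F : I -> X -> R) :
  (forall i, Rintegrable (F i)) -> Rintegrable (fun x => \sum_(i <- s) F i x).
Proof.
move=> hF; elim: s => [|i s IH].
  by under eq_fun do rewrite big_nil; exact: Rint0.
by under eq_fun do rewrite big_cons; exact: RintD.
Qed.

Lemma Rintegral_add f g : Rintegrable f -> Rintegrable g ->
  \int[mu]_x (f x + g x) = \int[mu]_x f x + \int[mu]_x g x.
Proof. by move=> hf hg; rewrite RintegralD. Qed.

Lemma Rintegral_scale c f : Rintegrable f -> \int[mu]_x (c * f x) = c * \int[mu]_x f x.
Proof. by move=> hf; rewrite RintegralZl. Qed.

Lemma Rintegral_sum (I : Type) (s : seq I) (F : I -> X -> R) :
  (forall i, Rintegrable (F i)) ->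
  \int[mu]_x (\sum_(i <- s) F i x) = \sum_(i <- s) \int[mu]_x F i x.
Proof.
move=> hF; elim: s => [|i s IH].
  rewrite big_nil; under eq_Rintegral do rewrite big_nil.
  by rewrite Rintegral_cst // mul0r.
rewrite big_cons -IH -Rintegral_add //; last exact: Rint_sum.
by apply: eq_Rintegral => x _; rewrite big_cons.
Qed.

Lemma Rint_le f g : measurable_fun setT f -> Rintegrable g ->
  (forall x, `|f x| <= g x) -> Rintegrable f.
Proof.
move=> mf hg fg; apply: (le_integrable measurableT _ _ hg).
  exact/measurable_EFinP.
by move=> x _ /=; rewrite lee_fin (le_trans (fg x)) // ler_norm.
Qed.

Lemma Rint_ae_le f g : measurable_fun setT f -> Rintegrable g ->
  {ae mu, forall x, `|f x| <= g x} -> Rintegrable f.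
Proof.
move=> mf hg fg.
have mf' : measurable_fun setT (EFin \o f) by exact/measurable_EFinP.
apply/integrableP; split => //.
case/integrableP : hg => mg; apply: le_lt_trans.
apply: ae_ge0_le_integral => //.
- exact: measurableT_comp.
- exact: measurableT_comp.
by apply: (@filterS _ (almost_everywhere mu) _ _ _ _ fg) => x e _ /=; rewrite lee_fin (le_trans e) // ler_norm.
Qed.

Lemma Rintegral_ae f g : measurable_fun setT f -> measurable_fun setT g ->
  {ae mu, forall x, f x = g x} -> \int[mu]_x f x = \int[mu]_x g x.
Proof.
move=> mf mg fg; congr fine; apply: ae_eq_integral => //;
  try exact/measurable_EFinP.
by apply: (@filterS _ (almost_everywhere mu) _ _ _ _ fg) => x e _ /=; rewrite e.
Qed.

Lemma Rintegral_dominated (f_ : nat -> X -> R) f g :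
  (forall n, measurable_fun setT (f_ n)) -> measurable_fun setT f ->
  Rintegrable g ->
  {ae mu, forall x, f_ n x @[n --> \oo] --> f x} ->
  {ae mu, forall x n, `|f_ n x| <= g x} ->
  \int[mu]_x f_ n x @[n --> \oo] --> \int[mu]_x f x.
Proof.
move=> mf_ mf hg cv bd.
have cv' : {ae mu, forall x, setT x -> (EFin \o f_ n) x @[n --> \oo] --> (EFin \o f) x}.
  apply: (@filterS _ (almost_everywhere mu) _ _ _ _ cv) => x h _.
  by apply: cvg_EFin => //; exact: nearW.
have bd' : {ae mu, forall x n, setT x -> (`|(EFin \o f_ n) x| <= (EFin \o g) x)%E}.
  by apply: (@filterS _ (almost_everywhere mu) _ _ _ _ bd) => x h n _; rewrite /= lee_fin.
have [hi _ h2] := @dominated_convergence _ X R mu setT measurableT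
  (fun n => EFin \o f_ n) (EFin \o f) (EFin \o g)
  (fun n => iffRL (measurable_EFinP _ _) (mf_ n))
  (iffRL (measurable_EFinP _ _) mf) cv' hg bd'.
apply: fine_cvg; rewrite fineK //; exact: (integrable_fin_num measurableT hi).
Qed.

Definition L2 f : Prop := f \in Lfun mu 2%:E.

Lemma L2P f : L2 f <-> measurable_fun setT f /\ Rintegrable (fun x => f x ^+ 2).
Proof.
split.
  move=> hf; split; last exact: Lfun2_integrable_sqr.
  by move: hf; rewrite /L2 inE => /andP[]; rewrite inE.
move=> [mf hf]; rewrite /L2 inE; apply/andP; split; rewrite inE //=.
rewrite /finite_norm unlock poweR_lty //.
case/integrableP : hf => _; congr (_ < _)%E; apply: eq_integral => x _ /=.
by rewrite powR_mulrn // ger0_norm ?sqr_ge0 // real_normK ?num_real.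
Qed.

Lemma L2_measurable f : L2 f -> measurable_fun setT f.
Proof. by move=> /L2P[]. Qed.

Lemma L2_mul f g : L2 f -> L2 g -> Rintegrable (fun x => f x * g x).
Proof. by move=> hf hg; apply/Lfun1_integrable; exact: Lfun2_mul_Lfun1. Qed.

Lemma L2D f g : L2 f -> L2 g -> L2 (fun x => f x + g x).
Proof.
move=> hf hg; apply/L2P; split.
  by apply: measurable_funD; exact: L2_measurable.
have h := RintD (RintD (L2_mul hf hf) (RintZ 2 (L2_mul hf hg))) (L2_mul hg hg).
by move: h; rewrite /Rintegrable; apply: eq_integrable => // x _ /=; congr EFin; ring.
Qed.

Lemma L2Z c f : L2 f -> L2 (fun x => c * f x).
Proof.
move=> hf; apply/L2P; split.
  by apply: measurable_funM => //; exact: L2_measurable.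
have := RintZ (c ^+ 2) (L2_mul hf hf).
by rewrite /Rintegrable; apply: eq_integrable => // x _ /=; congr EFin; ring.
Qed.

Lemma L20 : L2 (fun=> 0).
Proof.
apply/L2P; split => //; have := Rint0; rewrite /Rintegrable.
by apply: eq_integrable => // x _ /=; rewrite expr0n.
Qed.

Lemma L2_sum (I : Type) (s : seq I) (F : I -> X -> R) :
  (forall i, L2 (F i)) -> L2 (fun x => \sum_(i <- s) F i x).
Proof.
move=> hF; elim: s => [|i s IH].
  by under eq_fun do rewrite big_nil; exact: L20.
by under eq_fun do rewrite big_cons; exact: L2D.
Qed.

Hypothesis mu_fin : (mu setT < +oo)%E.

Lemma Rint_cst c : Rintegrable (fun=> c).
Proof.
apply/integrableP; split; first exact: measurable_cst.
rewrite (eq_integral (cst `|c|%:E)) //.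
by rewrite integral_cst // lte_mul_pinfty.
Qed.

Lemma L2_bounded f B : measurable_fun setT f ->
  {ae mu, forall x, `|f x| <= B} -> L2 f.
Proof.
move=> mf fB; apply/L2P; split => //; apply: (Rint_ae_le (g := fun=> B ^+ 2)).
- exact: measurable_funX.
- exact: Rint_cst.
apply: (@filterS _ (almost_everywhere mu) _ _ _ _ fB) => x h.
by rewrite normrX lerXn2r // nnegrE (le_trans _ h).
Qed.

Lemma L2_Rint f : L2 f -> Rintegrable f.
Proof.
move=> hf; have := L2_mul hf (@L2_bounded (fun=> 1) 1 _ _).
move=> /(_ (measurable_cst _)) h; have : Rintegrable (fun x => f x * 1).
  by apply: h; apply: aeW => x; rewrite normr1.
by rewrite /Rintegrable; apply: eq_integrable => // x _ /=; rewrite mulr1.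
Qed.

Lemma Rint_bounded f B : measurable_fun setT f ->
  {ae mu, forall x, `|f x| <= B} -> Rintegrable f.
Proof. by move=> mf fB; apply: L2_Rint; exact: L2_bounded fB. Qed.

End SquareIntegrable.

(** * Borel sets of row vectors and the measure of the cell *)

Section BorelRows.
Variables (R : realType) (n : nat).

Lemma measurable_open_box (a b : 'rV[R]_n) :
  measurable [set x : 'rV[R]_n | forall i, a 0 i < x 0 i < b 0 i].
Proof.
rewrite (_ : [set x | _] =
    \bigcap_(i in [set: 'I_n])
      ((fun x : 'rV[R]_n => x 0 i) @^-1` `]a 0 i, b 0 i[)).
  apply: fin_bigcap_measurable => // i _; rewrite -[X in measurable X]setTI.
  by apply: measurable_coord => //; exact: measurable_itv.
apply/seteqP; split => x /= H i.
  by move=> _; rewrite /= in_itv; exact: H.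
by have := H i I; rewrite /= in_itv.
Qed.

(** The sigma-algebra generated by the coordinates contains the open sets, since
    each of them is a countable union of boxes with rational centres. *)
Lemma measurable_open_rV (U : set 'rV[R]_n) : open U -> measurable U.
Proof.
move=> oU.
pose B (q : 'rV[rat]_n * nat) : set 'rV[R]_n :=
  [set x | forall i, ratr (q.1 0 i) - q.2.+1%:R^-1 < x 0 i < ratr (q.1 0 i) + q.2.+1%:R^-1].
pose F q : set 'rV[R]_n := if `[< B q `<=` U >] then B q else set0.
rewrite (_ : U = \bigcup_q F q).
  apply: countable_bigcupT_measurable => // q.
  rewrite /F; case: ifP => // _.
  have := @measurable_open_box (\row_i (ratr (q.1 0 i) - q.2.+1%:R^-1))
    (\row_i (ratr (q.1 0 i) + q.2.+1%:R^-1)).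
  by congr measurable; apply/seteqP; split => x /= h i; have := h i; rewrite !mxE.
apply/seteqP; split => [x Ux|x [q _]]; last first.
  by rewrite /F; case: ifP => // /asboolP; exact.
have : nbhs x U by exact: open_nbhs_nbhs.
move=> /nbhs_ballP[e /= e0 xU].
have [k ke] : exists k : nat, k.+1%:R^-1 < e / 2.
  exists (Num.truncn (e / 2)^-1).
  rewrite invf_plt ?posrE ?divr_gt0 ?ltr0n //; exact: truncnS_gt.
have /choice[q qP] : forall i, exists q : rat, x 0 i - k.+1%:R^-1 < ratr q < x 0 i + k.+1%:R^-1.
  move=> i; have lt_i : x 0 i - k.+1%:R^-1 < x 0 i + k.+1%:R^-1.
    by rewrite ltrBlDr -addrA ltrDl addr_gt0 // invr_gt0.
  by have [q] := rat_in_itvoo lt_i; rewrite in_itv /= => h; exists q.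
exists (\row_i q i, k) => //; rewrite /F.
have sub : B (\row_i q i, k) `<=` U.
  move=> y yB; apply: xU; split => // i j; rewrite ord1 /ball /=.
  have := yB j; have := qP j; rewrite /= !mxE => /andP[h1 h2] /andP[h3 h4].
  move: h1 h2 h3 h4 ke; move: (ratr _) (k.+1%:R^-1) => z w h1 h2 h3 h4 ke.
  by rewrite ltr_norml; apply/andP; split; lra.
rewrite (asboolT sub) => i; have := qP i; rewrite /= !mxE => /andP[].
by move: (ratr _) (k.+1%:R^-1) => z w h1 h2; apply/andP; split; lra.
Qed.

Lemma continuous_measurable_rV (g : 'rV[R]_n -> R) :
  continuous g -> measurable_fun setT g.
Proof.
move=> /continuousP cg; apply: (measurability _ (RGenOInfty.measurableE R)) => //.
move=> _ [_ [x ->] <-]; rewrite setTI; apply: measurable_open_rV.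
by apply: cg; exact: interval_open.
Qed.

End BorelRows.

Section CubeMeasure.
Variables (R : realType) (d : nat) (a : 'rV[R]_d) (l : R).
Hypothesis l0 : 0 < l.
Local Notation mu := (mu_cube a l).

Lemma cube_corner i : a 0 i <= (a + const_mx l) 0 i.
Proof. by rewrite !mxE lerDl ltW. Qed.

Lemma mu_cubeE (A : set 'rV[R]_d) : mu A = lebesgue_rV R d (A `&` cube a l).
Proof. by []. Qed.

Lemma mu_cube_fin : (mu setT < +oo)%E.
Proof.
rewrite mu_cubeE setTI lebesgue_rV_box ?ltry //; exact: cube_corner.
Qed.

Lemma ae_cube : {ae mu, forall x, cube a l x}.
Proof.
exists (~` cube a l); split => //.
  by apply: measurableC; exact: measurable_box.
by rewrite mu_cubeE setICl measure0.
Qed.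

Lemma ae_in_cube (P : 'rV[R]_d -> Prop) :
  (forall x, cube a l x -> P x) -> {ae mu, forall x, P x}.
Proof.
by move=> h; apply: (@filterS _ (almost_everywhere mu) _ _ _ _ ae_cube) => x /h.
Qed.

Lemma mu_cube_slice i c : mu [set x | x 0 i = c] = 0.
Proof.
have [ca|] := boolP (a 0 i <= c <= a 0 i + l); last first.
  move=> nca; rewrite mu_cubeE (_ : _ `&` _ = set0) ?measure0 //.
  apply/seteqP; split => // x [/= xc] /(_ i); rewrite xc !mxE => h.
  by rewrite h in nca.
pose a' : 'rV[R]_d := \row_j (if j == i then c else a 0 j).
pose b' : 'rV[R]_d := \row_j (if j == i then c else a 0 j + l).
rewrite mu_cubeE (_ : _ `&` _ = [set x : 'rV[R]_d | forall j, a' 0 j <= x 0 j <= b' 0 j]).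
  rewrite lebesgue_rV_box => [|j]; last first.
    by rewrite !mxE; case: eqP => // _; rewrite lerDl ltW.
  by rewrite (bigD1 i) //= !mxE eqxx subrr mul0r.
apply/seteqP; split => [x [/= xc] xcube j|x /= xab].
  by rewrite !mxE; case: eqP => [->|_]; [rewrite xc lexx|have := xcube j; rewrite !mxE].
have xi : x 0 i = c by have := xab i; rewrite !mxE eqxx => /le_anti.
by split => // j; have := xab j; rewrite !mxE; case: eqP => [->|_//]; rewrite xi.
Qed.

End CubeMeasure.

(** * Integrals of derivatives of periodic functions *)

Section ContinuousRows.
Variable R : realType.

Lemma continuous_rV (X : topologicalType) n (F : X -> 'rV[R]_n) :
  (forall i, continuous (fun x => F x 0 i)) -> continuous F.
Proof.
move=> Fc x; apply/cvgrPdist_lt => e e0.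
have : \forall y \near x, forall i, `|F x 0 i - F y 0 i| < e.
  by apply: filter_forall => i; move: (Fc i x) => /cvgrPdist_lt; exact.
apply: filterS => y h; have : ball (F x) e (F y).
  by split => // i j; rewrite ord1; exact: h.
by rewrite -ball_normE.
Qed.

Lemma continuous_comp_rV (X : topologicalType) n (F : X -> 'rV[R]_n) (g : 'rV[R]_n -> R) :
  continuous F -> continuous g -> continuous (fun x => g (F x)).
Proof. by move=> Fc gc x; apply: continuous_comp; [exact: Fc|exact: gc]. Qed.

Lemma continuous_bounded_segment (f : R -> R) (u v : R) : continuous f ->
  exists B, forall y, y \in `[u, v] -> `|f y| <= B.
Proof.
move=> cf; have : compact (f @` `[u, v]).
  by apply: continuous_compact; [exact: continuous_subspaceT|exact: segment_compact].
move=> /compact_bounded[M [_ hM]]; exists (M + 1) => y yc.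
by apply: (hM (M + 1)); [rewrite ltrDl|exists y].
Qed.

Lemma continuous_bounded_cube d (a : 'rV[R]_d) (l : R) (g : 'rV[R]_d -> R) :
  continuous g -> exists B, forall x, cube a l x -> `|g x| <= B.
Proof.
move=> cg; have cc : compact (cube a l).
  have := @rV_compact R d (fun i => `[a 0 i, (a + const_mx l) 0 i]%classic)
    (fun i => @segment_compact R _ _).
  congr compact; apply/seteqP; split => x /= h i; have := h i; by rewrite /= in_itv.
have : compact (g @` cube a l).
  by apply: continuous_compact => //; apply: continuous_subspaceT.
move=> /compact_bounded[M [_ hM]]; exists (M + 1) => x xc.
by apply: (hM (M + 1)); [rewrite ltrDl|exists x].
Qed.

Lemma Rint_continuous_cube d (a : 'rV[R]_d) (l : R) (g : 'rV[R]_d -> R) : 0 < l ->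
  continuous g -> Rintegrable (mu_cube a l) g.
Proof.
move=> l0 cg; have [B hB] := continuous_bounded_cube a l cg.
apply: (Rint_bounded (mu_cube_fin a l0) (B := B)).
  exact: continuous_measurable_rV.
exact: ae_in_cube.
Qed.

End ContinuousRows.

Section CubeFubini.
Variables (R : realType) (n : nat) (a : 'rV[R]_n.+1) (l : R).
Hypothesis l0 : 0 < l.

Definition base : 'rV[R]_n := \row_j a 0 (lift ord_max j).
Let top := a 0 ord_max.

Lemma itv_fin : ((@lebesgue_measure R) `[top, (top + l)%R] < +oo)%E.
Proof. by rewrite lebesgue_measure_itv /=; case: ifP => // _; rewrite ltry. Qed.

Lemma box_fin : (lebesgue_rV R n (cube base l) < +oo)%E.
Proof. by have := mu_cube_fin base l0; rewrite mu_cubeE setTI. Qed.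

Definition mu_base : {finite_measure set 'rV[R]_n -> \bar R} :=
  mfrestr (measurable_box base (base + const_mx l)) box_fin.
Definition mu_top : {finite_measure set (measurableTypeR R) -> \bar R} :=
  @mfrestr _ (measurableTypeR R) R `[top, top + l]%classic (@lebesgue_measure R)
    (measurable_itv `[top, top + l]) itv_fin.

Lemma rcons_cube (x : 'rV[R]_n) (y : R) :
  cube a l (rV_rcons (x, y)) <-> cube base l x /\ `[top, top + l]%classic y.
Proof.
split.
  move=> h; split.
    by move=> j; have := h (lift ord_max j); rewrite !mxE liftK.
  by have := h ord_max; rewrite !mxE unlift_none /= in_itv.
move=> [h1 h2] i; rewrite mxE; case: unliftP => [j ->|->] /=.
  by have := h1 j; rewrite !mxE.
by move: h2; rewrite /= in_itv !mxE.
Qed.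

(** The measure of the cell is a restriction of a product; writing it as a product
    of restrictions, which are finite, gives access to the theorem of Fubini. *)
Lemma mu_cube_rcons (A : set 'rV[R]_n.+1) : measurable A ->
  mu_cube a l A = pushforward (mu_base \x mu_top)%E (@rV_rcons R n) A.
Proof.
move=> mA; rewrite mu_cubeE /= /lebesgue_step /pushforward.
have mCI : measurable (cube base l `*` `[top, top + l] : set ('rV[R]_n * measurableTypeR R)).
  by apply: measurableX; [exact: measurable_box|exact: measurable_itv].
have mA' : measurable (@rV_rcons R n @^-1` A).
  by rewrite -[X in measurable X]setTI; exact: measurable_rV_rcons.
have := @product_measure_unique _ _ _ _ R mu_base mu_top
  (mrestr (lebesgue_rV R n \x (@lebesgue_measure R))%E mCI) _ _ mA'.
move=> ->; last first.
  move=> A1 A2 mA1 mA2.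
  rewrite [LHS](_ : _ = (lebesgue_rV R n \x (@lebesgue_measure R))%E
    ((A1 `&` cube base l) `*` (A2 `&` `[top, top + l]%classic))); last by rewrite setXI.
  rewrite product_measure1E //; apply: measurableI => //.
  exact: measurable_box.
rewrite /mrestr; congr (_ _); apply/seteqP; split => -[x y] /=.
  by move=> [Axy /rcons_cube[h1 h2]]; split.
by move=> [Axy [h1 h2]]; split => //; apply/rcons_cube.
Qed.

Lemma ae_rcons_cube : {ae (mu_base \x mu_top)%E, forall z, cube a l (rV_rcons z)}.
Proof.
exists (@rV_rcons R n @^-1` ~` cube a l); split => //.
  rewrite -[X in measurable X]setTI; apply: measurable_rV_rcons => //.
  by apply: measurableC; exact: measurable_box.
have := @mu_cube_rcons (~` cube a l); rewrite /pushforward => <-.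
  by rewrite mu_cubeE setICl measure0.
by apply: measurableC; exact: measurable_box.
Qed.

Lemma integral_cube_rcons (g : 'rV[R]_n.+1 -> R) : continuous g ->
  (\int[mu_cube a l]_x (g x)%:E = \int[mu_base \x mu_top]_z (g (rV_rcons z))%:E)%E
  /\ (mu_base \x mu_top)%E.-integrable setT (fun z => (g (rV_rcons z))%:E).
Proof.
move=> cg.
have mg : measurable_fun setT (fun z => g (@rV_rcons R n z)).
  apply: (@measurableT_comp _ _ _ _ _ _ g _ (@rV_rcons R n)).
    exact: continuous_measurable_rV.
  exact: measurable_rV_rcons.
have ig : (mu_base \x mu_top)%E.-integrable setT (fun z => (g (rV_rcons z))%:E).
  have [B hB] := continuous_bounded_cube a l cg.
  apply: (@Rint_bounded _ _ R (mu_base \x mu_top)%E _ _ B) => //.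
    by have := mu_cube_fin a l0; rewrite mu_cube_rcons.
  by apply: (@filterS _ (almost_everywhere (mu_base \x mu_top)%E) _ _ _ _ ae_rcons_cube) => z /hB.
split => //.
rewrite (eq_measure_integral (pushforward (mu_base \x mu_top)%E (@rV_rcons R n))); last first.
  by move=> ? A mA _; exact: mu_cube_rcons.
  move=> mrc; rewrite integral_pushforward //.
  by apply/measurable_EFinP; exact: continuous_measurable_rV.
exact: measurable_rV_rcons.
Qed.

End CubeFubini.

(** A directional derivative only sees the restriction to a line, so it can be
    computed after any substitution that is affine along that line. *)
Lemma derive_along (R : realType) (V W : normedModType R) (g : V -> R) (h : W -> R)
    (z e : V) (y v : W) :
  (forall t : R, h (t *: v + y) = g (t *: e + z)) ->
  ('D_v h y = 'D_e g z) * (derivable g z e -> derivable h y v).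
Proof.
move=> hg.
have hy : h y = g z by have := hg 0; rewrite !scale0r !add0r.
have E : (fun t : R => t^-1 *: ((h \o shift y) (t *: v) - h y)) =
         (fun t : R => t^-1 *: ((g \o shift z) (t *: e) - g z)).
  by apply/funext => t /=; rewrite hg hy.
split; first by rewrite /derive E.
by rewrite /derivable E.
Qed.

Lemma integral_mrestr (d : measure_display) (X : measurableType d) (R : realType)
    (mu : {measure set X -> \bar R}) (D : set X) (mD : measurable D) (f : X -> \bar R) :
  (mrestr mu mD).-integrable setT f ->
  (\int[mrestr mu mD]_x f x = \int[mu]_(x in D) f x)%E.
Proof.
move=> intf; rewrite [LHS](@negligible_integral _ _ _ _ _ (~` D)) //.
- rewrite setTD setCK; apply: eq_measure_integral => A mA AD.
  by rewrite /= /mrestr setIidl.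
- exact: measurableC.
- by rewrite /= /mrestr setICl measure0.
Qed.

Lemma rcons_shift_last (R : realType) n (x : 'rV[R]_n) (t y : R) :
  rV_rcons (x, t + y) = t *: delta_mx 0 ord_max + rV_rcons (x, y).
Proof.
apply/rowP => i; rewrite !mxE; case: unliftP => [j ->|->] /=.
  by rewrite eq_sym (negbTE (neq_lift _ _)) mulr0 add0r.
by rewrite eqxx mulr1.
Qed.

Lemma rcons_shift_first (R : realType) n (x : 'rV[R]_n) (t y : R) j :
  rV_rcons (t *: delta_mx 0 j + x, y) =
  t *: delta_mx 0 (lift ord_max j) + rV_rcons (x, y).
Proof.
apply/rowP => i; rewrite !mxE; case: unliftP => [k ->|->] /=.
  by rewrite !mxE (inj_eq lift_inj).
by rewrite (negbTE (neq_lift _ _)) mulr0 add0r.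
Qed.

Lemma continuous_rcons (R : realType) (X : topologicalType) n (x : X -> 'rV[R]_n) (y : X -> R) :
  continuous x -> continuous y -> continuous (fun t => rV_rcons (x t, y t)).
Proof.
move=> cx cy; apply: continuous_rV => i t; rewrite /rV_rcons.
case: (unliftP ord_max i) => [j ->|->]; last first.
  by under eq_fun do rewrite mxE unlift_none; exact: cy.
under eq_fun do rewrite mxE liftK /=.
exact: (@continuous_comp_rV _ _ _ x (fun v => v 0 j) cx (@coord_continuous _ _ _ 0 j)).
Qed.

Lemma continuous_rcons_first (R : realType) n (y : R) :
  continuous (fun x : 'rV[R]_n => rV_rcons (x, y)).
Proof.
apply: (@continuous_rcons R _ n (fun x => x) (fun=> y)) => x.
  exact: cvg_id.
exact: cst_continuous.
Qed.

Lemma continuous_rcons_last (R : realType) n (x : 'rV[R]_n) :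
  continuous (fun y : R => rV_rcons (x, y)).
Proof.
apply: (@continuous_rcons R _ n (fun=> x) (fun y => y)) => y.
  exact: cst_continuous.
exact: cvg_id.
Qed.

Lemma integral_derivative (R : realType) (f h : R -> R) (u v : R) : u < v ->
  (forall y, derivable h y 1) -> (forall y, 'D_1 h y = f y) -> continuous f ->
  (\int[@lebesgue_measure R]_(y in `[u, v]) (f y)%:E = (h v - h u)%:E)%E.
Proof.
move=> uv dh hf cf.
have ch : continuous h.
  by move=> y; apply/differentiable_continuous/derivable1_diffP; exact: dh.
rewrite (@continuous_FTC2 _ _ h) ?EFinB //.
- exact: continuous_subspaceT.
- split => //.
  + by apply: cvg_at_right_filter; exact: ch.
  + by apply: cvg_at_left_filter; exact: ch.
by move=> y _; rewrite derive1E.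
Qed.

(** Integrate first in the variable i: this is the fundamental theorem of calculus
    on a period.  By induction on the dimension the variable is the last one or the
    integral over the others vanishes already. *)
Lemma Rintegral_pderiv_periodic (R : realType) (l : R) : 0 < l ->
  forall n (a : 'rV[R]_n) (i : 'I_n) (g : 'rV[R]_n -> R),
  (forall x, derivable g x (delta_mx 0 i)) -> continuous (pderiv i g) ->
  (forall x, g (x + l *: delta_mx 0 i) = g x) ->
  \int[mu_cube a l]_x pderiv i g x = 0.
Proof.
move=> l0; elim=> [a []//|n IH] a i g dg cg pg.
have [E Ig] := integral_cube_rcons a l0 cg.
rewrite /Rintegral E; case: (unliftP ord_max i) => [j ij|ij].
  rewrite -(integral21_prod_meas1 Ig) integral0_eq // => y _.
  rewrite /fubini_G.
  pose gy x := g (rV_rcons (x, y)).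
  have gyE x : (pderiv j gy x = pderiv i g (rV_rcons (x, y))) *
      (derivable g (rV_rcons (x, y)) (delta_mx 0 i) -> derivable gy x (delta_mx 0 j)).
    by apply: derive_along => t; rewrite /gy rcons_shift_first ij.
  have gyE' : pderiv j gy = fun x => pderiv i g (rV_rcons (x, y)).
    by apply/funext => x; exact: (gyE x).1.
  have cgy : continuous (pderiv j gy).
    rewrite gyE'; apply: continuous_comp_rV => //.
    exact: continuous_rcons_first.
  have pgy x : gy (x + l *: delta_mx 0 j) = gy x.
    by rewrite /gy addrC rcons_shift_first addrC -ij pg.
  have R0 := IH (base a) j gy (fun x => (gyE x).2 (dg _)) cgy pgy.
  have fn := integrable_fin_num measurableT (Rint_continuous_cube (base a) l0 cgy).
  transitivity (\int[mu_cube (base a) l]_x (EFin \o pderiv j gy) x)%E.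
    by apply: eq_integral => x _; rewrite /= gyE'.
  by rewrite -(fineK fn); congr EFin; exact: R0.
rewrite -(integral12_prod_meas1 Ig) integral0_eq // => x _.
rewrite /fubini_F.
pose h y := g (rV_rcons (x, y)); set top := a 0 ord_max.
have hE y : ('D_1 h y = pderiv i g (rV_rcons (x, y))) *
    (derivable g (rV_rcons (x, y)) (delta_mx 0 i) -> derivable h y 1).
  apply: (@derive_along _ _ _ _ h) => t.
  by rewrite /h /GRing.scale /= mulr1 rcons_shift_last ij.
have dh y : derivable h y 1 by apply: (hE y).2; exact: dg.
have ch' : continuous (fun y : R => pderiv i g (rV_rcons (x, y))).
  apply: continuous_comp_rV => //.
  exact: continuous_rcons_last.
have lt_top : top < top + l by rewrite ltrDl.
rewrite integral_mrestr; last first.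
  have [B hB] := continuous_bounded_segment top (top + l) ch'.
  apply: (@Rint_bounded _ _ R (mrestr _ _) _ _ B) => //.
  - by rewrite /= /mrestr setTI; exact: itv_fin.
  - exact: continuous_measurable_fun.
  - exists (~` `[top, top + l]); split.
    + by apply: measurableC; exact: measurable_itv.
    + by rewrite /= /mrestr setICl measure0.
    + by move=> y /= hy; apply: contra_not hy => /hB.
apply: etrans (integral_derivative lt_top dh (fun y => (hE y).1) ch') _.
have -> : h (top + l) = h top.
  by rewrite /h [top + l]addrC rcons_shift_last addrC -ij pg.
by rewrite subrr.
Qed.

(** * Functions orthogonal to the smooth periodic functions *)

Section OpenBoxes.
Variables (R : realType) (n : nat).

Definition open_box (a b : 'rV[R]_n) : set 'rV[R]_n :=
  [set x | forall i, a 0 i < x 0 i < b 0 i].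

Definition open_boxes : set (set 'rV[R]_n) :=
  [set A | exists a b, A = open_box a b].

Lemma open_boxesI : setI_closed open_boxes.
Proof.
move=> _ _ [a [b ->]] [a' [b' ->]].
exists (\row_i Num.max (a 0 i) (a' 0 i)), (\row_i Num.min (b 0 i) (b' 0 i)).
apply/seteqP; split => x /=.
  by move=> [h h'] i; rewrite !mxE gt_max lt_min; case/andP: (h i) => -> ->;
     case/andP: (h' i) => -> ->.
by move=> h; split => i; have := h i; rewrite !mxE gt_max lt_min => /andP[/andP[? ?] /andP[? ?]];
   apply/andP.
Qed.

(** The open boxes form a pi-system generating the Borel sets, so that by Dynkin's
    theorem the integrals over boxes determine a function almost everywhere. *)
Lemma measurable_rV_boxes : @measurable _ 'rV[R]_n = <<s open_boxes >>.
Proof.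
apply/seteqP; split; last first.
  apply: smallest_sub; first exact: sigma_algebra_measurable.
  by move=> _ [a [b ->]]; exact: measurable_open_box.
apply: smallest_sub; first exact: smallest_sigma_algebra.
rewrite -bigcup_seq; apply: bigcup_sub => i _ _ [B mB <-].
rewrite -/(measurable _).
suff : measurable_fun setT
    (fun x : g_sigma_algebraType open_boxes => x 0 i : measurableTypeR R).
  by move=> /(_ measurableT _ mB).
apply: (measurability _ (RGenOInfty.measurableE R)) => //.
move=> _ [_ [c ->] <-]; rewrite setTI.
rewrite (_ : _ @^-1` _ = \bigcup_k open_box (\row_j (if j == i then c else - k%:R))
    (\row_j k%:R)).
  apply: bigcup_measurable => k _; apply: sub_sigma_algebra.
  by exists (\row_j (if j == i then c else - k%:R)), (\row_j k%:R).
apply/seteqP; split => [x /=|x [k _ /= /(_ i)]]; rewrite in_itv /= andbT; last first.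
  by rewrite !mxE eqxx => /andP[].
move=> cx; exists (Num.truncn (\sum_j `|x 0 j|)).+1 => // j; rewrite !mxE.
have : `|x 0 j| < (Num.truncn (\sum_j `|x 0 j|)).+1%:R.
  apply: le_lt_trans (truncnS_gt _); rewrite (bigD1 j) //= lerDl.
  by apply: sumr_ge0.
by rewrite ltr_norml => /andP[h1 h2]; case: eqP => [ji|_]; rewrite ?ji ?cx -?ji ?h1 ?h2.
Qed.

End OpenBoxes.

Section TrigExp.
Variables (R : realType) (d : nat).
Implicit Types u v : 'rV[R]_d -> R.

(** A class of functions that is stable under partial derivatives, hence consists of
    smooth functions, and that is rich enough to approximate indicators of boxes by
    periodic functions. *)
Inductive trigexp : ('rV[R]_d -> R) -> Prop :=
| trigexp_cst c : trigexp (fun=> c)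
| trigexp_sin i w c : trigexp (fun x => sin (w * x 0 i + c))
| trigexp_add u v : trigexp u -> trigexp v -> trigexp (fun x => u x + v x)
| trigexp_mul u v : trigexp u -> trigexp v -> trigexp (fun x => u x * v x)
| trigexp_exp u : trigexp u -> trigexp (fun x => expR (u x)).

Lemma trigexp_opp u : trigexp u -> trigexp (fun x => - u x).
Proof.
move=> hu; have := trigexp_mul (trigexp_cst (-1)) hu.
by under eq_fun do rewrite mulN1r.
Qed.

Lemma trigexp_prod (I : Type) (s : seq I) (F : I -> 'rV[R]_d -> R) :
  (forall i, trigexp (F i)) -> trigexp (fun x => \prod_(i <- s) F i x).
Proof.
move=> hF; elim: s => [|i s IH].
  by under eq_fun do rewrite big_nil; exact: trigexp_cst.
by under eq_fun do rewrite big_cons; exact: trigexp_mul.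
Qed.

Lemma trigexp_continuous u : trigexp u -> continuous u.
Proof.
elim=> {u} [c|i w c|u v _ cu _ cv|u v _ cu _ cv|u _ cu] x.
- exact: cst_continuous.
- apply: (@continuous_comp _ _ _ (fun x : 'rV[R]_d => w * x 0 i + c) sin); last exact: continuous_sin.
  exact: (cvgD (cvgM (cvg_cst w) (@coord_continuous _ _ _ 0 i x)) (cvg_cst c)).
- exact: (cvgD (cu x) (cv x)).
- exact: (cvgM (cu x) (cv x)).
- exact: (continuous_comp (cu x) (@continuous_expR R _)).
Qed.

Lemma is_derive_line (g : 'rV[R]_d -> R) (x e : 'rV[R]_d) (c : R) :
  is_derive (0 : R) 1 (fun t : R => g (t *: e + x)) c -> is_derive x e g c.
Proof.
move=> [dg gc].
have E := @derive_along R R _ (fun t : R => g (t *: e + x)) g 0 1 x e _.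
split.
  by apply: (E _).2 => // t; rewrite addr0 /GRing.scale /= mulr1.
by rewrite (E _).1 // => t; rewrite addr0 /GRing.scale /= mulr1.
Qed.

Lemma is_derive_to_line (g : 'rV[R]_d -> R) (x e : 'rV[R]_d) (c : R) :
  is_derive x e g c -> is_derive (0 : R) 1 (fun t : R => g (t *: e + x)) c.
Proof.
move=> [dg gc].
have E := @derive_along R _ R g (fun t : R => g (t *: e + x)) x e 0 1 _.
split.
  by apply: (E _).2 => // t; rewrite addr0 /GRing.scale /= mulr1.
by rewrite (E _).1 // => t; rewrite addr0 /GRing.scale /= mulr1.
Qed.

Lemma is_derive_affine (p q t : R) : is_derive t 1 (fun s => p * s + q) p.
Proof.
have := is_deriveD (is_deriveM (is_derive_cst p t 1) (is_derive_id t 1))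
  (is_derive_cst q t 1).
by rewrite /GRing.scale /= mulr0 !addr0 mulr1.
Qed.

Lemma trigexp_derive u j : trigexp u ->
  exists2 v, trigexp v & forall x, is_derive x (delta_mx 0 j) u (v x).
Proof.
elim=> {u} [c|i w c|u v _ [u' hu du] _ [v' hv dv]|u v tu [u' hu du] tv [v' hv dv]|u tu [u' hu du]].
- by exists (fun=> 0); [exact: trigexp_cst|move=> x; exact: is_derive_cst].
- exists (fun x => (w * (i == j)%:R) * sin (w * x 0 i + (c + pi / 2))).
    by apply: trigexp_mul; [exact: trigexp_cst|exact: trigexp_sin].
  move=> x; apply: is_derive_line.
  pose k s := w * (i == j)%:R * s + (w * x 0 i + c).
  have k0 : k 0 = w * x 0 i + c by rewrite /k mulr0 add0r.
  have := is_derive1_comp (is_derive_sin (k 0)) (is_derive_affine _ _ 0 : is_derive (0 : R) (1 : R) k _).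
  rewrite k0 addrA sinDpihalf mulrC.
  suff -> : sin \o k = (fun t => sin (w * (t *: delta_mx 0 j + x) 0 i + c)) by [].
  apply/funext => t; rewrite /k /= !mxE /=; congr sin; ring.
- exists (fun x => u' x + v' x); first exact: trigexp_add.
  by move=> x; exact: is_deriveD.
- exists (fun x => u x * v' x + v x * u' x).
    by apply: trigexp_add; exact: trigexp_mul.
  by move=> x; exact: is_deriveM.
exists (fun x => expR (u x) * u' x); first exact: (trigexp_mul (trigexp_exp tu)).
move=> x; apply: is_derive_line.
pose k (t : R) := u (t *: delta_mx 0 j + x).
have k0 : k 0 = u x by rewrite /k scale0r add0r.
have := is_derive1_comp (is_derive_expR (k 0)) (is_derive_to_line (du x) : is_derive (0 : R) (1 : R) k _).
by rewrite k0.
Qed.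

Lemma trigexp_pderiv u j : trigexp u ->
  trigexp (pderiv j u) /\ forall x, derivable u x (delta_mx 0 j).
Proof.
move=> /(trigexp_derive j)[v tv uv]; split=> [|x]; last exact: (@ex_derive _ _ _ _ _ _ _ (uv x)).
suff -> : pderiv j u = v by [].
by apply/funext => x; exact: (@derive_val _ _ _ _ _ _ _ (uv x)).
Qed.

Lemma trigexp_smooth u : trigexp u -> smooth u.
Proof.
move=> tu k s _; suff ts : trigexp (pderivs s u).
  by split; [exact: trigexp_continuous|move=> _ i; have [] := trigexp_pderiv i ts].
by elim: s => //= i s IH; have [] := trigexp_pderiv i IH.
Qed.

End TrigExp.

Section Uniqueness.
Variables (R : realType) (d : nat) (a : 'rV[R]_d) (l : R).
Hypothesis l0 : 0 < l.
Local Notation mu := (mu_cube a l).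

(** As n grows this tends to the indicator of the positive reals.  The argument
    n - n^2 s, rather than - n s, makes the limit at s = 0 equal to 0. *)
Definition gumbel (n : nat) (s : R) : R := expR (- expR (n%:R - n%:R ^+ 2 * s)).

Lemma gumbel_bound n s : 0 <= gumbel n s <= 1.
Proof.
by rewrite expR_ge0 /= -expR0 ler_expR oppr_le0 expR_ge0.
Qed.

Lemma expRN_le (t : R) : 0 <= t -> expR (- t) <= (1 + t)^-1.
Proof.
move=> t0; rewrite expRN lef_pV2 ?posrE ?expR_gt0 //; last lra.
exact: expR_ge1Dx.
Qed.

Lemma cvg_gumbel (s : R) :
  gumbel n s @[n --> \oo] --> (if 0 < s then 1 else 0 : R).
Proof.
have [N hN] : exists N : nat, forall n, (N <= n)%N ->
    `|(if 0 < s then 1 else 0) - gumbel n s| <= n.+1%:R^-1.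
  have [s0|s0] := ltP 0 s.
    exists (Num.truncn (2 / s)).+1 => n hn.
    (* With 2 <= n s the exponent n - n^2 s is at most - n. *)
    have ns : 2 <= n%:R * s.
      rewrite -ler_pdivrMr // ltW // (lt_le_trans (truncnS_gt _)) //.
      by rewrite ler_nat.
    have /andP[_ g1] := gumbel_bound n s.
    rewrite ger0_norm ?subr_ge0 //.
    have h1 : 1 - expR (n%:R - n%:R ^+ 2 * s) <= gumbel n s by exact: expR_ge1Dx.
    have h2 : expR (n%:R - n%:R ^+ 2 * s) <= n.+1%:R^-1.
      rewrite -natr1 [n%:R + 1]addrC; apply: (le_trans _ (expRN_le (ler0n R n))).
      rewrite ler_expR; have n0 : 0 <= n%:R :> R by [].
      by nra.
    by rewrite lerBlDr addrC -lerBlDr (le_trans _ h1) // lerB.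
  exists 0%N => n _; have /andP[g0 _] := gumbel_bound n s.
  rewrite sub0r normrN ger0_norm //.
  have n0 : 0 <= n%:R :> R by [].
  apply: (le_trans (expRN_le (expR_ge0 _))).
  have p0 : 0 < 1 + expR (n%:R - n%:R ^+ 2 * s) by rewrite addr_gt0 // expR_gt0.
  rewrite lef_pV2 ?posrE ?ltr0n // -natr1 [n%:R + 1]addrC lerD2l.
  have := expR_ge1Dx (n%:R - n%:R ^+ 2 * s).
  by nra.
apply/cvgrPdist_le => e e0.
have /cvgrPdist_le/(_ e e0)[M _ hM] := @cvg_harmonic R.
exists (maxn N M) => // n /=; rewrite geq_max => /andP[Nn Mn].
apply: le_trans (hN n Nn) _; have := hM n Mn.
by rewrite /= sub0r normrN ger0_norm // invr_ge0.
Qed.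

(** Each sine changes sign under a shift by l, so that the product is l-periodic. *)
Definition bump (al be : R) (x : R) : R := sin (pi / l * (x - al)) * sin (pi / l * (be - x)).

Lemma bump_gt0 (A al be x : R) : A <= al -> al <= be -> be <= A + l ->
  A <= x <= A + l -> (0 < bump al be x) = (al < x < be).
Proof.
move=> Aal albe beA /andP[Ax xA].
have p0 : 0 < pi / l by rewrite divr_gt0 // pi_gt0.
have S0 t : 0 <= t <= l -> 0 <= sin (pi / l * t).
  move=> /andP[t0 tl]; apply: sin_ge0_pi; rewrite mulr_ge0 ?(ltW p0) //=.
  by rewrite -mulrA ger_pMr ?pi_gt0 // mulrC ler_pdivrMr // mul1r.
have S1 t : 0 < t < l -> 0 < sin (pi / l * t).
  move=> /andP[t0 tl]; apply: sin_gt0_pi; rewrite mulr_gt0 //=.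
  by rewrite -mulrA gtr_pMr ?pi_gt0 // mulrC ltr_pdivrMr // mul1r.
rewrite /bump; have [alx|xal] /= := ltP al x; last first.
  apply/negbTE; rewrite -leNgt; rewrite -opprB mulrN sinN mulNr oppr_le0.
  by rewrite mulr_ge0 //; apply: S0; apply/andP; split; lra.
have [xbe|bex] := ltP x be.
  by rewrite mulr_gt0 //; apply: S1; apply/andP; split; lra.
apply/negbTE; rewrite -leNgt -[be - x]opprB mulrN sinN mulrN oppr_le0.
by rewrite mulr_ge0 //; apply: S0; apply/andP; split; lra.
Qed.

Lemma bump_periodic al be x : bump al be (x + l) = bump al be x.
Proof.
rewrite /bump.
have -> : pi / l * (x + l - al) = pi / l * (x - al) + pi by field; rewrite gt_eqF.
have -> : pi / l * (be - (x + l)) = - (pi / l * (x - be) + pi) by field; rewrite gt_eqF.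
rewrite sinDpi sinN sinDpi opprK mulNr -mulrN -sinN -mulrN opprB //.
Qed.

Definition box_test (n : nat) (al be : 'rV[R]_d) (x : 'rV[R]_d) : R :=
  \prod_i gumbel n (bump (al 0 i) (be 0 i) (x 0 i)).

Lemma trigexp_box_test n al be : trigexp (box_test n al be).
Proof.
apply: trigexp_prod => i; rewrite /gumbel /bump.
have h : trigexp (fun x : 'rV[R]_d => sin (pi / l * (x 0 i - al 0 i)) * sin (pi / l * (be 0 i - x 0 i))).
  apply: trigexp_mul.
    have := @trigexp_sin R d i (pi / l) (- (pi / l * al 0 i)).
    by under eq_fun do rewrite -mulrBr.
  have := @trigexp_sin R d i (- (pi / l)) (pi / l * be 0 i).
  by under eq_fun do rewrite mulNr addrC -mulrBr.
apply: trigexp_exp; apply: trigexp_opp; apply: trigexp_exp.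
apply: trigexp_add; first exact: trigexp_cst.
by apply: trigexp_opp; apply: trigexp_mul => //; exact: trigexp_cst.
Qed.

Lemma box_test_periodic n al be : Defs.periodic l (box_test n al be).
Proof.
move=> x i; apply: eq_bigr => j _; rewrite !mxE /=.
by case: eqP => _; rewrite ?mulr1 ?bump_periodic // mulr0 addr0.
Qed.

Lemma box_test_bound n al be x : `|box_test n al be x| <= 1.
Proof.
have g i := gumbel_bound n (bump (al 0 i) (be 0 i) (x 0 i)).
rewrite ger0_norm; last by apply: prodr_ge0 => i _; have /andP[] := g i.
by apply: prodr_ile1 => i _; exact: g.
Qed.

Lemma cvg_prodr (I : Type) (s : seq I) (F : I -> nat -> R) (L : I -> R) :
  (forall i, F i n @[n --> \oo] --> L i) ->
  \prod_(i <- s) F i n @[n --> \oo] --> \prod_(i <- s) L i.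
Proof.
move=> FL; elim: s => [|i s IH].
  by rewrite big_nil; under eq_fun do rewrite big_nil; exact: cvg_cst.
by rewrite big_cons; under eq_fun do rewrite big_cons; exact: cvgM.
Qed.

Lemma cvg_box_test (al be x : 'rV[R]_d) : (forall i, a 0 i <= al 0 i) ->
  (forall i, al 0 i <= be 0 i) -> (forall i, be 0 i <= a 0 i + l) -> cube a l x ->
  box_test n al be x @[n --> \oo] --> (\1_(open_box al be) x : R).
Proof.
move=> aal albe bea xc.
have -> : \1_(open_box al be) x =
    \prod_i (if 0 < bump (al 0 i) (be 0 i) (x 0 i) then 1 else 0 : R).
  have bE i : (0 < bump (al 0 i) (be 0 i) (x 0 i)) = (al 0 i < x 0 i < be 0 i).
    by apply: (@bump_gt0 (a 0 i)) => //; have := xc i; rewrite !mxE.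
  rewrite indicE; have [xB|xB] := boolP (x \in open_box al be).
    by rewrite big1 // => i _; rewrite bE; move: xB; rewrite inE => ->.
  suff [i hi] : exists i, ~~ (al 0 i < x 0 i < be 0 i).
    by rewrite (bigD1 i) //= bE (negbTE hi) mul0r.
  apply/existsP; rewrite -negb_forall; apply: contra xB => /forallP h.
  by rewrite inE.
by apply: cvg_prodr => i; exact: cvg_gumbel.
Qed.

Variable g : 'rV[R]_d -> R.
Hypothesis L2g : L2 mu g.
Hypothesis g_orth : forall phi, smooth phi -> Defs.periodic l phi -> ip a l g phi = 0.

Let Ig : Rintegrable mu g := L2_Rint (mu_cube_fin a l0) L2g.
Let mg : measurable_fun setT g := L2_measurable L2g.

Lemma measurable_open_boxT (al be : 'rV[R]_d) : measurable (open_box al be).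
Proof. exact: measurable_open_box. Qed.

(** By dominated convergence along the smooth periodic functions [box_test]. *)
Lemma orth_inner_box (al be : 'rV[R]_d) : (forall i, a 0 i <= al 0 i) ->
  (forall i, al 0 i <= be 0 i) -> (forall i, be 0 i <= a 0 i + l) ->
  \int[mu]_x (g x * \1_(open_box al be) x) = 0.
Proof.
move=> h1 h2 h3.
have cv : \int[mu]_x (g x * box_test n al be x) @[n --> \oo] -->
    \int[mu]_x (g x * \1_(open_box al be) x).
  apply: (@Rintegral_dominated _ _ _ _ _ _ (fun x => `|g x|)).
  - move=> n; apply: measurable_funM => //; apply: continuous_measurable_rV.
    exact/trigexp_continuous/trigexp_box_test.
  - by apply: measurable_funM => //; apply: measurable_indic; exact: measurable_open_boxT.
  - by have := integrable_abse Ig; apply: eq_integrable.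
  - apply: (ae_in_cube (a := a) (l := l)) => x xc.
    by apply: cvgM; [exact: cvg_cst|exact: cvg_box_test].
  - apply: aeW => x n; rewrite normrM -[leRHS]mulr1 ler_wpM2l //.
    exact: box_test_bound.
have z n : \int[mu]_x (g x * box_test n al be x) = 0.
  by apply: g_orth; [exact/trigexp_smooth/trigexp_box_test|exact: box_test_periodic].
have cv0 : \int[mu]_x (g x * box_test n al be x) @[n --> \oo] --> (0 : R).
  by under eq_fun do rewrite z; exact: cvg_cst.
exact: (cvg_unique _ cv cv0).
Qed.

(** A box is clamped to the cell, which only changes its trace on the cell by a
    null set. *)
Lemma orth_box (al be : 'rV[R]_d) : \int[mu]_x (g x * \1_(open_box al be) x) = 0.
Proof.
have [/forallP albe|] := boolP [forall i, al 0 i <= be 0 i]; last first.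
  rewrite negb_forall => /existsP[i]; rewrite -ltNge => bal.
  rewrite (_ : open_box al be = set0); last first.
    by apply/seteqP; split => // x /(_ i) /andP[h1 h2]; have := lt_trans h1 h2; rewrite ltNge (ltW bal).
  under eq_Rintegral do rewrite indic0 mulr0.
  by rewrite Rintegral_cst // mul0r.
pose cl (v : R) i := Num.min (Num.max v (a 0 i)) (a 0 i + l).
pose al' : 'rV[R]_d := \row_i cl (al 0 i) i; pose be' : 'rV[R]_d := \row_i cl (be 0 i) i.
have al_l i : a 0 i <= a 0 i + l by rewrite lerDl ltW.
rewrite -[RHS](@orth_inner_box al' be'); first last.
- by move=> i; rewrite mxE ge_min lexx orbT.
- move=> i; rewrite !mxE /cl le_min !ge_min lexx orbT andbT.
  by apply/orP; left; rewrite ge_max !le_max albe lexx orbT.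
- by move=> i; rewrite mxE /cl le_min le_max lexx orbT al_l.
apply: Rintegral_ae.
- by apply: measurable_funM => //; apply: measurable_indic; exact: measurable_open_boxT.
- by apply: measurable_funM => //; apply: measurable_indic; exact: measurable_open_boxT.
have nb : {ae mu, forall x : 'rV[R]_d, forall i, x 0 i != a 0 i /\ x 0 i != a 0 i + l}.
  apply: filter_forall => i.
  have sl c : {ae mu, forall x : 'rV[R]_d, x 0 i != c}.
    exists [set x : 'rV[R]_d | x 0 i = c]; split.
    - rewrite (_ : [set x | _] = (fun x : 'rV[R]_d => x 0 i) @^-1` [set c]) //.
      by rewrite -[X in measurable X]setTI; apply: measurable_coord => //; exact: measurable_set1.
    - exact: mu_cube_slice.
    - by move=> x /= /negP; rewrite negbK => /eqP.
  apply: (@filterS2 _ (almost_everywhere mu) _ _ _ _ _ (sl (a 0 i)) (sl (a 0 i + l))) => x h1 h2.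
  by split.
apply: (@filterS2 _ (almost_everywhere mu) _ _ _ _ _ nb (ae_cube a l)) => x xn xc.
congr (_ * _); rewrite !indicE; congr ((_ : bool)%:R).
have key i : (al' 0 i < x 0 i < be' 0 i) = (al 0 i < x 0 i < be 0 i).
  have [n1 n2] := xn i; have := xc i; rewrite !mxE => /andP[c1 c2].
  have {n1}c1 : a 0 i < x 0 i by rewrite lt_neqAle eq_sym n1.
  have {n2}c2 : x 0 i < a 0 i + l by rewrite lt_neqAle n2.
  by rewrite /cl gt_min lt_min lt_max gt_max c1 c2 (lt_gtF c1) (lt_gtF c2) !andbT !orbF.
by apply/idP/idP; rewrite !inE => h i; have := h i; rewrite /= key.
Qed.

Lemma orth_measurable (A : set 'rV[R]_d) : measurable A ->
  (\int[mu]_(x in A) (g x)%:E = 0)%E.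
Proof.
have T0 : (\int[mu]_x (g x)%:E = 0)%E.
  rewrite -(fineK (integrable_fin_num measurableT Ig)); congr EFin.
  have one : smooth (fun _ : 'rV[R]_d => 1 : R) by apply: trigexp_smooth; exact: trigexp_cst.
  have := g_orth one (fun x i => erefl); rewrite /ip => <-.
  by apply: eq_Rintegral => x _; rewrite mulr1.
rewrite measurable_rV_boxes; apply: (dynkin_induction (measurable_rV_boxes R d)
  (@open_boxesI R d) (P := fun A => (\int[mu]_(x in A) (g x)%:E = 0)%E)).
- exact: T0.
- move=> _ [al [be ->]].
  have mB := measurable_open_boxT al be.
  rewrite -(fineK (integrable_fin_num mB (integrableS measurableT mB (@subsetT _ _) Ig))).
  congr EFin; have := orth_box al be => <-.
  apply: etrans (Rintegral_mkcond mu (open_box al be) g) _.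
  apply: eq_Rintegral => x _; rewrite patchE indicE.
  by case: ifP => _; rewrite ?mulr1 ?mulr0.
- move=> S mS S0.
  have mCS := measurableC mS.
  have fS := integrable_fin_num mCS (integrableS measurableT mCS (@subsetT _ _) Ig).
  have := @Rintegral_setU _ _ R mu S (~` S) g mS mCS _ _.
  rewrite setUv => /(_ Ig); rewrite disj_set2E setICr eqxx => /(_ erefl).
  have -> : \int[mu]_x g x = 0 by rewrite /Rintegral T0.
  rewrite {1}/Rintegral S0 add0r => e.
  by rewrite -(fineK fS); congr EFin; exact: (esym e).
- move=> F mF tF F0; rewrite integral_bigcup //.
    by rewrite eseries0 // => k _ _; exact: F0.
  by apply: (integrableS measurableT _ (@subsetT _ _) Ig); exact: bigcup_measurable.
Qed.

(** The fundamental lemma of the calculus of variations on the torus: the integral of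
    g vanishes on boxes by [orth_box], hence on Borel sets by Dynkin's theorem. *)
Lemma orth_ae0 : {ae mu, forall x, g x = 0}.
Proof.
have := @integral_ae_eq _ _ R mu setT measurableT (cst 0%E) (EFin \o g) Ig (measurable_cst _).
move=> h; have : ae_eq mu setT (EFin \o g) (cst 0%E).
  by apply: h => E _ mE; rewrite integral0; exact: orth_measurable.
move=> h'; apply: (@filterS _ (almost_everywhere mu) _ _ _ _ h') => x /(_ I) /= [].
by [].
Qed.

End Uniqueness.

(** * Weak derivatives *)

Section WeakDerivatives.
Variables (R : realType) (d : nat) (a : 'rV[R]_d) (l : R).
Hypothesis l0 : 0 < l.
Local Notation mu := (mu_cube a l).
Local Notation F := ('rV[R]_d -> R).
Implicit Types u v g : F.

Definition aeq u v : Prop := {ae mu, forall x, u x = v x}.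

Lemma aeq_refl u : aeq u u.
Proof. by apply: aeW. Qed.

Lemma aeq_sym u v : aeq u v -> aeq v u.
Proof. by apply: (@filterS _ (almost_everywhere mu)) => x. Qed.

Lemma aeq_trans u v w : aeq u v -> aeq v w -> aeq u w.
Proof. by apply: (@filterS2 _ (almost_everywhere mu)) => x -> ->. Qed.

Lemma aeqD u v u' v' : aeq u u' -> aeq v v' ->
  aeq (fun x => u x + v x) (fun x => u' x + v' x).
Proof. by apply: (@filterS2 _ (almost_everywhere mu)) => x -> ->. Qed.

Lemma ipC u v : ip a l u v = ip a l v u.
Proof. by apply: eq_Rintegral => x _; rewrite mulrC. Qed.

Lemma ipDl u v w : L2 mu u -> L2 mu v -> L2 mu w ->
  ip a l (fun x => u x + v x) w = ip a l u w + ip a l v w.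
Proof.
move=> hu hv hw; rewrite /ip -Rintegral_add; try exact: L2_mul.
by apply: eq_Rintegral => x _; rewrite mulrDl.
Qed.

Lemma ipZl c u w : L2 mu u -> L2 mu w ->
  ip a l (fun x => c * u x) w = c * ip a l u w.
Proof.
move=> hu hw; rewrite /ip -Rintegral_scale; last exact: L2_mul.
by apply: eq_Rintegral => x _; rewrite mulrA.
Qed.

Lemma ip_suml n (c : 'I_n -> R) (u : 'I_n -> F) w : (forall i, L2 mu (u i)) -> L2 mu w ->
  ip a l (fun x => \sum_i c i * u i x) w = \sum_i c i * ip a l (u i) w.
Proof.
move=> hu hw; under [RHS]eq_bigr => i _ do rewrite -ipZl //.
rewrite /ip -Rintegral_sum; last by move=> i; apply: L2_mul => //; exact: L2Z.
by apply: eq_Rintegral => x _; rewrite mulr_suml.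
Qed.

Lemma ip_ge0 u : 0 <= ip a l u u.
Proof. by apply: Rintegral_ge0 => x _; rewrite -expr2 sqr_ge0. Qed.

Lemma ip_ae u u' w w' : L2 mu u -> L2 mu u' -> L2 mu w -> L2 mu w' ->
  aeq u u' -> aeq w w' -> ip a l u w = ip a l u' w'.
Proof.
move=> hu hu' hw hw' e1 e2; apply: Rintegral_ae.
- exact: measurable_funM (L2_measurable hu) (L2_measurable hw).
- exact: measurable_funM (L2_measurable hu') (L2_measurable hw').
by move: e1 e2; apply: (@filterS2 _ (almost_everywhere mu)) => x -> ->.
Qed.

Lemma Rintegral_eq0_ae (f : F) : Rintegrable mu f -> (forall x, 0 <= f x) ->
  \int[mu]_x f x = 0 -> {ae mu, forall x, f x = 0}.
Proof.
move=> If f0 I0.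
have mf : measurable_fun setT (EFin \o f) by apply/measurable_EFinP; exact: Rint_measurable If.
have : (\int[mu]_x `|(EFin \o f) x| = 0)%E.
  rewrite (eq_integral (EFin \o f)) => [|x _]; last by rewrite /= ger0_norm.
  by rewrite -(fineK (integrable_fin_num measurableT If)); congr EFin.
move=> /(ae_eq_integral_abs mu measurableT mf).
by apply: (@filterS _ (almost_everywhere mu)) => x /(_ I) /= [].
Qed.

Lemma ip_eq0 u : L2 mu u -> ip a l u u = 0 -> aeq u (fun=> 0).
Proof.
move=> hu /(Rintegral_eq0_ae (L2_mul hu hu)) h.
have : {ae mu, forall x, u x * u x = 0}.
  by apply: h => x; rewrite -expr2 sqr_ge0.
by apply: (@filterS _ (almost_everywhere mu)) => x /eqP; rewrite mulf_eq0 orbb => /eqP.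
Qed.

Lemma L2_continuous (phi : F) : continuous phi -> L2 mu phi.
Proof.
move=> cphi; have [B hB] := continuous_bounded_cube a l cphi.
apply: (L2_bounded (mu_cube_fin a l0) (B := B)).
  exact: continuous_measurable_rV.
exact: ae_in_cube.
Qed.

Lemma smooth_continuous (phi : F) : smooth phi -> continuous phi.
Proof. by move=> /(_ 0%N [::] isT)[]. Qed.

Lemma smooth_pderiv (phi : F) i : smooth phi ->
  continuous (pderiv i phi) /\ forall x, derivable phi x (delta_mx 0 i).
Proof.
move=> h; have [c _] := h 1%N [:: i] isT; have [_ dd] := h 1%N [::] isT.
by split => // x; exact: dd.
Qed.

Lemma periodicD u v : Defs.periodic l u -> Defs.periodic l v ->
  Defs.periodic l (fun x => u x + v x).
Proof. by move=> pu pv x i; rewrite pu pv. Qed.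

Lemma L2perD u v : L2per a l u -> L2per a l v -> L2per a l (fun x => u x + v x).
Proof. by move=> [hu pu] [hv pv]; split; [exact: L2D|exact: periodicD]. Qed.

Lemma L2perZ c u : L2per a l u -> L2per a l (fun x => c * u x).
Proof. by move=> [hu pu]; split; [exact: L2Z|move=> x i; rewrite pu]. Qed.

Lemma weak_pderiv_unique i v g g' :
  is_weak_pderiv a l i v g -> is_weak_pderiv a l i v g' -> aeq g g'.
Proof.
move=> [[hg pg] e] [[hg' pg'] e'].
have hB : L2 mu (fun x => g x + -1 * g' x) by apply: L2D => //; exact: L2Z.
have : {ae mu, forall x, g x + -1 * g' x = 0}.
  apply: (orth_ae0 l0 hB) => phi sphi pphi.
  have hphi := L2_continuous (smooth_continuous sphi).
  rewrite ipDl //; last exact: L2Z.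
  rewrite ipZl // -[ip a l g phi]opprK -e // e' //; ring.
by apply: (@filterS _ (almost_everywhere mu)) => x; rewrite mulN1r => /subr0_eq.
Qed.

Lemma weak_pderivP i v : H1per a l v -> is_weak_pderiv a l i v (weak_pderiv a l i v).
Proof. by move=> [_ /(_ i)/cid[g hg]]; exact: (xgetPex _ (ex_intro _ g hg)). Qed.

(** Almost everywhere equal functions have the same weak derivatives, so that
    the choice operator picks the same representative for both: the conclusion is an
    equality of functions. *)
Lemma weak_pderiv_aeq i v v' : L2 mu v -> L2 mu v' -> aeq v v' ->
  weak_pderiv a l i v = weak_pderiv a l i v'.
Proof.
move=> hv hv' vv'; rewrite /weak_pderiv; congr xget.
apply/seteqP; split => g [h1 h2]; split => // phi sphi pphi; rewrite -h2 //;
  have hphi := L2_continuous (smooth_pderiv i sphi).1.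
- by apply: ip_ae => //; [exact: aeq_sym|exact: aeq_refl].
- by apply: ip_ae => //; exact: aeq_refl.
Qed.

Lemma is_weak_pderivD i u v g g' : L2per a l u -> L2per a l v ->
  is_weak_pderiv a l i u g -> is_weak_pderiv a l i v g' ->
  is_weak_pderiv a l i (fun x => u x + v x) (fun x => g x + g' x).
Proof.
move=> [hu _] [hv _] [hg e] [hg' e']; split; first exact: L2perD.
move=> phi sphi pphi.
have hphi := L2_continuous (smooth_continuous sphi).
have hphi' := L2_continuous (smooth_pderiv i sphi).1.
by rewrite !ipDl //; [rewrite e // e' // opprD|case: hg|case: hg'].
Qed.

Lemma is_weak_pderivZ i c u g : L2per a l u -> is_weak_pderiv a l i u g ->
  is_weak_pderiv a l i (fun x => c * u x) (fun x => c * g x).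
Proof.
move=> [hu _] [hg e]; split; first exact: L2perZ.
move=> phi sphi pphi.
have hphi := L2_continuous (smooth_continuous sphi).
have hphi' := L2_continuous (smooth_pderiv i sphi).1.
by rewrite !ipZl //; [rewrite e // mulrN|case: hg].
Qed.

Lemma H1perD u v : H1per a l u -> H1per a l v -> H1per a l (fun x => u x + v x).
Proof.
move=> hu hv; split=> [|i]; first by apply: L2perD; [case: hu|case: hv].
by eexists; apply: is_weak_pderivD; [case: hu|case: hv|exact: weak_pderivP|exact: weak_pderivP].
Qed.

Lemma H1perZ c u : H1per a l u -> H1per a l (fun x => c * u x).
Proof.
move=> hu; split=> [|i]; first by apply: L2perZ; case: hu.
by eexists; apply: is_weak_pderivZ; [case: hu|exact: weak_pderivP].
Qed.


Lemma L2per_cst c : L2per a l (fun=> c).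
Proof.
split => //; apply: (L2_bounded (mu_cube_fin a l0) (B := `|c|)) => //.
by apply: aeW.
Qed.


(** Integration by parts against a constant is [Rintegral_pderiv_periodic]. *)
Lemma is_weak_pderiv_cst i c : is_weak_pderiv a l i (fun=> c) (fun=> 0).
Proof.
split; first exact: L2per_cst.
move=> phi sphi pphi; have [cp dp] := smooth_pderiv i sphi.
rewrite /ip Rintegral_scale; last exact: Rint_continuous_cube.
rewrite Rintegral_pderiv_periodic // mulr0.
under eq_Rintegral do rewrite mul0r.
by rewrite Rintegral_cst // mul0r oppr0.
Qed.

Lemma H1per_cst c : H1per a l (fun=> c).
Proof. by split=> [|i]; [exact: L2per_cst|exists (fun=> 0); exact: is_weak_pderiv_cst]. Qed.

Lemma weak_pderiv_cst i c : aeq (weak_pderiv a l i (fun=> c)) (fun=> 0).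
Proof.
by apply: weak_pderiv_unique (is_weak_pderiv_cst i c); apply: weak_pderivP; exact: H1per_cst.
Qed.

Lemma weak_pderivD i u v : H1per a l u -> H1per a l v ->
  aeq (weak_pderiv a l i (fun x => u x + v x))
      (fun x => weak_pderiv a l i u x + weak_pderiv a l i v x).
Proof.
move=> hu hv; apply: (@weak_pderiv_unique i (fun x => u x + v x)).
  by apply: weak_pderivP; exact: H1perD.
by apply: is_weak_pderivD; [case: hu|case: hv|exact: weak_pderivP|exact: weak_pderivP].
Qed.

Lemma weak_pderivZ i c u : H1per a l u ->
  aeq (weak_pderiv a l i (fun x => c * u x)) (fun x => c * weak_pderiv a l i u x).
Proof.
move=> hu; apply: (@weak_pderiv_unique i (fun x => c * u x)).
  by apply: weak_pderivP; exact: H1perZ.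
by apply: is_weak_pderivZ; [case: hu|exact: weak_pderivP].
Qed.

Lemma H1per_sum n (c : 'I_n -> R) (u : 'I_n -> F) : (forall i, H1per a l (u i)) ->
  H1per a l (fun x => \sum_i c i * u i x).
Proof.
elim: n c u => [|n IH] c u hu.
  by under eq_fun do rewrite big_ord0; exact: H1per_cst.
under eq_fun do rewrite big_ord_recl.
by apply: H1perD; [exact: H1perZ|exact: IH].
Qed.

Lemma weak_pderiv_sum i n (c : 'I_n -> R) (u : 'I_n -> F) : (forall k, H1per a l (u k)) ->
  aeq (weak_pderiv a l i (fun x => \sum_k c k * u k x))
      (fun x => \sum_k c k * weak_pderiv a l i (u k) x).
Proof.
elim: n c u => [|n IH] c u hu.
  under eq_fun do rewrite big_ord0.
  by under [X in aeq _ X]eq_fun do rewrite big_ord0; exact: weak_pderiv_cst.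
under eq_fun do rewrite big_ord_recl.
under [X in aeq _ X]eq_fun do rewrite big_ord_recl.
apply: aeq_trans (weak_pderivD i _ _) _; [exact: H1perZ|exact: H1per_sum|].
by apply: aeqD; [exact: weak_pderivZ|exact: IH].
Qed.

Lemma weak_pderiv_L2 i u : H1per a l u -> L2 mu (weak_pderiv a l i u).
Proof. by move=> /(weak_pderivP i)[[]]. Qed.

End WeakDerivatives.

(** * The finite element space *)

Section FiniteElements.
Variables (R : realType) (d : nat) (a : 'rV[R]_d) (l : R).
Variables (K : finType) (vtx : K -> 'I_d.+1 -> 'rV[R]_d).
Hypothesis l0 : 0 < l.
Hypothesis cover : \bigcup_(k in [set: K]) simplex (vtx k) = cube a l.
Local Notation mu := (mu_cube a l).
Local Notation V := (Vh a l vtx).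
Implicit Types u v : 'rV[R]_d -> R.

Lemma Vh_H1 v : V v -> H1per a l v. Proof. by case. Qed.

Lemma Vh_L2per v : V v -> L2per a l v. Proof. by case; case. Qed.

Lemma Vh_L2 v : V v -> L2 mu v. Proof. by case; case; case. Qed.

Lemma VhD u v : V u -> V v -> V (fun x => u x + v x).
Proof.
move=> [hu pu] [hv pv]; split; first exact: H1perD.
move=> k; have [c [b [q e]]] := pu k; have [c' [b' [q' e']]] := pv k.
exists (c + c'), (b + b'), (q + q') => x xk; rewrite e // e' //.
rewrite [RHS](_ : _ = (c + c') + (\sum_i b 0 i * x 0 i + \sum_i b' 0 i * x 0 i) +
   (\sum_i \sum_j q i j * x 0 i * x 0 j + \sum_i \sum_j q' i j * x 0 i * x 0 j)); first by ring.
rewrite -!big_split /=; congr (_ + _ + _); apply: eq_bigr => i _.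
  by rewrite !mxE mulrDl.
by rewrite -big_split /=; apply: eq_bigr => j _; rewrite !mxE !mulrDl.
Qed.

Lemma VhZ s u : V u -> V (fun x => s * u x).
Proof.
move=> [hu pu]; split; first exact: H1perZ.
move=> k; have [c [b [q e]]] := pu k.
exists (s * c), (s *: b), (s *: q) => x xk; rewrite e // !mulrDr !mulr_sumr.
congr (_ + _ + _); apply: eq_bigr => i _; first by rewrite !mxE mulrA.
by rewrite mulr_sumr; apply: eq_bigr => j _; rewrite !mxE !mulrA.
Qed.

Lemma Vh_cst c : V (fun=> c).
Proof.
split; first exact: H1per_cst.
move=> k; exists c, 0, 0 => x _; rewrite !big1 ?addr0 // => i _; rewrite ?mxE ?mul0r //.
by rewrite big1 // => j _; rewrite !mxE !mul0r.
Qed.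

Lemma Vh_sum n (c : 'I_n -> R) (u : 'I_n -> 'rV[R]_d -> R) : (forall i, V (u i)) ->
  V (fun x => \sum_i c i * u i x).
Proof.
elim: n c u => [|n IH] c u hu.
  by under eq_fun do rewrite big_ord0; exact: Vh_cst.
under eq_fun do rewrite big_ord_recl.
by apply: VhD; [exact: VhZ|exact: IH].
Qed.

Lemma Vh_bounded v : V v -> exists B, forall x, cube a l x -> `|v x| <= B.
Proof.
move=> [_ pv].
have /choice[B hB] : forall k, exists B, forall x, cube a l x -> simplex (vtx k) x -> `|v x| <= B.
  move=> k; have [c [b [q e]]] := pv k.
  pose w (x : 'rV[R]_d) := c + \sum_i b 0 i * x 0 i + \sum_i \sum_j q i j * x 0 i * x 0 j.
  have cw : continuous w.
    have cx i : continuous (fun x : 'rV[R]_d => x 0 i) by exact: coord_continuous.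
    have c1 : continuous (fun x : 'rV[R]_d => \sum_i b 0 i * x 0 i).
      by apply: continuous_sumr => i x; exact: (cvgM (cvg_cst _) (cx i x)).
    have c2 : continuous (fun x : 'rV[R]_d => \sum_i \sum_j q i j * x 0 i * x 0 j).
      apply: continuous_sumr => i; apply: continuous_sumr => j x.
      exact: (cvgM (cvgM (cvg_cst _) (cx i x)) (cx j x)).
    by move=> x; exact: (cvgD (cvgD (cvg_cst c) (c1 x)) (c2 x)).
  have [B hB] := continuous_bounded_cube a l cw.
  by exists B => x xc xk; rewrite e //; exact: hB.
exists (\sum_k `|B k|) => x xc; have := xc; rewrite -cover => -[k _ xk].
apply: le_trans (hB k x xc xk) _; rewrite (bigD1 k) //=.
by rewrite (le_trans (ler_norm _)) // lerDl sumr_ge0.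
Qed.

Definition orthonormal_Vh n (u : 'I_n -> 'rV[R]_d -> R) : Prop :=
  (forall i, V (u i)) /\ forall i j, ip a l (u i) (u j) = (i == j)%:R.

Lemma ip_lincomb n (c : 'I_n -> R) (u : 'I_n -> 'rV[R]_d -> R) j : orthonormal_Vh u ->
  ip a l (fun x => \sum_i c i * u i x) (u j) = c j.
Proof.
move=> [hu uu]; rewrite ip_suml //; [|by move=> i; exact: Vh_L2|exact: Vh_L2].
rewrite (bigD1 j) //= uu eqxx mulr1 big1 ?addr0 // => i ij.
by rewrite uu (negbTE ij) mulr0.
Qed.

Lemma ae_cube_eq u v : (forall x, cube a l x -> u x = v x) -> aeq a l u v.
Proof. by move=> h; exact: ae_in_cube. Qed.

(** If there are more functions than coefficients of quadratics on all cells, some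
    nontrivial combination has all coefficients 0 and so vanishes on the cell, against
    orthonormality. *)
Lemma orthonormal_size : exists M, forall n (u : 'I_n -> 'rV[R]_d -> R),
  orthonormal_Vh u -> (n <= M)%N.
Proof.
pose T : finType := (K * (unit + ('I_d + 'I_d * 'I_d)))%type.
exists #|T| => n u ou; rewrite leqNgt; apply/negP => Tn.
have [hu uu] := ou.
have /choice[P hP] : forall i, exists P : K -> R * 'rV[R]_d * 'M[R]_d,
    forall k x, simplex (vtx k) x -> u i x = (P k).1.1 + \sum_j (P k).1.2 0 j * x 0 j
      + \sum_j \sum_m (P k).2 j m * x 0 j * x 0 m.
  move=> i; have [_ pu] := hu i.
  have /choice[P hP] : forall k, exists P : R * 'rV[R]_d * 'M[R]_d,
    forall x, simplex (vtx k) x -> u i x = P.1.1 + \sum_j P.1.2 0 j * x 0 j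
      + \sum_j \sum_m P.2 j m * x 0 j * x 0 m.
    by move=> k; have [c [b [q e]]] := pu k; exists (c, b, q).
  by exists P.
pose co i (t : T) : R := match t with
  | (k, inl _) => (P i k).1.1
  | (k, inr (inl j)) => (P i k).1.2 0 j
  | (k, inr (inr (j, m))) => (P i k).2 j m end.
pose A : 'M[R]_(n, #|T|) := \matrix_(i, t) co i (enum_val t).
have : kermx A != 0.
  rewrite -mxrank_eq0 mxrank_ker subn_eq0 -ltnNge.
  exact: leq_ltn_trans (rank_leq_col A) Tn.
move=> /rowV0Pn[c /sub_kermxP cA c0].
have cT t : \sum_i c 0 i * co i t = 0.
  have := congr1 (fun B : 'rV[R]_#|T| => B 0 (enum_rank t)) cA; rewrite !mxE => e.
  rewrite -[RHS]e; by apply: eq_bigr => i _; rewrite !mxE enum_rankK.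
have z : aeq a l (fun x => \sum_i c 0 i * u i x) (fun=> 0).
  apply: ae_cube_eq => x; rewrite -cover => -[k _ xk].
  under eq_bigr => i _ do rewrite (hP i k x xk) !mulrDr !mulr_sumr.
  rewrite !big_split /= (cT (k, inl tt)) add0r.
  rewrite exchange_big /= big1 ?add0r => [|j _]; last first.
    under eq_bigr do rewrite mulrA; rewrite -mulr_suml.
    by rewrite (cT (k, inr (inl j))) mul0r.
  rewrite exchange_big /= big1 // => j _.
  under eq_bigr do rewrite mulr_sumr; rewrite exchange_big /= big1 // => m _.
  under eq_bigr do rewrite !mulrA; rewrite -!mulr_suml.
  by rewrite (cT (k, inr (inr (j, m)))) !mul0r.
case/negP: c0; apply/eqP/rowP => j; rewrite mxE -(ip_lincomb (c 0) j ou).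
rewrite (ip_ae _ _ _ _ z (aeq_refl _ _ _)); try exact: Vh_L2.
- by rewrite /ip; under eq_Rintegral do rewrite mul0r; rewrite Rintegral_cst // mul0r.
- by apply: Vh_L2; exact: Vh_sum.
- exact: L20.
Qed.

(** A maximal orthonormal family; the residual of a projection that did not vanish
    almost everywhere could be normalised and added to it. *)
Lemma orthonormal_basis : exists m (b : 'I_m -> 'rV[R]_d -> R),
  orthonormal_Vh b /\
  forall v, V v -> aeq a l v (fun x => \sum_i ip a l v (b i) * b i x).
Proof.
have [M hM] := orthonormal_size.
pose P n := `[< exists u : 'I_n -> 'rV[R]_d -> R, orthonormal_Vh u >].
have P0 : exists n, P n.
  by exists 0%N; apply/asboolP; exists (fun=> fun=> 0); split; case.
have PM n : P n -> (n <= M)%N by move=> /asboolP[u /hM].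
have [m /asboolP[b ob] mmax] := ex_maxnP P0 PM.
exists m, b; split => // v hv; have [hb bb] := ob.
set pv := fun x => \sum_i ip a l v (b i) * b i x.
have hpv : V pv by exact: Vh_sum.
pose w x := v x + -1 * pv x.
have hw : V w by apply: VhD => //; exact: VhZ.
have wb i : ip a l w (b i) = 0.
  rewrite ipDl; try exact: Vh_L2; last by apply: Vh_L2; exact: VhZ.
  rewrite ipZl; try exact: Vh_L2.
  by rewrite ip_lincomb // mulN1r subrr.
have [ww|ww] := eqVneq (ip a l w w) 0.
  have := ip_eq0 (Vh_L2 hw) ww.
  by apply: (@filterS _ (almost_everywhere mu)) => x; rewrite /w mulN1r => /subr0_eq.
have ww0 : 0 < ip a l w w by rewrite lt_neqAle eq_sym ww ip_ge0.
pose s := (Num.sqrt (ip a l w w))^-1.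
pose b' (i : 'I_m.+1) := if unlift ord_max i is Some j then b j else (fun x => s * w x).
suff /mmax : P m.+1 by rewrite ltnn.
have hsw : V (fun x => s * w x) by exact: VhZ.
apply/asboolP; exists b'; split => [i|i j].
  by rewrite /b'; case: unliftP.
rewrite /b'; case: (unliftP ord_max i) => [i' ->|->]; case: (unliftP ord_max j) => [j' ->|->].
- by rewrite (inj_eq lift_inj).
- rewrite ipC ipZl; try exact: Vh_L2.
  by rewrite wb mulr0 eq_sym (negbTE (neq_lift _ _)).
- rewrite ipZl; try exact: Vh_L2.
  by rewrite wb mulr0 (negbTE (neq_lift _ _)).
rewrite eqxx ipZl; try exact: Vh_L2.
rewrite ipC ipZl; try exact: Vh_L2.
by rewrite mulrA -expr2 /s exprVn sqr_sqrtr ?mulVf // ltW.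
Qed.

End FiniteElements.

(** * Integrals depending on a parameter *)

Section ParametricIntegrals.
Variable R : realType.

(** Sequences suffice for continuity on a normed space; this is how dominated
    convergence is turned into continuity. *)
Lemma seq_continuous (V : normedModType R) (Phi : V -> R) :
  (forall (z : V) (z_ : nat -> V), z_ n @[n --> \oo] --> z ->
     Phi (z_ n) @[n --> \oo] --> Phi z) -> continuous Phi.
Proof.
move=> sc z; apply/cvgrPdist_lt => e e0; apply: contrapT => ne.
have /choice[z_ hz] : forall n : nat, exists y, ball z n.+1%:R^-1 y /\ e <= `|Phi z - Phi y|.
  move=> n; apply: contrapT => nex; apply: ne.
  apply/nbhs_ballP; exists n.+1%:R^-1; first by rewrite /= invr_gt0.
  by move=> y yb /=; rewrite ltNge; apply/negP => h; apply: nex; exists y.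
have cz : z_ n @[n --> \oo] --> z.
  apply/cvgrPdist_lt => r r0; have /cvgrPdist_lt/(_ r r0)[M _ hM] := @cvg_harmonic R.
  exists M => // n Mn; have := hM n Mn; rewrite /= sub0r normrN ger0_norm ?invr_ge0 //.
  by apply: lt_trans; have [+ _] := hz n; rewrite -ball_normE.
have /cvgrPdist_lt/(_ e e0)[M _ hM] := sc z z_ cz.
by have := hM M (leqnn M); rewrite /= ltNge (hz M).2.
Qed.

Lemma continuous_Rintegral_param d (X : measurableType d) (mu : {measure set X -> \bar R})
    (V : normedModType R) (G : set X) (H : V -> X -> R) (b : X -> R) :
  {ae mu, forall x, G x} ->
  (forall z, measurable_fun setT (H z)) -> Rintegrable mu b ->
  (forall x, G x -> continuous (H ^~ x)) ->
  (forall r, exists B, forall z x, `|z| <= r -> G x -> `|H z x| <= B) ->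
  continuous (fun z => \int[mu]_x (H z x * b x)).
Proof.
move=> aeG mH Ib cH bH; apply: seq_continuous => z z_ cz.
have /cvg_seq_bounded[r [_ hr]] : cvgn z_ by apply/cvg_ex; exists z.
have zr n : `|z_ n| <= r + 1 by apply: (hr (r + 1)); rewrite ?ltrDl.
have [B hB] := bH (r + 1).
apply: (@Rintegral_dominated _ _ _ _ _ _ (fun x => B * `|b x|)).
- by move=> n; apply: measurable_funM => //; exact: Rint_measurable Ib.
- by apply: measurable_funM => //; exact: Rint_measurable Ib.
- by apply: RintZ; have := integrable_abse Ib; apply: eq_integrable.
- apply: (@filterS _ (almost_everywhere mu) _ _ _ _ aeG) => x Gx.
  apply: cvgM; last exact: cvg_cst.
  exact: (cvg_comp _ _ cz (cH x Gx z)).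
apply: (@filterS _ (almost_everywhere mu) _ _ _ _ aeG) => x Gx n.
by rewrite normrM ler_wpM2r // hB.
Qed.

Lemma mean_value (phi dphi : R -> R) (x y : R) :
  (forall t : R, is_derive t 1 phi (dphi t)) ->
  exists2 c, `|c - x| <= `|y - x| & phi y - phi x = dphi c * (y - x).
Proof.
move=> dp; have cp : continuous phi.
  by move=> t; apply/differentiable_continuous/derivable1_diffP.
have [xy|yx] := leP x y.
  have [c] := @MVT_segment R phi dphi x y xy (fun t _ => dp t) (continuous_subspaceT cp).
  rewrite in_itv /= => /andP[c1 c2] e; exists c => //.
  by rewrite !ger0_norm ?subr_ge0 // lerD2r.
have [c] := @MVT_segment R phi dphi y x (ltW yx) (fun t _ => dp t) (continuous_subspaceT cp).
rewrite in_itv /= => /andP[c1 c2] e; exists c => //.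
  by rewrite !ler0_norm ?subr_le0 ?(ltW yx) // lerN2 lerD2r.
by rewrite -opprB e -mulrN opprB.
Qed.

End ParametricIntegrals.

Section Plane.
Variable R : realType.
Implicit Types (f h : 'rV[R]_2 -> R) (p q r e : R).

Lemma pt2_coord p q (i : 'I_2) : pt2 p q 0 i = if i == 0 then p else q.
Proof. by rewrite mxE. Qed.

Lemma continuous_pt2 (X : topologicalType) (u v : X -> R) :
  continuous u -> continuous v -> continuous (fun x => pt2 (u x) (v x)).
Proof.
move=> cu cv; apply: continuous_rV => i.
rewrite (_ : (fun x => _) = if i == 0 then u else v).
  by case: ifP.
by apply/funext => x; rewrite pt2_coord; case: ifP.
Qed.

Lemma measurable_pt2 d (X : measurableType d) h (u v : X -> R) : continuous h ->
  measurable_fun setT u -> measurable_fun setT v ->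
  measurable_fun setT (fun x => h (pt2 (u x) (v x))).
Proof.
move=> ch mu_ mv; apply: (@measurableT_comp _ _ _ _ _ _ h _ (fun x => pt2 (u x) (v x))).
  exact: continuous_measurable_rV.
apply: measurable_fun_rV => i; rewrite (_ : (fun x => _) = if i == 0 then u else v).
  by case: ifP.
by apply/funext => x; rewrite pt2_coord; case: ifP.
Qed.

Lemma bounded_pt2 h (B : R) : continuous h ->
  exists C, forall p q, `|p| <= B -> `|q| <= B -> `|h (pt2 p q)| <= C.
Proof.
move=> ch; have [C hC] := continuous_bounded_cube (const_mx (- B)) (B *+ 2) ch.
exists C => p q pB qB; apply: hC => i; rewrite !mxE mulr2n addKr -ler_norml.
by case: ifP.
Qed.

Lemma pt2_line0 p q t : pt2 (t + p) q = t *: delta_mx 0 0 + pt2 p q.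
Proof. by apply/rowP => i; rewrite !mxE /=; case: eqP; rewrite ?mulr1 ?mulr0 ?add0r. Qed.

Lemma pt2_line1 p q t : pt2 p (t + q) = t *: delta_mx 0 1 + pt2 p q.
Proof.
apply/rowP => i; rewrite !mxE /=; case: (eqVneq i 0) => [->|i0].
  by rewrite mulr0 add0r.
suff -> : i = 1 by rewrite mulr1.
by apply: val_inj; case: i i0 => -[|[|]].
Qed.

(** Split the increment into one increment in each variable and apply the mean value
    theorem to both; the continuity of the partial derivatives controls the errors. *)
Lemma is_derive_pt2_line f (p q al be t : R) : smooth f ->
  is_derive t 1 (fun s => f (pt2 (p + s * al) (q + s * be)))
    (f_rho f (pt2 (p + t * al) (q + t * be)) * al
     + f_eta f (pt2 (p + t * al) (q + t * be)) * be).
Proof.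
move=> sf; have [c0 d0] := smooth_pderiv 0 sf; have [c1 d1] := smooth_pderiv 1 sf.
have D0 (q' s : R) : is_derive s 1 (fun s => f (pt2 s q')) (f_rho f (pt2 s q')).
  have E := @derive_along R _ R f (fun s => f (pt2 s q')) (pt2 s q') (delta_mx 0 0) s 1 _.
  split.
    by apply: (E _).2 => // w; rewrite /GRing.scale /= mulr1 pt2_line0.
  by rewrite (E _).1 // => w; rewrite /GRing.scale /= mulr1 pt2_line0.
have D1 (p' s : R) : is_derive s 1 (fun s => f (pt2 p' s)) (f_eta f (pt2 p' s)).
  have E := @derive_along R _ R f (fun s => f (pt2 p' s)) (pt2 p' s) (delta_mx 0 1) s 1 _.
  split.
    by apply: (E _).2 => // w; rewrite /GRing.scale /= mulr1 pt2_line1.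
  by rewrite (E _).1 // => w; rewrite /GRing.scale /= mulr1 pt2_line1.
set P := p + t * al; set Q := q + t * be.
set F := fun s => f (pt2 (p + s * al) (q + s * be)).
set c := f_rho f (pt2 P Q) * al + f_eta f (pt2 P Q) * be.
suff cv : h^-1 *: (F (h *: 1 + t) - F t) @[h --> 0^'] --> c.
  by split; [apply/cvg_ex; exists c|exact: cvg_lim cv].
apply/cvgrPdist_le => e e0.
(* The term 1 only serves to make M positive. *)
set M := `|al| + `|be| + 1.
have M0 : 0 < M by rewrite ltr_wpDl // addr_ge0.
have near_c (g : 'rV[R]_2 -> R) : continuous g -> exists2 r, 0 < r & forall p' q',
    `|p' - P| < r -> `|q' - Q| < r -> `|g (pt2 p' q') - g (pt2 P Q)| <= e / M.
  move=> cg; have /cvgrPdist_le/(_ (e / M)) := cg (pt2 P Q).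
  rewrite divr_gt0 // => /(_ erefl) /nbhs_ballP[r /= r0 hr]; exists r => // p' q' hp hq.
  rewrite distrC; apply: hr; split => // i j; rewrite ord1 /ball /= !mxE distrC.
  by case: ifP.
have [r0 r00 h0] := near_c _ c0; have [r1 r10 h1] := near_c _ c1.
exists (Num.min r0 r1 / M) => /=; first by rewrite divr_gt0 // lt_min r00.
move=> w /=; rewrite sub0r normrN => wlt w0.
have wM : `|w| * M < Num.min r0 r1 by rewrite -ltr_pdivlMr.
have [wal wbe] : `|w * al| < Num.min r0 r1 /\ `|w * be| < Num.min r0 r1.
  split; apply: le_lt_trans wM; rewrite normrM ler_wpM2l // /M.
    by rewrite -addrA lerDl addr_ge0.
  by rewrite [`|al| + _]addrC -addrA lerDl addr_ge0.
have [xi hxi e1] := mean_value P (P + w * al) (D0 (Q + w * be)).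
have [ze hze e2] := mean_value Q (Q + w * be) (D1 P).
have aK (u v : R) : u + v - u = v by rewrite addrC addKr.
rewrite !aK in hxi hze e1 e2.
have -> : F (w *: 1 + t) - F t = f_rho f (pt2 xi (Q + w * be)) * (w * al)
     + f_eta f (pt2 P ze) * (w * be).
  rewrite -e1 -e2 addrA addrNK /F; congr (f (pt2 _ _) - _); rewrite /P /Q /GRing.scale /=; ring.
have -> : c - w^-1 *: (f_rho f (pt2 xi (Q + w * be)) * (w * al)
     + f_eta f (pt2 P ze) * (w * be)) =
   - ((f_rho f (pt2 xi (Q + w * be)) - f_rho f (pt2 P Q)) * al
   + (f_eta f (pt2 P ze) - f_eta f (pt2 P Q)) * be).
  by rewrite /c /GRing.scale /=; field.
rewrite normrN; apply: le_trans (ler_normD _ _) _; rewrite !normrM.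
have b0 : `|f_rho f (pt2 xi (Q + w * be)) - f_rho f (pt2 P Q)| <= e / M.
  apply: h0; first by apply: le_lt_trans hxi _; move: wal; rewrite lt_min => /andP[].
  by rewrite aK; move: wbe; rewrite lt_min => /andP[].
have b1 : `|f_eta f (pt2 P ze) - f_eta f (pt2 P Q)| <= e / M.
  apply: h1; first by rewrite subrr normr0.
  by apply: le_lt_trans hze _; move: wbe; rewrite lt_min => /andP[].
apply: le_trans (lerD (ler_wpM2r (normr_ge0 al) b0) (ler_wpM2r (normr_ge0 be) b1)) _.
by rewrite -mulrDr mulrAC ler_pdivrMr // ler_pM2l // /M lerDl.
Qed.

End Plane.

Lemma integrable_continuous_itv (R : realType) (h : R -> R) (u v : R) :
  continuous h -> (@lebesgue_measure R).-integrable `[u, v] (EFin \o h).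
Proof.
move=> ch; apply: continuous_compact_integrable; first exact: segment_compact.
exact: continuous_subspaceT.
Qed.

Lemma Rintegral_oo_cc (R : realType) (h : R -> R) (u v : R) : u < v -> continuous h ->
  \int[@lebesgue_measure R]_(s in `]u, v[) h s =
  \int[@lebesgue_measure R]_(s in `[u, v]) h s.
Proof.
move=> uv ch; have I := integrable_continuous_itv u v ch.
rewrite Rintegral_itv_obnd_cbnd ?Rintegral_itv_bndo_bndc //.
- apply: (integrableS _ _ _ I); try exact: measurable_itv.
  by move=> x /=; rewrite !in_itv /= => /andP[-> /ltW ->].
- apply: (integrableS _ _ _ I); try exact: measurable_itv.
  by move=> x /=; rewrite !in_itv /= => /andP[/ltW -> /ltW ->].
Qed.

Section PotentialEnergy.
Context d (X : measurableType d) (R : realType) (mu : {measure set X -> \bar R}).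
Hypothesis mu_fin : (mu setT < +oo)%E.
Variable f : 'rV[R]_2 -> R.
Hypothesis sf : smooth f.
Variables (r0 r1 e0 e1 : X -> R) (B : R).
Hypotheses (mr0 : measurable_fun setT r0) (mr1 : measurable_fun setT r1)
  (me0 : measurable_fun setT e0) (me1 : measurable_fun setT e1).
Hypotheses (br0 : forall x, `|r0 x| <= B) (br1 : forall x, `|r1 x| <= B)
  (be0 : forall x, `|e0 x| <= B) (be1 : forall x, `|e1 x| <= B).

Let r (t : R) x := r0 x + t * r1 x.
Let e (t : R) x := e0 x + t * e1 x.
Let D t x := f_rho f (pt2 (r t x) (e t x)) * r1 x + f_eta f (pt2 (r t x) (e t x)) * e1 x.

Let bline (c0 c1 : X -> R) M t x : (forall x, `|c0 x| <= B) -> (forall x, `|c1 x| <= B) ->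
  `|t| <= M -> `|c0 x + t * c1 x| <= B + M * B.
Proof.
move=> b0 b1 tM; apply: le_trans (ler_normD _ _) _; rewrite normrM lerD // ler_pM //.
Qed.

Let mline (c0 c1 : X -> R) t : measurable_fun setT c0 -> measurable_fun setT c1 ->
  measurable_fun setT (fun x => c0 x + t * c1 x).
Proof. by move=> m0 m1; apply: measurable_funD => //; exact: measurable_funM. Qed.

Let bound_line (h : 'rV[R]_2 -> R) M : continuous h ->
  exists C, forall t x, `|t| <= M -> `|h (pt2 (r t x) (e t x))| <= C.
Proof.
move=> ch; have [C hC] := bounded_pt2 (B + M * B) ch.
by exists C => t x tM; apply: hC; exact: bline.
Qed.

Let c_rho : continuous (f_rho f) := (smooth_pderiv 0 sf).1.
Let c_eta : continuous (f_eta f) := (smooth_pderiv 1 sf).1.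

Let mD t : measurable_fun setT (D t).
Proof.
by apply: measurable_funD; apply: measurable_funM => //; apply: measurable_pt2 => //;
  exact: mline.
Qed.

Let bD M : exists C, forall t x, `|t| <= M -> `|D t x| <= C.
Proof.
have [C hC] := bound_line M c_rho; have [C' hC'] := bound_line M c_eta.
exists (C * B + C' * B) => t x tM; apply: le_trans (ler_normD _ _) _.
apply: lerD; rewrite normrM; apply: ler_pM (normr_ge0 _) (normr_ge0 _) _ _.
- exact: hC.
- exact: br1.
- exact: hC'.
- exact: be1.
Qed.

Lemma continuous_potential_power : continuous (fun t => \int[mu]_x D t x).
Proof.
have -> : (fun t => \int[mu]_x D t x) = (fun t => \int[mu]_x (D t x * (fun=> 1) x)).
  by apply/funext => t; apply: eq_Rintegral => x _; rewrite mulr1.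
apply: (@continuous_Rintegral_param R _ X mu R^o setT D (fun=> 1)) => //.
- by apply: aeW.
- exact: Rint_cst.
- move=> x _; rewrite /D.
  have cl (c0 c1 : R) : continuous (fun t : R => c0 + t * c1).
    by move=> t; exact: (cvgD (cvg_cst c0) (cvgM cvg_id (cvg_cst c1))).
  have ch (h : 'rV[R]_2 -> R) : continuous h -> continuous (fun t : R => h (pt2 (r t x) (e t x))).
    by move=> ch; apply: continuous_comp_rV => //; apply: continuous_pt2; exact: cl.
  move=> t; exact: (cvgD (cvgM (ch _ c_rho t) (cvg_cst _)) (cvgM (ch _ c_eta t) (cvg_cst _))).
by move=> M; have [C hC] := bD M; exists C => t x tM _; exact: hC.
Qed.

(** Differentiation under the integral sign; on a bounded time interval the
    derivative is bounded, since the functions are bounded and f is smooth. *)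
Lemma is_derive_potential (t : R) :
  is_derive t 1 (fun s : R => \int[mu]_x f (pt2 (r s x) (e s x))) (\int[mu]_x D t x).
Proof.
pose F s x := f (pt2 (r s x) (e s x)).
have dF (s : R) x : is_derive s 1 (F ^~ x) (D s x) by exact: is_derive_pt2_line.
pose M := `|t| + 1.
have sM (s : R) : `]t - 1, t + 1[%classic s -> `|s| <= M.
  rewrite /= in_itv /= /M => /andP[h1 h2].
  rewrite ler_norml; have := ler_norm t; have := ler_norm (- t); rewrite normrN => a1 a2.
  by apply/andP; split; lra.
have [C hC] := bD M.
have [C0 hC0] := bound_line M (smooth_continuous sf).
have It : `]t - 1, t + 1[%classic t by rewrite /= in_itv /= ltrBlDr ltrDl ltr01.
have IF s : `]t - 1, t + 1[%classic s -> mu.-integrable setT (EFin \o F s).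
  move=> /sM hs; apply: (@Rint_bounded _ _ R mu mu_fin _ C0).
    by apply: measurable_pt2 (mline _ mr0 mr1) (mline _ me0 me1); exact: smooth_continuous.
  by apply: aeW => x; exact: hC0.
have dF1 s x : `]t - 1, t + 1[%classic s -> setT x -> derivable (F ^~ x) s 1.
  by move=> _ _; exact: (@ex_derive _ _ _ _ _ _ _ (dF s x)).
have pE s x : partial1of2 F s x = D s x.
  by rewrite partial1of2E; exact: (@derive_val _ _ _ _ _ _ _ (dF s x)).
have Gu s x : `]t - 1, t + 1[%classic s -> setT x -> `|partial1of2 F s x| <= `|C|.
  by move=> /sM hs _; rewrite pE (le_trans (hC s x hs)) // ler_norm.
have cv := cvg_differentiation_under_integral measurableT It IF dF1
  (fun=> normr_ge0 C) (Rint_cst mu_fin `|C|) Gu.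
have E : \int[mu]_x partial1of2 F t x = \int[mu]_x D t x by apply: eq_Rintegral => x _; exact: pE.
rewrite E in cv.
suff cv' : h^-1 *: ((\int[mu]_x F (h *: 1 + t) x) - \int[mu]_x F t x) @[h --> 0^'] -->
    \int[mu]_x D t x.
  by split; [apply/cvg_ex; exists (\int[mu]_x D t x)|exact: cvg_lim cv'].
by under eq_fun do rewrite scaler1.
Qed.

Lemma potential_increment (u v : R) : u < v ->
  \int[@lebesgue_measure R]_(s in `]u, v[) (\int[mu]_x D s x) =
  (\int[mu]_x f (pt2 (r v x) (e v x))) - \int[mu]_x f (pt2 (r u x) (e u x)).
Proof.
move=> uv.
have := integral_derivative uv
  (fun y => @ex_derive _ _ _ _ _ _ _ (is_derive_potential y))
  (fun y => @derive_val _ _ _ _ _ _ _ (is_derive_potential y)) continuous_potential_power.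
move=> /(congr1 fine) /= <-.
exact: (Rintegral_oo_cc uv continuous_potential_power).
Qed.

End PotentialEnergy.

(** * The time grid and the projection in time *)

Section TimeGrid.
Variables (R : realType) (d : nat) (a : 'rV[R]_d) (l : R).
Variables (T : R) (N : nat).
Hypotheses (l0 : 0 < l) (T0 : 0 < T) (N0 : (0 < N)%N).
Local Notation mu := (mu_cube a l).
Local Notation F := ('rV[R]_d -> R).
Local Notation tg := (tgrid T N).
Local Notation Itv := (Itv T N).

Definition tau : R := T / N%:R.

Lemma tau_gt0 : 0 < tau. Proof. by rewrite divr_gt0 // ltr0n. Qed.

Lemma tgridS n : tg n.+1 = tg n + tau.
Proof. by rewrite /tgrid -natr1 mulrDl mul1r. Qed.

Lemma tgrid_pred n : (0 < n)%N -> tg n = tg n.-1 + tau.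
Proof. by case: n => // n _; rewrite tgridS. Qed.

Lemma tgrid_lt n : (0 < n)%N -> tg n.-1 < tg n.
Proof. by move=> n0; rewrite (tgrid_pred n0) ltrDl tau_gt0. Qed.

Lemma tgrid_le m n : (m <= n)%N -> tg m <= tg n.
Proof. by move=> mn; rewrite /tgrid ler_wpM2r ?ler_nat // ltW // tau_gt0. Qed.

(** Makes it possible to assemble piecewise constant functions of time as finite sums
    over the intervals. *)
Lemma Itv_inj m n t : (0 < m)%N -> (0 < n)%N -> Itv m t -> Itv n t -> m = n.
Proof.
wlog mn : m n / (m <= n)%N.
  move=> W m0 n0 hm hn; case: (leqP m n) => [mn|/ltnW nm]; first exact: W.
  by apply/esym; exact: W.
move=> m0 n0; rewrite /Defs.Itv /= !in_itv /= => /andP[m1 m2] /andP[n1 n2].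
apply/eqP; rewrite eqn_leq mn /= leqNgt; apply/negP => mn'.
have : tg m <= tg n.-1 by apply: tgrid_le; rewrite -ltnS prednK.
by rewrite leNgt (lt_trans n1 m2).
Qed.

Definition mid n : R := (tg n.-1 + tg n) / 2.

Lemma tgrid_sub n : (0 < n)%N -> tg n - tg n.-1 = tau.
Proof. by move=> /tgrid_pred ->; rewrite addrC addKr. Qed.

Lemma Rintegral_Itv_affine n (A B : R) : (0 < n)%N ->
  \int[@lebesgue_measure R]_(s in Itv n) (A + s * B) = tau * (A + mid n * B).
Proof.
move=> n0; have uv := tgrid_lt n0.
have ch : continuous (fun s : R => A + s * B).
  by move=> t; exact: (cvgD (cvg_cst A) (cvgM cvg_id (cvg_cst B))).
rewrite /Defs.Itv (Rintegral_oo_cc uv ch).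
pose h (s : R) := A * s + B / 2 * s ^+ 2.
have dh (s : R) : is_derive s 1 h (A + s * B).
  have := is_deriveD (is_deriveM (is_derive_cst A s 1) (is_derive_id s 1))
    (is_deriveM (is_derive_cst (B / 2) s 1) (@is_deriveX _ _ id 2 s 1 _ (is_derive_id s 1))).
  have -> : cst A * id + cst (B / 2) * id ^+ 2 = h by [].
  suff -> : cst A s *: (1 : R) + id s *: 0 + (cst (B / 2) s *: ((2%:R * id s ^+ 2.-1) *: (1 : R)) + (id ^+ 2) s *: 0) = A + s * B by [].
  by rewrite /GRing.scale /= !mulr0 !addr0 !mulr1 expr1; field.
have := integral_derivative uv (fun y => @ex_derive _ _ _ _ _ _ _ (dh y))
  (fun y => @derive_val _ _ _ _ _ _ _ (dh y)) ch.
move=> /(congr1 fine) /= e; rewrite [LHS]e /h /mid -(tgrid_sub n0).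
by field.
Qed.

Lemma Rintegral_Itv_cst n (A : R) : (0 < n)%N ->
  \int[@lebesgue_measure R]_(s in Itv n) A = tau * A.
Proof.
move=> n0; have := Rintegral_Itv_affine A 0 n0; rewrite mulr0 addr0 => <-.
by apply: eq_Rintegral => s _; rewrite mulr0 addr0.
Qed.

Lemma Rintegral_Itv_eq n (f g : R -> R) : (forall s, Itv n s -> f s = g s) ->
  \int[@lebesgue_measure R]_(s in Itv n) f s = \int[@lebesgue_measure R]_(s in Itv n) g s.
Proof. by move=> fg; apply: eq_Rintegral => s; rewrite inE => /fg. Qed.

Lemma Pk0P (X : set F) n u : Pk_on T N 0 X n u <->
  exists2 phi, X phi & forall t, Itv n t -> u t = phi.
Proof.
split=> [[c [hc e]]|[phi hphi e]].
  exists (c ord0) => // t ht; rewrite e //; apply/funext => x.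
  by rewrite big_ord1 expr0 mul1r.
exists (fun=> phi); split => // t ht; rewrite e //; apply/funext => x.
by rewrite big_ord1 expr0 mul1r.
Qed.

Lemma Pk1P (X : set F) n u : Pk_on T N 1 X n u <->
  exists c0 c1, [/\ X c0, X c1 & forall t, Itv n t -> u t = fun x => c0 x + t * c1 x].
Proof.
split=> [[c [hc e]]|[c0 [c1 [h0 h1 e]]]].
  exists (c ord0), (c (lift ord0 ord0)); split=> // t ht; rewrite e //; apply/funext => x.
  by rewrite big_ord_recl big_ord1 /= expr0 mul1r expr1.
exists (fun j => if j == ord0 then c0 else c1); split=> [j|t ht]; first by case: ifP.
rewrite e //; apply/funext => x.
by rewrite big_ord_recl big_ord1 /= expr0 mul1r expr1.
Qed.

Lemma dt_affine n (u : R -> F) c0 c1 : (forall t, Itv n t -> u t = fun x => c0 x + t * c1 x) ->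
  forall t, Itv n t -> dt u t = c1.
Proof.
move=> e t ht; apply/funext => x; rewrite /dt derive1E.
have E : \forall s \near t, u s x = c0 x + s * c1 x.
  have : nbhs t (Itv n) by apply: open_nbhs_nbhs; split => //; exact: interval_open.
  by apply: filterS => s /e ->.
rewrite (near_eq_derive _ E) ?oner_eq0 //.
apply: (@derive_val _ _ _ _ _ _ _ _).
have := is_derive_affine (c1 x) (c0 x) t.
by under eq_fun do rewrite mulrC addrC.
Qed.

Section Projection.
Variables (u : R -> F) (c0 c1 : nat -> F).
Hypothesis hc0 : forall n, (0 < n <= N)%N -> L2per a l (c0 n).
Hypothesis hc1 : forall n, (0 < n <= N)%N -> L2per a l (c1 n).
Hypothesis hu : forall n, (0 < n <= N)%N -> forall t, Itv n t ->
  L2 mu (u t) /\ aeq a l (u t) (fun x => c0 n x + t * c1 n x).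

Let md n : F := fun x => c0 n x + mid n * c1 n x.

Let L2md n : (0 < n <= N)%N -> L2per a l (md n).
Proof. by move=> hn; apply: L2perD; [exact: hc0|apply: L2perZ; exact: hc1]. Qed.

Let ipI_proj n (ub phi : F) (v w : R -> F) : (0 < n <= N)%N -> L2 mu ub -> L2 mu phi ->
  (forall t, Itv n t -> v t = ub) -> (forall t, Itv n t -> w t = phi) ->
  ipI a l T N n (fun s x => u s x - v s x) w =
  tau * ip a l (fun x => md n x + -1 * ub x) phi.
Proof.
move=> hn hub hphi ev ew; have n0 : (0 < n)%N by case/andP: hn.
have h0 : L2 mu (c0 n) by case: (hc0 hn).
have h1 : L2 mu (c1 n) by case: (hc1 hn).
transitivity (\int[@lebesgue_measure R]_(s in Itv n)
   ((ip a l (c0 n) phi - ip a l ub phi) + s * ip a l (c1 n) phi)).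
  apply: Rintegral_Itv_eq => s hs; rewrite ev // ew //.
  have [hus es] := hu hn hs.
  rewrite (@ip_ae _ _ _ _ _ (fun x => (c0 n x + s * c1 n x) + -1 * ub x) _ phi) //.
  - rewrite ipDl ?ipDl ?ipZl //; try ring.
    + exact: L2Z.
    + by apply: L2D => //; exact: L2Z.
    + exact: L2Z.
  - under [X in L2 mu X]eq_fun do rewrite -mulN1r; by apply: L2D => //; exact: L2Z.
  - by apply: L2D; [apply: L2D => //; exact: L2Z|exact: L2Z].
  - by move: es; apply: (@filterS _ (almost_everywhere mu)) => x ->; rewrite mulN1r.
  - exact: aeq_refl.
rewrite Rintegral_Itv_affine //; congr (_ * _).
rewrite ipDl ?ipDl ?ipZl //; try ring.
- exact: L2Z.
- by case: (L2md hn).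
- exact: L2Z.
Qed.

(** The piecewise constant with the midpoint values is a projection, because the mean
    of an affine function is its midpoint value.  The chosen projection can only differ
    from it on a null set: test the difference of the two with itself. *)
Lemma bar_affine n t : (0 < n <= N)%N -> Itv n t ->
  L2 mu (bar a l T N u t) /\
  aeq a l (bar a l T N u t) (fun x => c0 n x + mid n * c1 n x).
Proof.
pose ub t x := \sum_(i < N) (if `[< Itv i.+1 t >] then md i.+1 x else 0).
have ubE m s : (0 < m <= N)%N -> Itv m s -> ub s = md m.
  case: m => // m /= mN hs; apply/funext => x.
  rewrite /ub (bigD1 (Ordinal mN)) //= asboolT // big1 ?addr0 // => i im.
  rewrite asboolF // => hi; have [] := Itv_inj (ltn0Sn _) (ltn0Sn _) hi hs.
  by move=> e; move/eqP: im; apply; exact: val_inj.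
have ex : is_L2proj0 a l T N u ub.
  split.
    move=> m hm; apply/Pk0P; exists (md m); first exact: L2md.
    by move=> s; exact: ubE.
  move=> m hm w /Pk0P[phi hphi ew].
  rewrite (@ipI_proj m (md m) phi ub w) //.
  - rewrite ipDl ?ipZl; try (by case: (L2md hm)); try (by case: hphi).
      by rewrite mulN1r subrr mulr0.
    by apply: L2Z; case: (L2md hm).
  - by case: (L2md hm).
  - by case: hphi.
  - by move=> s; exact: ubE.
have [hb ob] : is_L2proj0 a l T N u (bar a l T N u).
  exact: (xgetPex _ (ex_intro _ ub ex)).
move=> hn ht; have /Pk0P[phi hphi ephi] := hb n hn.
rewrite ephi //; split; first by case: hphi.
have n0 : (0 < n)%N by case/andP: hn.
pose z x := md n x + -1 * phi x.
have hz : L2per a l z by apply: L2perD; [exact: L2md|exact: L2perZ].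
have := ob n hn (fun=> z) _; rewrite (@ipI_proj n phi z (bar a l T N u) (fun=> z)) //.
- move=> /(_ _)/eqP; rewrite mulf_eq0 (gt_eqF tau_gt0) /= => h.
  have /eqP/ip_eq0 : ip a l z z == 0 by apply: h; apply/Pk0P; exists z.
  case: (hz) => L2z _ /(_ L2z).
  by apply: (@filterS _ (almost_everywhere mu)) => x; rewrite /z mulN1r => /subr0_eq.
- by case: hphi.
- by case: hz.
Qed.

End Projection.

End TimeGrid.

(** * The mobility form *)

Section Mobility.
Variables (R : realType) (d : nat).
Variables (L : 'rV[R]_(1 + 1 + d + d) -> 'M[R]_(d + 1)) (lam1 lam2 lam3 : R).
Hypothesis hL : mobility_assumption L lam1 lam2 lam3.
Implicit Types (w : 'rV[R]_(1 + 1 + d + d)) (g : 'rV[R]_d) (s : R).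

(** The vector on which the mobility acts in the dissipation; both the flux and
    the source terms are the mobility form of two such vectors. *)
Definition force g s : 'cV[R]_(d + 1) := col_mx g^T s%:M.

Definition qform n (A : 'M[R]_n) (u v : 'cV[R]_n) : R := (u^T *m (A *m v)) 0 0.

Lemma qformE n (A : 'M[R]_n) (u v : 'cV[R]_n) :
  qform A u v = \sum_i u i 0 * \sum_j A i j * v j 0.
Proof. by rewrite /qform mxE; apply: eq_bigr => i _; rewrite !mxE. Qed.

Lemma qformDl n (A : 'M[R]_n) u u' v : qform A (u + u') v = qform A u v + qform A u' v.
Proof. by rewrite /qform linearD /= mulmxDl mxE. Qed.

Lemma qformDr n (A : 'M[R]_n) u v v' : qform A u (v + v') = qform A u v + qform A u v'.
Proof. by rewrite /qform mulmxDr mulmxDr mxE. Qed.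

Lemma qformZl n (A : 'M[R]_n) c u v : qform A (c *: u) v = c * qform A u v.
Proof. by rewrite /qform linearZ /= -scalemxAl mxE. Qed.

Lemma qformZr n (A : 'M[R]_n) c u v : qform A u (c *: v) = c * qform A u v.
Proof. by rewrite /qform -scalemxAr -scalemxAr mxE. Qed.

Lemma mobility_sym w : (L w)^T = L w. Proof. by case: hL. Qed.

Lemma qform_ge0 w u : 0 <= qform (L w) u u.
Proof.
case: hL => /andP[l10 _] _ /(_ w u)/andP[h _] _ _.
rewrite /qform mulmxA; apply: le_trans h.
by rewrite mulr_ge0 ?(ltW l10) // sumr_ge0 // => i _; rewrite sqr_ge0.
Qed.

Lemma qform_le w u : qform (L w) u u <= lam2 * \sum_i u i 0 ^+ 2.
Proof. by case: hL => _ _ /(_ w u)/andP[_ h] _ _; rewrite /qform mulmxA. Qed.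

Lemma lam2_ge0 : 0 <= lam2.
Proof. by case: hL => /andP[h1 h2] _ _ _ _; exact: ltW (lt_le_trans h1 h2). Qed.

Lemma qformC n (A : 'M[R]_n) u v : A^T = A -> qform A u v = qform A v u.
Proof.
move=> AT; rewrite !qformE.
under eq_bigr do rewrite mulr_sumr; rewrite exchange_big /=.
apply: eq_bigr => j _; rewrite mulr_sumr; apply: eq_bigr => i _.
have -> : A j i = A i j by rewrite -[in LHS]AT mxE.
ring.
Qed.

(** Nonnegativity of the form at r u + v. *)
Lemma qform_young w u v (r : R) : 0 < r ->
  - qform (L w) u v <= r / 2 * qform (L w) u u + (2 * r)^-1 * qform (L w) v v.
Proof.
move=> r0; have := qform_ge0 w (r *: u + v).
rewrite !(qformDl, qformDr, qformZl, qformZr) (qformC v u (mobility_sym w)) => h.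
rewrite -subr_ge0.
have -> : r / 2 * qform (L w) u u + (2 * r)^-1 * qform (L w) v v - - qform (L w) u v =
  (2 * r)^-1 * (r * (r * qform (L w) u u) + r * qform (L w) u v
     + (r * qform (L w) u v + qform (L w) v v)) by field; rewrite gt_eqF.
by apply: mulr_ge0; [rewrite invr_ge0 mulr_ge0 // ltW|lra].
Qed.

Lemma mobility_continuous i j : continuous (fun w => L w i j).
Proof. by case: hL => _ _ _ h _; have [] := h i j [::] isT. Qed.

(** Polarisation of the two-sided bound on the form. *)
Lemma mobility_bounded w i j : `|L w i j| <= lam2.
Proof.
pose e k : 'cV[R]_(d + 1) := delta_mx k 0.
have qe i' j' : qform (L w) (e i') (e j') = L w i' j'.
  by rewrite /qform trmx_delta -colE -rowE !mxE.
have sq (c : R) : \sum_k ((e i + c *: e j) k 0) ^+ 2 <= 2 * (1 + c ^+ 2).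
  have s1 k : \sum_m (e k m 0) ^+ 2 = 1.
    rewrite (bigD1 k) //= big1 ?addr0 => [|m mk].
      by rewrite mxE !eqxx expr1n.
    by rewrite mxE (negbTE mk) expr0n.
  have -> : 2 * (1 + c ^+ 2) = \sum_k (2 * (e i k 0) ^+ 2 + 2 * c ^+ 2 * (e j k 0) ^+ 2).
    by rewrite big_split /= -!mulr_sumr !s1; ring.
  apply: ler_sum => k _; 
  have -> : (e i + c *: e j) k 0 = e i k 0 + c * e j k 0 by rewrite !mxE.
  rewrite -subr_ge0.
  have -> : 2 * e i k 0 ^+ 2 + 2 * c ^+ 2 * e j k 0 ^+ 2 - (e i k 0 + c * e j k 0) ^+ 2
     = (e i k 0 - c * e j k 0) ^+ 2 by ring.
  exact: sqr_ge0.
have q c : qform (L w) (e i + c *: e j) (e i + c *: e j) =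
   L w i i + c * (2 * L w i j) + c ^+ 2 * L w j j.
  rewrite !(qformDl, qformDr, qformZl, qformZr) !qe.
  have -> : L w j i = L w i j by rewrite -[in LHS](mobility_sym w) mxE.
  ring.
have p1 := qform_ge0 w (e i + 1 *: e j); have p2 := qform_ge0 w (e i + (-1) *: e j).
have u1 := le_trans (qform_le w (e i + 1 *: e j)) (ler_wpM2l lam2_ge0 (sq 1)).
have u2 := le_trans (qform_le w (e i + (-1) *: e j)) (ler_wpM2l lam2_ge0 (sq (-1))).
move: p1 p2 u1 u2; rewrite !q sqrrN !expr1n => p1 p2 u1 u2.
by rewrite ler_norml; apply/andP; split; lra.
Qed.

Lemma forceE g s i : force g s i 0 = if fintype.split i is inl k then g 0 k else s.
Proof.
rewrite mxE; case: fintype.split => k; first by rewrite mxE.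
by rewrite mxE !ord1 eqxx mulr1n.
Qed.

Lemma force_add g s : force g s = force g 0 + force 0 s.
Proof.
apply/colP => i; rewrite [RHS]mxE !forceE; case: fintype.split => k; last by rewrite add0r.
by rewrite mxE addr0.
Qed.

(** The divergence equation is the mobility form tested with (g', 0). *)
Lemma fluxE w g s g' :
  dotv (L11 L w *m g^T + s *: L12 L w)^T g' = qform (L w) (force g' 0) (force g s).
Proof.
rewrite /qform /force -{1}[L w]submxK mul_block_col tr_col_mx mul_row_col.
rewrite [(0%:M)^T](_ : _ = 0) ?mul0mx ?addr0; last by rewrite raddf0 trmx0.
rewrite trmxK mul_mx_scalar [RHS]mxE /dotv; apply: eq_bigr => i _.
by rewrite mxE mulrC.
Qed.

(** The reaction equation is the mobility form tested with (0, s'). *)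
Lemma sourceE w g s s' :
  (((L12 L w)^T *m g^T) 0 0 + L22 L w * s) * s' = qform (L w) (force 0 s') (force g s).
Proof.
rewrite /qform /force -{1}[L w]submxK mul_block_col tr_col_mx mul_row_col trmxK.
rewrite mul0mx add0r tr_scalar_mx mul_scalar_mx.
have -> : dlsubmx (L w) = (L12 L w)^T.
  by rewrite /L12 trmx_ursub mobility_sym.
rewrite [RHS]mxE mulrC [X in _ = _ * X]mxE; congr (_ * (_ + _)).
by rewrite mul_mx_scalar [RHS]mxE /L22 mulrC.
Qed.

End Mobility.

Lemma cauchy_schwarz_sum (R : realFieldType) n (c p : 'I_n -> R) :
  (\sum_k c k * p k) ^+ 2 <= (\sum_k c k ^+ 2) * \sum_k p k ^+ 2.
Proof.
have : 0 <= \sum_k \sum_m (c k * p m - c m * p k) ^+ 2.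
  by apply: sumr_ge0 => k _; apply: sumr_ge0 => m _; rewrite sqr_ge0.
have -> : \sum_k \sum_m (c k * p m - c m * p k) ^+ 2 =
  2 * ((\sum_k c k ^+ 2) * (\sum_k p k ^+ 2) - (\sum_k c k * p k) ^+ 2).
  transitivity (\sum_k \sum_m (c k ^+ 2 * p m ^+ 2) + \sum_k \sum_m (p k ^+ 2 * c m ^+ 2)
     - 2 * \sum_k \sum_m ((c k * p k) * (c m * p m))).
    rewrite -big_split mulr_sumr -sumrB /=; apply: eq_bigr => k _.
    by rewrite -big_split mulr_sumr -sumrB /=; apply: eq_bigr => m _; ring.
  have dist (u v : 'I_n -> R) : \sum_k \sum_m u k * v m = (\sum_k u k) * \sum_m v m.
    by rewrite mulr_suml; apply: eq_bigr => k _; rewrite mulr_sumr.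
  rewrite (dist (fun k => c k ^+ 2) (fun k => p k ^+ 2)) (dist (fun k => p k ^+ 2) (fun k => c k ^+ 2)).
  by rewrite (dist (fun k => c k * p k) (fun k => c k * p k)); ring.
by rewrite pmulr_rge0 // subr_ge0.
Qed.

Section MobilityIntegrals.
Variables (R : realType) (d : nat) (a : 'rV[R]_d) (l : R).
Hypothesis l0 : 0 < l.
Variables (L : 'rV[R]_(1 + 1 + d + d) -> 'M[R]_(d + 1)) (lam1 lam2 lam3 : R).
Hypothesis hL : mobility_assumption L lam1 lam2 lam3.
Local Notation mu := (mu_cube a l).
Local Notation F := ('rV[R]_d -> R).
Local Notation W := ('rV[R]_d -> 'rV[R]_(1 + 1 + d + d)).
Local Notation C := ('rV[R]_d -> 'cV[R]_(d + 1)).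

Definition L2row n (w : 'rV[R]_d -> 'rV[R]_n) := forall j, L2 mu (fun x => w x 0 j).
Definition L2col (P : C) := forall j, L2 mu (fun x => P x j 0).

Lemma measurable_mobility (w : W) i j : L2row w ->
  measurable_fun setT (fun x => L (w x) i j).
Proof.
move=> hw; apply: (@measurableT_comp _ _ _ _ _ _ (fun v => L v i j) _ w).
  by apply: continuous_measurable_rV; exact: (mobility_continuous hL).
by apply: measurable_fun_rV => k; exact: L2_measurable (hw k).
Qed.

Lemma Rint_mobility (w : W) i j (f : F) : L2row w -> Rintegrable mu f ->
  Rintegrable mu (fun x => L (w x) i j * f x).
Proof.
move=> hw hf; apply: (Rint_le (g := fun x => lam2 * `|f x|)).
- by apply: measurable_funM; [exact: measurable_mobility|exact: Rint_measurable hf].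
- by apply: RintZ; have := integrable_abse hf; apply: eq_integrable.
by move=> x; rewrite normrM ler_wpM2r // (mobility_bounded hL).
Qed.

Lemma qform_sum (A : 'M[R]_(d + 1)) (u v : 'cV[R]_(d + 1)) :
  qform A u v = \sum_i \sum_j A i j * (u i 0 * v j 0).
Proof.
rewrite qformE; apply: eq_bigr => i _; rewrite mulr_sumr; apply: eq_bigr => j _; ring.
Qed.

Lemma Rint_qform (w : W) (P Q : C) : L2row w -> L2col P -> L2col Q ->
  Rintegrable mu (fun x => qform (L (w x)) (P x) (Q x)).
Proof.
move=> hw hP hQ; under [X in Rintegrable _ X]eq_fun do rewrite qform_sum.
apply: Rint_sum => i; apply: Rint_sum => j; apply: Rint_mobility => //.
exact: L2_mul.
Qed.

Definition Qform (w : W) (P Q : C) : R := \int[mu]_x qform (L (w x)) (P x) (Q x).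

Lemma Qform_ae w w' P P' Q Q' : L2row w -> L2row w' ->
  L2col P -> L2col P' -> L2col Q -> L2col Q' ->
  {ae mu, forall x, w x = w' x} -> {ae mu, forall x, P x = P' x} ->
  {ae mu, forall x, Q x = Q' x} -> Qform w P Q = Qform w' P' Q'.
Proof.
move=> hw hw' hP hP' hQ hQ' ew eP eQ; apply: Rintegral_ae.
- exact: Rint_measurable (Rint_qform hw hP hQ).
- exact: Rint_measurable (Rint_qform hw' hP' hQ').
by move: ew eP eQ; apply: (@filterS3 _ (almost_everywhere mu)) => x -> -> ->.
Qed.

Lemma L2col_sum n (c : 'I_n -> R) (P : 'I_n -> C) : (forall k, L2col (P k)) ->
  L2col (fun x => \sum_k c k *: P k x).
Proof.
move=> hP j; under [X in L2 mu X]eq_fun do rewrite summxE.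
by apply: L2_sum => k; under [X in L2 mu X]eq_fun do rewrite mxE; apply: L2Z; exact: hP.
Qed.

Lemma qform_suml n (c : 'I_n -> R) (A : 'M[R]_(d + 1)) (u : 'I_n -> 'cV[R]_(d + 1)) v :
  qform A (\sum_k c k *: u k) v = \sum_k c k * qform A (u k) v.
Proof.
rewrite (big_morph (fun u => qform A u v) (id1 := 0) (op1 := +%R)).
- by apply: eq_bigr => k _; exact: qformZl.
- by move=> x y; exact: qformDl.
- by rewrite /qform trmx0 mul0mx mxE.
Qed.

Lemma qform_sumr n (c : 'I_n -> R) (A : 'M[R]_(d + 1)) u (v : 'I_n -> 'cV[R]_(d + 1)) :
  qform A u (\sum_k c k *: v k) = \sum_k c k * qform A u (v k).
Proof.
rewrite (big_morph (qform A u) (id1 := 0) (op1 := +%R)).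
- by apply: eq_bigr => k _; exact: qformZr.
- by move=> x y; exact: qformDr.
- by rewrite /qform !mulmx0 mxE.
Qed.

Lemma Qform_suml n (c : 'I_n -> R) w (P : 'I_n -> C) Q : L2row w ->
  (forall k, L2col (P k)) -> L2col Q ->
  Qform w (fun x => \sum_k c k *: P k x) Q = \sum_k c k * Qform w (P k) Q.
Proof.
move=> hw hP hQ; rewrite /Qform.
under eq_Rintegral do rewrite qform_suml.
rewrite Rintegral_sum => [|k]; last by apply: RintZ; exact: Rint_qform.
by apply: eq_bigr => k _; rewrite Rintegral_scale //; exact: Rint_qform.
Qed.

Lemma Qform_sumr n (c : 'I_n -> R) w P (Q : 'I_n -> C) : L2row w ->
  L2col P -> (forall k, L2col (Q k)) ->
  Qform w P (fun x => \sum_k c k *: Q k x) = \sum_k c k * Qform w P (Q k).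
Proof.
move=> hw hP hQ; rewrite /Qform.
under eq_Rintegral do rewrite qform_sumr.
rewrite Rintegral_sum => [|k]; last by apply: RintZ; exact: Rint_qform.
by apply: eq_bigr => k _; rewrite Rintegral_scale //; exact: Rint_qform.
Qed.

(** With c_k = - Qform w (P k) Q and U = sum_k c_k P k, the left-hand side is
    N = - Qform w U Q.  Young's inequality bounds it by r/2 Qform w U U + 1/(2r) Qform w Q Q,
    and Qform w U U is at most a constant times N, so that for small r the first term is
    absorbed.  The constant depends on the P k only, not on the state w. *)
Lemma dissipation_controls n (P : 'I_n -> C) : (forall k, L2col (P k)) ->
  exists2 K : R, 0 <= K & forall w (Q : C), L2row w -> L2col Q ->
    \sum_k (Qform w (P k) Q) ^+ 2 <= K * Qform w Q Q.
Proof.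
move=> hP; pose S := \sum_k \sum_i \int[mu]_x (P k x i 0 * P k x i 0).
have S0 : 0 <= S.
  apply: sumr_ge0 => k _; apply: sumr_ge0 => i _; apply: Rintegral_ge0 => x _.
  by rewrite -expr2 sqr_ge0.
pose r := (lam2 * S + 1)^-1.
have lS : 0 <= lam2 * S by rewrite mulr_ge0 // (lam2_ge0 hL).
have r0 : 0 < r by rewrite invr_gt0 ltr_wpDl.
exists r^-1 => [|w Q hw hQ]; first by rewrite invr_ge0 ltW.
set c := fun k => - Qform w (P k) Q.
pose U x := \sum_k c k *: P k x.
have hU : L2col U by exact: L2col_sum.
set N := \sum_k _.
have NE : N = - Qform w U Q.
  rewrite Qform_suml // -sumrN; apply: eq_bigr => k _; rewrite /c; ring.
have QU : Qform w U U <= lam2 * (S * N).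
  have sq x : \sum_i U x i 0 ^+ 2 <= N * \sum_k \sum_i (P k x i 0 * P k x i 0).
    rewrite exchange_big /= mulr_sumr; apply: ler_sum => i _.
    have -> : U x i 0 = \sum_k c k * P k x i 0.
      by rewrite summxE; apply: eq_bigr => k _; rewrite mxE.
    have -> : N = \sum_k c k ^+ 2 by apply: eq_bigr => k _; rewrite /c sqrrN.
    under [X in _ * X]eq_bigr do rewrite -expr2.
    exact: cauchy_schwarz_sum.
  have IS : Rintegrable mu (fun x => \sum_k \sum_i (P k x i 0 * P k x i 0)).
    by apply: Rint_sum => k; apply: Rint_sum => i; apply: L2_mul; exact: hP.
  have -> : lam2 * (S * N) = \int[mu]_x (lam2 * (N * \sum_k \sum_i (P k x i 0 * P k x i 0))).
    rewrite !Rintegral_scale //; last exact: RintZ.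
    rewrite Rintegral_sum => [|k]; last by apply: Rint_sum => i; apply: L2_mul; exact: hP.
    rewrite /S; congr (_ * _); rewrite mulrC; congr (_ * _); apply: eq_bigr => k _.
    by rewrite Rintegral_sum // => i; apply: L2_mul; exact: hP.
  apply: le_Rintegral => //; first exact: Rint_qform.
    by apply: RintZ; exact: RintZ.
  move=> x _; apply: le_trans (qform_le hL _ _) _.
  by rewrite ler_wpM2l // (lam2_ge0 hL).
have Y : N <= r / 2 * Qform w U U + (2 * r)^-1 * Qform w Q Q.
  rewrite NE [Qform w U U]/Qform [Qform w Q Q]/Qform -!Rintegral_scale; try exact: Rint_qform.
  rewrite -Rintegral_add; try by apply: RintZ; exact: Rint_qform.
  have -> : - Qform w U Q = \int[mu]_x (- 1 * qform (L (w x)) (U x) (Q x)).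
    by rewrite Rintegral_scale ?mulN1r //; exact: Rint_qform.
  apply: le_Rintegral => //.
  - by apply: RintZ; exact: Rint_qform.
  - by apply: RintD; apply: RintZ; exact: Rint_qform.
  by move=> x _; rewrite mulN1r; exact: (qform_young hL).
have N0 : 0 <= N by apply: sumr_ge0 => k _; rewrite sqr_ge0.
have rS : r * (lam2 * S) <= 1.
  by rewrite /r mulrC ler_pdivrMr ?mul1r ?lerDl // ltr_wpDl.
have h1 : r / 2 * Qform w U U <= N / 2.
  have := ler_wpM2l (ltW r0) QU.
  have : r * (lam2 * (S * N)) <= N.
    have -> : r * (lam2 * (S * N)) = r * (lam2 * S) * N by ring.
    by rewrite -[leRHS]mul1r ler_wpM2r.
  by lra.
have h2 : N / 2 <= (2 * r)^-1 * Qform w Q Q by lra.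
have -> : r^-1 * Qform w Q Q = 2 * ((2 * r)^-1 * Qform w Q Q) by field; rewrite gt_eqF.
by lra.
Qed.

Lemma L2col_force (g : 'rV[R]_d -> 'rV[R]_d) (s : F) :
  L2row g -> L2 mu s -> L2col (fun x => force (g x) (s x)).
Proof.
move=> hg hs i; under [X in L2 mu X]eq_fun do rewrite forceE.
by case: fintype.split => k.
Qed.

Lemma L2row_grad v : H1per a l v -> L2row (grad a l v).
Proof. by move=> hv j; under [X in L2 mu X]eq_fun do rewrite mxE; exact: weak_pderiv_L2. Qed.

Lemma L2row0 n : L2row (fun=> 0 : 'rV[R]_n).
Proof. by move=> j; under [X in L2 mu X]eq_fun do rewrite mxE; exact: L20. Qed.

End MobilityIntegrals.

(** * Energies along a line of functions *)

Section StepPreliminaries.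
Variables (R : realType) (d : nat) (a : 'rV[R]_d) (l : R).
Hypothesis l0 : 0 < l.
Local Notation mu := (mu_cube a l).
Local Notation F := ('rV[R]_d -> R).

(** The argument of the mobility as a function of values and gradients given
    separately, so that gradients can be replaced by other representatives. *)
Definition state (p q : R) (g g' : 'rV[R]_d) : 'rV[R]_(1 + 1 + d + d) :=
  row_mx (row_mx (row_mx p%:M q%:M) g) g'.

Lemma omegaE r e x : omega a l r e x = state (r x) (e x) (grad a l r x) (grad a l e x).
Proof. by []. Qed.

Lemma state_coord (X : Type) (P : (X -> R) -> Prop) (p q : X -> R) (g g' : X -> 'rV[R]_d) :
  P p -> P q -> (forall k, P (fun x => g x 0 k)) -> (forall k, P (fun x => g' x 0 k)) ->
  forall j, P (fun x => state (p x) (q x) (g x) (g' x) 0 j).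
Proof.
move=> Pp Pq Pg Pg' j; rewrite /state.
have E (u : X -> R) : (forall x, row_mx (row_mx (row_mx (p x)%:M (q x)%:M) (g x)) (g' x) 0 j = u x) ->
    P u -> P (fun x => row_mx (row_mx (row_mx (p x)%:M (q x)%:M) (g x)) (g' x) 0 j).
  by move=> /funext ->.
case: (fintype.splitP j) => [j1 ej|k ek]; last first.
  have -> : j = rshift _ k by apply: val_inj.
  by under eq_fun do rewrite row_mxEr.
have -> : j = lshift _ j1 by apply: val_inj.
under eq_fun do rewrite row_mxEl.
case: (fintype.splitP j1) => [j2 ej2|k ek]; last first.
  have -> : j1 = rshift _ k by apply: val_inj.
  by under eq_fun do rewrite row_mxEr.
have -> : j1 = lshift _ j2 by apply: val_inj.
under eq_fun do rewrite row_mxEl.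
case: (fintype.splitP j2) => [k ek|k ek].
  have -> : j2 = lshift _ k by apply: val_inj.
  by under eq_fun do rewrite row_mxEl mxE !ord1 eqxx mulr1n.
have -> : j2 = rshift _ k by apply: val_inj.
by under eq_fun do rewrite row_mxEr mxE !ord1 eqxx mulr1n.
Qed.

Definition kin (g g' : 'rV[R]_d -> 'rV[R]_d) : R := \int[mu]_x dotv (g x) (g' x).

Lemma Rint_dotv (g g' : 'rV[R]_d -> 'rV[R]_d) : L2row a l g -> L2row a l g' -> Rintegrable mu (fun x => dotv (g x) (g' x)).
Proof. by move=> hg hg'; apply: Rint_sum => i; exact: L2_mul. Qed.

Lemma dotvC n (u v : 'rV[R]_n) : dotv u v = dotv v u.
Proof. by apply: eq_bigr => i _; rewrite mulrC. Qed.

Lemma dotvDl n (u u' v : 'rV[R]_n) : dotv (u + u') v = dotv u v + dotv u' v.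
Proof. by rewrite -big_split; apply: eq_bigr => i _; rewrite mxE mulrDl. Qed.

Lemma dotvZl n c (u v : 'rV[R]_n) : dotv (c *: u) v = c * dotv u v.
Proof. by rewrite mulr_sumr; apply: eq_bigr => i _; rewrite mxE mulrA. Qed.

Lemma kinC g g' : kin g g' = kin g' g.
Proof. by apply: eq_Rintegral => x _; rewrite dotvC. Qed.

Lemma kinDl g g' u : L2row a l g -> L2row a l g' -> L2row a l u ->
  kin (fun x => g x + g' x) u = kin g u + kin g' u.
Proof.
move=> h h' hu; rewrite /kin -Rintegral_add; try exact: Rint_dotv.
by apply: eq_Rintegral => x _; rewrite dotvDl.
Qed.

Lemma kinZl c g u : L2row a l g -> L2row a l u -> kin (fun x => c *: g x) u = c * kin g u.
Proof.
move=> h hu; rewrite /kin -Rintegral_scale; last exact: Rint_dotv.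
by apply: eq_Rintegral => x _; rewrite dotvZl.
Qed.

Lemma L2rowD n (g g' : 'rV[R]_d -> 'rV[R]_n) : L2row a l g -> L2row a l g' ->
  L2row a l (fun x => g x + g' x).
Proof. by move=> h h' j; under [X in L2 mu X]eq_fun do rewrite mxE; exact: L2D. Qed.

Lemma L2rowZ n c (g : 'rV[R]_d -> 'rV[R]_n) : L2row a l g -> L2row a l (fun x => c *: g x).
Proof. by move=> h j; under [X in L2 mu X]eq_fun do rewrite mxE; exact: L2Z. Qed.

Lemma L2row_sum n k (c : 'I_k -> R) (g : 'I_k -> 'rV[R]_d -> 'rV[R]_n) :
  (forall i, L2row a l (g i)) -> L2row a l (fun x => \sum_i c i *: g i x).
Proof.
move=> h j; under [X in L2 mu X]eq_fun do rewrite summxE.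
by apply: L2_sum => i; under [X in L2 mu X]eq_fun do rewrite mxE; apply: L2Z; exact: h.
Qed.

Lemma kin_suml k (c : 'I_k -> R) g u : (forall i, L2row a l (g i)) -> L2row a l u ->
  kin (fun x => \sum_i c i *: g i x) u = \sum_i c i * kin (g i) u.
Proof.
elim: k c g => [|k IH] c g hg hu.
  rewrite big_ord0 -[RHS](mul0r (kin u u)) -kinZl //.
  by apply: eq_Rintegral => x _; rewrite big_ord0 scale0r.
rewrite big_ord_recl -IH // -kinZl // -kinDl //.
- by apply: eq_Rintegral => x _; rewrite big_ord_recl.
- exact: L2rowZ.
- exact: L2row_sum.
Qed.

Lemma kin_ae g g' u u' : L2row a l g -> L2row a l g' -> L2row a l u -> L2row a l u' ->
  {ae mu, forall x, g x = g' x} -> {ae mu, forall x, u x = u' x} -> kin g u = kin g' u'.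
Proof.
move=> hg hg' hu hu' e1 e2; apply: Rintegral_ae.
- exact: Rint_measurable (Rint_dotv hg hu).
- exact: Rint_measurable (Rint_dotv hg' hu').
by move: e1 e2; apply: (@filterS2 _ (almost_everywhere mu)) => x -> ->.
Qed.

Lemma kin_ge0 g : 0 <= kin g g.
Proof. by apply: Rintegral_ge0 => x _; exact: dotv_ge0. Qed.

Lemma ae_row n (g g' : 'rV[R]_d -> 'rV[R]_n) :
  (forall k, aeq a l (fun x => g x 0 k) (fun x => g' x 0 k)) ->
  {ae mu, forall x, g x = g' x}.
Proof.
move=> h; have : {ae mu, forall x, forall k, g x 0 k = g' x 0 k}.
  by apply: filter_forall => k; exact: h.
by apply: (@filterS _ (almost_everywhere mu)) => x e; apply/rowP => k.
Qed.

(** The identity |x + s y|^2 - |x|^2 = 2 s <x + (s/2) y, y>: the increment of a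
    quadratic energy is the power at the midpoint. *)
Lemma kin_increment g0 g1 (s : R) : L2row a l g0 -> L2row a l g1 ->
  kin (fun x => g0 x + s *: g1 x) (fun x => g0 x + s *: g1 x) - kin g0 g0 =
  2 * s * kin (fun x => g0 x + (s / 2) *: g1 x) g1.
Proof.
move=> h0 h1.
rewrite !kinDl //; try (by apply: L2rowZ); try (by apply: L2rowD => //; exact: L2rowZ).
rewrite !kinZl //; try (by apply: L2rowD => //; exact: L2rowZ).
rewrite [kin g0 (fun x => _)]kinC [kin g1 (fun x => _)]kinC.
rewrite !kinDl ?kinZl //; try (by apply: L2rowZ).
by rewrite (kinC g1 g0); field.
Qed.

Variables (K : finType) (vtx : K -> 'I_d.+1 -> 'rV[R]_d).
Hypothesis cover : \bigcup_(k in [set: K]) simplex (vtx k) = cube a l.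
Local Notation V := (Vh a l vtx).
Variable f : 'rV[R]_2 -> R.
Hypothesis sf : smooth f.

(** Makes a function of the finite element space bounded on the whole space without
    changing any integral. *)
Definition cut (v : F) : F := v \_ (cube a l).

Lemma cut_cube v x : cube a l x -> cut v x = v x.
Proof. by move=> xc; rewrite /cut patchE mem_set. Qed.

Lemma measurable_cut v : V v -> measurable_fun setT (cut v).
Proof.
move=> hv; have mv := L2_measurable (Vh_L2 hv).
apply/(measurable_restrictT _ _).1; first exact: measurable_box.
exact: measurable_funTS.
Qed.

Lemma bounded_cut v : V v -> exists B, forall x, `|cut v x| <= B.
Proof.
move=> /(Vh_bounded cover)[B hB]; exists `|B| => x; rewrite /cut patchE.
case: ifP => [|_]; last by rewrite normr0.
by rewrite inE => /hB h; rewrite (le_trans h) // ler_norm.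
Qed.

Lemma Rint_Vh_comp (h : 'rV[R]_2 -> R) (u v w : F) : continuous h -> V u -> V v -> L2 mu w ->
  Rintegrable mu (fun x => h (pt2 (u x) (v x)) * w x).
Proof.
move=> ch hu hv hw.
have [B hB] := Vh_bounded cover hu; have [B' hB'] := Vh_bounded cover hv.
have [C hC] := bounded_pt2 (Num.max B B') ch.
have Iw := L2_Rint (mu_cube_fin a l0) hw.
apply: (Rint_ae_le (g := fun x => C * `|w x|)).
- apply: measurable_funM; last exact: Rint_measurable Iw.
  exact: measurable_pt2 ch (L2_measurable (Vh_L2 hu)) (L2_measurable (Vh_L2 hv)).
- by apply: RintZ; have := integrable_abse Iw; apply: eq_integrable.
apply: ae_in_cube => x xc; rewrite normrM ler_wpM2r // hC // le_max.
  by rewrite hB.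
by rewrite hB' ?orbT.
Qed.

Lemma potential_increment_Vh c0 c1 e0 e1 (u v : R) : V c0 -> V c1 -> V e0 -> V e1 -> u < v ->
  let r s x := c0 x + s * c1 x in let e s x := e0 x + s * e1 x in
  \int[@lebesgue_measure R]_(s in `]u, v[)
     (ip a l (fun x => f_rho f (pt2 (r s x) (e s x))) c1
      + ip a l (fun x => f_eta f (pt2 (r s x) (e s x))) e1) =
  (\int[mu]_x f (pt2 (r v x) (e v x))) - \int[mu]_x f (pt2 (r u x) (e u x)).
Proof.
move=> h0 h1 k0 k1 uv r e.
have [B0 b0] := bounded_cut h0; have [B1 b1] := bounded_cut h1.
have [B2 b2] := bounded_cut k0; have [B3 b3] := bounded_cut k1.
pose B := Num.max (Num.max B0 B1) (Num.max B2 B3).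
have bB0 x : `|cut c0 x| <= B by rewrite !le_max b0.
have bB1 x : `|cut c1 x| <= B by rewrite !le_max b1 orbT.
have bB2 x : `|cut e0 x| <= B by rewrite !le_max b2 !orbT.
have bB3 x : `|cut e1 x| <= B by rewrite !le_max b3 !orbT.
have := @potential_increment _ _ R mu (mu_cube_fin a l0) f sf (cut c0) (cut c1) (cut e0) (cut e1) B
  (measurable_cut h0) (measurable_cut h1) (measurable_cut k0) (measurable_cut k1)
  bB0 bB1 bB2 bB3 u v uv.
have Vr s : V (r s) by apply: VhD => //; exact: VhZ.
have Ve s : V (e s) by apply: VhD => //; exact: VhZ.
have E s : \int[mu]_x f (pt2 (cut c0 x + s * cut c1 x) (cut e0 x + s * cut e1 x)) =
    \int[mu]_x f (pt2 (r s x) (e s x)).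
  apply: Rintegral_ae.
  - apply: measurable_pt2; first exact: smooth_continuous.
      by apply: measurable_funD; [exact: measurable_cut|apply: measurable_funM => //; exact: measurable_cut].
    by apply: measurable_funD; [exact: measurable_cut|apply: measurable_funM => //; exact: measurable_cut].
  - by apply: measurable_pt2; [exact: smooth_continuous|exact: L2_measurable (Vh_L2 (Vr s))|exact: L2_measurable (Vh_L2 (Ve s))].
  by apply: ae_in_cube => x xc; rewrite !cut_cube.
rewrite !E => <-; apply: eq_Rintegral => s _.
have cr : continuous (f_rho f) by exact: (smooth_pderiv 0 sf).1.
have ce : continuous (f_eta f) by exact: (smooth_pderiv 1 sf).1.
have I1 := Rint_Vh_comp cr (Vr s) (Ve s) (Vh_L2 h1).
have I2 := Rint_Vh_comp ce (Vr s) (Ve s) (Vh_L2 k1).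
rewrite /ip -Rintegral_add //; apply: Rintegral_ae.
- exact: Rint_measurable (RintD I1 I2).
- have mc (w0 w1 : F) : V w0 -> V w1 -> measurable_fun setT (fun x => cut w0 x + s * cut w1 x).
    by move=> hw0 hw1; apply: measurable_funD; [exact: measurable_cut|apply: measurable_funM => //; exact: measurable_cut].
  apply: measurable_funD; apply: measurable_funM; try exact: measurable_cut.
    exact: measurable_pt2 cr (mc _ _ h0 h1) (mc _ _ k0 k1).
  exact: measurable_pt2 ce (mc _ _ h0 h1) (mc _ _ k0 k1).
by apply: ae_in_cube => x xc; rewrite !cut_cube.
Qed.

End StepPreliminaries.

(** * Continuous dependence on parameters *)

Section ContinuousDependence.
Variables (R : realType) (d : nat) (a : 'rV[R]_d) (l : R).
Hypothesis l0 : 0 < l.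
Local Notation mu := (mu_cube a l).
Local Notation F := ('rV[R]_d -> R).
Variables (K : finType) (vtx : K -> 'I_d.+1 -> 'rV[R]_d).
Hypothesis cover : \bigcup_(k in [set: K]) simplex (vtx k) = cube a l.
Local Notation V := (Vh a l vtx).

Lemma continuous_Qform (L : 'rV[R]_(1 + 1 + d + d) -> 'M[R]_(d + 1)) (lam1 lam2 lam3 : R)
    (hL : mobility_assumption L lam1 lam2 lam3) (Z : normedModType R)
    (w : Z -> 'rV[R]_d -> 'rV[R]_(1 + 1 + d + d)) P Q :
  (forall z, L2row a l (w z)) -> (forall x, continuous (w ^~ x)) ->
  L2col a l P -> L2col a l Q -> continuous (fun z => Qform a l L (w z) P Q).
Proof.
move=> hw cw hP hQ.
have PQ i j : Rintegrable mu (fun x => P x i 0 * Q x j 0) by exact: L2_mul.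
have -> : (fun z => Qform a l L (w z) P Q) =
    (fun z => \sum_i \sum_j \int[mu]_x (L (w z x) i j * (P x i 0 * Q x j 0))).
  apply/funext => z; rewrite /Qform.
  under eq_Rintegral do rewrite qform_sum.
  rewrite Rintegral_sum => [|i]; last first.
    by apply: Rint_sum => j; exact: (Rint_mobility hL).
  apply: eq_bigr => i _; rewrite Rintegral_sum // => j.
  exact: (Rint_mobility hL).
apply: continuous_sumr => i; apply: continuous_sumr => j.
apply: (@continuous_Rintegral_param R _ _ mu Z setT (fun z x => L (w z x) i j)) => //.
- by apply: aeW.
- by move=> z; exact: (measurable_mobility hL).
- move=> x _; apply: (@continuous_comp_rV R Z _ (w ^~ x) (fun v => L v i j)) => //.
  exact: (mobility_continuous hL).
- by move=> r; exists lam2 => z x _ _; exact: (mobility_bounded hL).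
Qed.

Section Families.
Variable Z : normedModType R.

Definition ball_bounded (phi : Z -> R) : Prop :=
  forall r, exists B, forall z, `|z| <= r -> `|phi z| <= B.

(** The properties that survive the algebraic operations and allow one to pass to the
    limit under integrals over the cell. *)
Definition Vfamily (u : Z -> F) : Prop :=
  [/\ forall z, V (u z), forall x, continuous (u ^~ x) &
      forall r, exists B, forall z x, `|z| <= r -> cube a l x -> `|u z x| <= B].

Lemma family_cst v : V v -> Vfamily (fun=> v).
Proof.
move=> hv; split=> // [x z|r]; first exact: cvg_cst.
by have [B hB] := Vh_bounded cover hv; exists B => z x _; exact: hB.
Qed.

Lemma familyD u v : Vfamily u -> Vfamily v -> Vfamily (fun z x => u z x + v z x).
Proof.
move=> [hu cu bu] [hv cv bv]; split=> [z|x z|r].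
- exact: VhD.
- exact: (cvgD (cu x z) (cv x z)).
have [B hB] := bu r; have [B' hB'] := bv r.
by exists (B + B') => z x zr xc; rewrite (le_trans (ler_normD _ _)) // lerD ?hB ?hB'.
Qed.

Lemma familyM phi u : continuous phi -> ball_bounded phi -> Vfamily u ->
  Vfamily (fun z x => phi z * u z x).
Proof.
move=> cphi bphi [hu cu bu]; split=> [z|x z|r].
- exact: VhZ.
- exact: (cvgM (cphi z) (cu x z)).
have [B hB] := bu r; have [B' hB'] := bphi r.
by exists (B' * B) => z x zr xc; rewrite normrM ler_pM ?hB ?hB'.
Qed.

Lemma familyZ c u : Vfamily u -> Vfamily (fun z x => c * u z x).
Proof.
move=> hu; apply: (@familyM (fun=> c)) => //; first by move=> z; exact: cvg_cst.
by move=> r; exists `|c|.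
Qed.

Lemma family_sum n (phi : 'I_n -> Z -> R) (b : 'I_n -> F) :
  (forall i, continuous (phi i)) -> (forall i, ball_bounded (phi i)) -> (forall i, V (b i)) ->
  Vfamily (fun z x => \sum_i phi i z * b i x).
Proof.
elim: n phi b => [|n IH] phi b cphi bphi hb.
  under [X in Vfamily X]eq_fun do under eq_fun do rewrite big_ord0.
  by apply: family_cst; exact: Vh_cst.
under [X in Vfamily X]eq_fun do under eq_fun do rewrite big_ord_recl.
apply: familyD; last exact: IH.
by apply: familyM => //; exact: family_cst.
Qed.

Lemma continuous_ip_comp (h : 'rV[R]_2 -> R) (u v : Z -> F) w : continuous h ->
  Vfamily u -> Vfamily v -> L2 mu w ->
  continuous (fun z => ip a l (fun x => h (pt2 (u z x) (v z x))) w).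
Proof.
move=> ch [hu cu bu] [hv cv bv] hw.
apply: (@continuous_Rintegral_param R _ _ mu Z (cube a l)
  (fun z x => h (pt2 (u z x) (v z x))) w).
- exact: ae_cube.
- move=> z; exact: measurable_pt2 ch (L2_measurable (Vh_L2 (hu z))) (L2_measurable (Vh_L2 (hv z))).
- by have := L2_Rint (mu_cube_fin a l0) hw.
- move=> x _; apply: continuous_comp_rV => //; exact: continuous_pt2.
move=> r; have [B hB] := bu r; have [B' hB'] := bv r.
have [C hC] := bounded_pt2 (Num.max B B') ch.
exists C => z x zr xc; apply: hC; rewrite le_max ?hB //.
by rewrite hB' ?orbT.
Qed.

End Families.

Lemma ip_comp_bounded (h : 'rV[R]_2 -> R) (u v w : F) C : continuous h -> V u -> V v ->
  L2 mu w -> (forall x, cube a l x -> `|h (pt2 (u x) (v x))| <= C) ->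
  `|ip a l (fun x => h (pt2 (u x) (v x))) w| <= C * \int[mu]_x `|w x|.
Proof.
move=> ch hu hv hw hC; have I := Rint_Vh_comp l0 cover ch hu hv hw.
have Iw : Rintegrable mu (fun x => `|w x|).
  by have := integrable_abse (L2_Rint (mu_cube_fin a l0) hw); apply: eq_integrable.
apply: le_trans (le_normr_Rintegral _ _) _ => //.
rewrite -Rintegral_scale //.
have In : Rintegrable mu (fun x => `|h (pt2 (u x) (v x)) * w x|).
  by have := integrable_abse I; apply: eq_integrable.
have -> : \int[mu]_x (C * `|w x|) =
  \int[mu]_x (Num.max (C * `|w x|) `|h (pt2 (u x) (v x)) * w x|).
  apply: Rintegral_ae.
  - by apply: measurable_funM => //; exact: Rint_measurable Iw.
  - apply: measurable_maxr; [by apply: measurable_funM => //; exact: Rint_measurable Iw|exact: Rint_measurable In].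
  - apply: ae_in_cube => x xc; rewrite max_l // normrM ler_wpM2r //.
    exact: hC.
apply: le_Rintegral => // [|x _]; last by rewrite le_max lexx orbT.
apply: (Rint_ae_le (g := fun x => `|C| * `|w x|)).
- apply: measurable_maxr; [by apply: measurable_funM => //; exact: Rint_measurable Iw|exact: Rint_measurable In].
- exact: RintZ.
apply: ae_in_cube => x xc; rewrite max_l; last by rewrite normrM ler_wpM2r // hC.
by rewrite normrM normr_id.
Qed.

(** The integral over a time interval of the power of the force h along the line of
    functions (c0 + s c1, e0 + s e1), tested with w. *)
Definition work (h : 'rV[R]_2 -> R) (t0 t1 : R) (c0 c1 e0 e1 w : F) : R :=
  \int[@lebesgue_measure R]_(s in `]t0, t1[)
     ip a l (fun x => h (pt2 (c0 x + s * c1 x) (e0 x + s * e1 x))) w.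

Section Work.
Variables (h : 'rV[R]_2 -> R) (t0 t1 : R).
Hypothesis ch : continuous h.

Lemma family_line c0 c1 : V c0 -> V c1 ->
  @Vfamily R^o (fun s x => c0 x + s * c1 x).
Proof.
move=> h0 h1; apply: familyD; first exact: family_cst.
apply: (@familyM _ (fun s : R^o => s)); last exact: family_cst.
- by move=> s; exact: cvg_id.
- by move=> r; exists r.
Qed.

Lemma continuous_power c0 c1 e0 e1 w : V c0 -> V c1 -> V e0 -> V e1 -> L2 mu w ->
  continuous (fun s : R => ip a l (fun x => h (pt2 (c0 x + s * c1 x) (e0 x + s * e1 x))) w).
Proof.
move=> h0 h1 k0 k1 hw.
exact: (@continuous_ip_comp R^o h _ _ w ch (family_line h0 h1) (family_line k0 k1) hw).
Qed.

(** Dominated convergence in time: the integrand is continuous in time for each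
    parameter, continuous in the parameter for each time, and bounded for bounded
    parameters. *)
Lemma continuous_work (Z : normedModType R) (c0 c1 e0 e1 : Z -> F) w :
  Vfamily c0 -> Vfamily c1 -> Vfamily e0 -> Vfamily e1 -> L2 mu w ->
  continuous (fun z => work h t0 t1 (c0 z) (c1 z) (e0 z) (e1 z) w).
Proof.
move=> h0 h1 k0 k1 hw.
pose D : set R := `]t0, t1[%classic.
pose g z s := ip a l (fun x => h (pt2 (c0 z x + s * c1 z x) (e0 z x + s * e1 z x))) w.
have -> : (fun z => work h t0 t1 (c0 z) (c1 z) (e0 z) (e1 z) w) =
    (fun z => \int[@lebesgue_measure R]_s ((g z \_ D) s * \1_D s)).
  apply/funext => z; rewrite /work Rintegral_mkcond.
  apply: eq_Rintegral => s _; rewrite /= patchE indicE.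
  by case: ifP => //; rewrite ?mulr1 ?mul0r.
have Vc z (u : Z -> F) : Vfamily u -> V (u z) by case.
have Vl z (u v : Z -> F) (q : R) : Vfamily u -> Vfamily v -> V (fun x => u z x + q * v z x).
  by move=> hu hv; apply: VhD => //; [exact: Vc|apply: VhZ => //; exact: Vc].
apply: (@continuous_Rintegral_param R _ _ (@lebesgue_measure R) Z setT (fun z => g z \_ D)).
- by apply: aeW.
- move=> z; apply/(measurable_restrictT _ _).1; first exact: measurable_itv.
  apply: measurable_funTS; apply: continuous_measurable_fun.
  by apply: continuous_power => //; exact: Vc.
- exact: (integrable_indic_itv t0 t1 false true).
- move=> s _; have -> : (fun z => (g z \_ D) s) = if s \in D then g ^~ s else fun=> 0.
    by apply/funext => z; rewrite /patch; case: ifP.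
  case: ifP => _; last by move=> z; exact: cvg_cst.
  apply: continuous_ip_comp => //; apply: familyD => //; exact: familyZ.
move=> r.
have [[_ _ b0] [_ _ b1] [_ _ b2] [_ _ b3]] := And4 h0 h1 k0 k1.
have [B0 hB0] := b0 r; have [B1 hB1] := b1 r; have [B2 hB2] := b2 r; have [B3 hB3] := b3 r.
pose M := `|t0| + `|t1|.
have [C hC] := bounded_pt2 (Num.max (B0 + M * B1) (B2 + M * B3)) ch.
exists (`|C| * \int[mu]_x `|w x|) => z s zr _; rewrite patchE; case: ifPn => [|_]; last first.
  rewrite normr0 mulr_ge0 //; apply: Rintegral_ge0 => x _; exact: normr_ge0.
rewrite inE /D /= in_itv /= => /andP[s0 s1].
have sM : `|s| <= M.
  rewrite /M ler_norml; have := ler_norm t1; have := ler_norm (- t0); rewrite normrN.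
  have := normr_ge0 t0; have := normr_ge0 t1; move=> q1 q2 q3 q4.
  by apply/andP; split; lra.
have bl (u v : Z -> F) B B' x : `|u z x| <= B -> `|v z x| <= B' ->
    `|u z x + s * v z x| <= B + M * B'.
  move=> hu hv; apply: le_trans (ler_normD _ _) _; rewrite normrM lerD // ler_pM //.
apply: ip_comp_bounded => //.
- exact: Vl.
- exact: Vl.
move=> x xc; apply: le_trans _ (ler_norm C); apply: hC; rewrite le_max.
  by rewrite bl ?hB0 ?hB1.
by rewrite (bl e0 e1 B2 B3) ?hB2 ?hB3 ?orbT.
Qed.

Lemma Rintegral_oo_D (p q : R -> R) : continuous p -> continuous q ->
  \int[@lebesgue_measure R]_(s in `]t0, t1[) (p s + q s) =
  \int[@lebesgue_measure R]_(s in `]t0, t1[) p s + \int[@lebesgue_measure R]_(s in `]t0, t1[) q s.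
Proof.
have I (u : R -> R) : continuous u -> (@lebesgue_measure R).-integrable `]t0, t1[ (EFin \o u).
  move=> cu; apply: (integrableS _ _ _ (integrable_continuous_itv t0 t1 cu)); try exact: measurable_itv.
  by move=> x /=; rewrite !in_itv /= => /andP[/ltW -> /ltW ->].
by move=> cp cq; rewrite RintegralD //; [exact: I|exact: I].
Qed.

Lemma Rintegral_oo_Z c (p : R -> R) : continuous p ->
  \int[@lebesgue_measure R]_(s in `]t0, t1[) (c * p s) =
  c * \int[@lebesgue_measure R]_(s in `]t0, t1[) p s.
Proof.
move=> cp; rewrite RintegralZl //.
apply: (integrableS _ _ _ (integrable_continuous_itv t0 t1 cp)); try exact: measurable_itv.
by move=> x /=; rewrite !in_itv /= => /andP[/ltW -> /ltW ->].
Qed.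

Section WorkLinear.
Variables (c0 c1 e0 e1 : F).
Hypotheses (h0 : V c0) (h1 : V c1) (k0 : V e0) (k1 : V e1).
Local Notation work := (work h t0 t1 c0 c1 e0 e1).

Let Vl u v s : V u -> V v -> V (fun x => u x + s * v x).
Proof. by move=> hu hv; apply: VhD => //; exact: VhZ. Qed.

Lemma workD w w' : L2 mu w -> L2 mu w' -> work (fun x => w x + w' x) = work w + work w'.
Proof.
move=> hw hw'; rewrite -Rintegral_oo_D; try exact: continuous_power.
apply: eq_Rintegral => s _; rewrite /ip -Rintegral_add.
- by apply: eq_Rintegral => x _; rewrite mulrDr.
- exact: (Rint_Vh_comp l0 cover ch (Vl s h0 h1) (Vl s k0 k1) hw).
- exact: (Rint_Vh_comp l0 cover ch (Vl s h0 h1) (Vl s k0 k1) hw').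
Qed.

Lemma workZ c w : L2 mu w -> work (fun x => c * w x) = c * work w.
Proof.
move=> hw; rewrite -Rintegral_oo_Z; last exact: continuous_power.
apply: eq_Rintegral => s _; rewrite /ip -Rintegral_scale.
- by apply: eq_Rintegral => x _; rewrite mulrCA.
- exact: (Rint_Vh_comp l0 cover ch (Vl s h0 h1) (Vl s k0 k1) hw).
Qed.

Lemma work_ae w w' : L2 mu w -> L2 mu w' -> aeq a l w w' -> work w = work w'.
Proof.
move=> hw hw' ww; apply: eq_Rintegral => s _; apply: Rintegral_ae.
- exact: Rint_measurable (Rint_Vh_comp l0 cover ch (Vl s h0 h1) (Vl s k0 k1) hw).
- exact: Rint_measurable (Rint_Vh_comp l0 cover ch (Vl s h0 h1) (Vl s k0 k1) hw').
by move: ww; apply: (@filterS _ (almost_everywhere mu)) => x ->.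
Qed.

Lemma work_sum n (c : 'I_n -> R) (w : 'I_n -> F) : (forall i, L2 mu (w i)) ->
  work (fun x => \sum_i c i * w i x) = \sum_i c i * work (w i).
Proof.
elim: n c w => [|n IH] c w hw.
  rewrite big_ord0 -[RHS](mul0r (work (fun=> 0))) -workZ; last exact: L20.
  by congr work; apply/funext => x; rewrite big_ord0 mul0r.
have -> : (fun x => \sum_i c i * w i x) = (fun x => c ord0 * w ord0 x
    + \sum_i c (lift ord0 i) * w (lift ord0 i) x).
  by apply/funext => x; rewrite big_ord_recl.
rewrite workD ?workZ ?IH ?big_ord_recl //; first exact: L2Z.
by apply: L2_sum => i; exact: L2Z.
Qed.

End WorkLinear.
End Work.

(** The chain rule along the line, integrated in space and time. *)
Lemma work_potential (f : 'rV[R]_2 -> R) c0 c1 e0 e1 (u v : R) : smooth f ->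
  V c0 -> V c1 -> V e0 -> V e1 -> u < v ->
  work (f_rho f) u v c0 c1 e0 e1 c1 + work (f_eta f) u v c0 c1 e0 e1 e1 =
  (\int[mu]_x f (pt2 (c0 x + v * c1 x) (e0 x + v * e1 x)))
  - \int[mu]_x f (pt2 (c0 x + u * c1 x) (e0 x + u * e1 x)).
Proof.
move=> sf h0 h1 k0 k1 uv.
have cr : continuous (f_rho f) by exact: (smooth_pderiv 0 sf).1.
have ce : continuous (f_eta f) by exact: (smooth_pderiv 1 sf).1.
rewrite -(potential_increment_Vh l0 cover sf h0 h1 k0 k1 uv).
have p1 := continuous_power cr h0 h1 k0 k1 (Vh_L2 h1).
have p2 := continuous_power ce h0 h1 k0 k1 (Vh_L2 k1).
exact: esym (Rintegral_oo_D u v p1 p2).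
Qed.

End ContinuousDependence.

(** * Solvability of one time step *)

Section Step.
Variables (R : realType) (d : nat) (a : 'rV[R]_d) (l : R).
Hypothesis l0 : 0 < l.
Local Notation mu := (mu_cube a l).
Local Notation F := ('rV[R]_d -> R).
Local Notation grad := (grad a l).
Variables (K : finType) (vtx : K -> 'I_d.+1 -> 'rV[R]_d).
Hypothesis cover : \bigcup_(k in [set: K]) simplex (vtx k) = cube a l.
Local Notation V := (Vh a l vtx).
Variables (L : 'rV[R]_(1 + 1 + d + d) -> 'M[R]_(d + 1)) (lam1 lam2 lam3 : R).
Hypothesis hL : mobility_assumption L lam1 lam2 lam3.
Variables (f : 'rV[R]_2 -> R) (gamma_rho gamma_eta : R).
Hypotheses (sf : smooth f) (f0 : forall z, 0 <= f z).
Hypotheses (gamma_rho_gt0 : 0 < gamma_rho) (gamma_eta_gt0 : 0 < gamma_eta).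

Definition line (c0 c1 : F) (t : R) : F := fun x => c0 x + t * c1 x.

(** The discrete equations on one interval ]t0, t1[, divided by its length for the
    first two, for a solution that is affine in time there: rho = c0 + t c1,
    eta = e0 + t e1.  Projected quantities are those at the midpoint. *)
Record step_solution (t0 t1 : R) (c0 c1 e0 e1 mr me : F) : Prop := StepSolution {
  step_V : [/\ V c0, V c1, V e0 & V e1];
  step_mu_V : V mr /\ V me;
  step_rho : forall v, V v -> ip a l c1 v
    + Qform a l L (omega a l (line c0 c1 ((t0 + t1) / 2)) (line e0 e1 ((t0 + t1) / 2)))
        (fun x => force (grad v x) 0) (fun x => force (grad mr x) (me x)) = 0;
  step_eta : forall v, V v -> ip a l e1 v
    + Qform a l L (omega a l (line c0 c1 ((t0 + t1) / 2)) (line e0 e1 ((t0 + t1) / 2)))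
        (fun x => force 0 (v x)) (fun x => force (grad mr x) (me x)) = 0;
  step_mu_rho : forall v, V v -> (t1 - t0) * ip a l mr v
    - gamma_rho * ((t1 - t0) * kin a l (grad (line c0 c1 ((t0 + t1) / 2))) (grad v))
    - work a l (f_rho f) t0 t1 c0 c1 e0 e1 v = 0;
  step_mu_eta : forall v, V v -> (t1 - t0) * ip a l me v
    - gamma_eta * ((t1 - t0) * kin a l (grad (line e0 e1 ((t0 + t1) / 2))) (grad v))
    - work a l (f_eta f) t0 t1 c0 c1 e0 e1 v = 0
}.

Lemma V_line c0 c1 t : V c0 -> V c1 -> V (line c0 c1 t).
Proof. by move=> h0 h1; apply: VhD => //; exact: VhZ. Qed.

Lemma grad_L2 v : V v -> L2row a l (grad v).
Proof. by move=> hv; apply: L2row_grad => //; exact: Vh_H1 hv. Qed.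

Lemma grad_line c0 c1 t : V c0 -> V c1 ->
  {ae mu, forall x, grad (line c0 c1 t) x = grad c0 x + t *: grad c1 x}.
Proof.
move=> h0 h1; apply: ae_row => k.
have e1 := weak_pderivD l0 k (Vh_H1 h0) (Vh_H1 (VhZ l0 t h1)).
have e2 := weak_pderivZ l0 k t (Vh_H1 h1).
by move: e1 e2; apply: (@filterS2 _ (almost_everywhere mu)) => x E1 E2; rewrite !mxE E1 E2.
Qed.

Lemma coord_norm_le n (z : 'rV[R]_n) j : `|z 0 j| <= `|z|.
Proof. by rewrite [leRHS]mx_normrE; apply: (le_bigmax _ (fun ij => `|z ij.1 ij.2|) (0, j)). Qed.

Section Discretisation.
Variables (m : nat) (b : 'I_m -> F).
Hypotheses (ob : orthonormal_Vh a l vtx b)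
  (span : forall v, V v -> aeq a l v (fun x => \sum_i ip a l v (b i) * b i x)).
Local Notation Z := 'rV[R]_(m + m).

Definition comb (c : 'I_m -> R) : F := fun x => \sum_i c i * b i x.
Definition comb_grad (c : 'I_m -> R) (x : 'rV[R]_d) : 'rV[R]_d := \sum_i c i *: grad (b i) x.

Let Vb i : V (b i). Proof. by case: ob. Qed.
Let L2b i : L2 mu (b i). Proof. exact: Vh_L2 (Vb i). Qed.
Let L2gb i : L2row a l (grad (b i)). Proof. exact: grad_L2. Qed.

Lemma V_comb c : V (comb c). Proof. exact: Vh_sum. Qed.
Lemma L2_comb c : L2 mu (comb c). Proof. exact: Vh_L2 (V_comb c). Qed.
Lemma L2_comb_grad c : L2row a l (comb_grad c). Proof. exact: L2row_sum. Qed.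

Lemma grad_comb c : {ae mu, forall x, grad (comb c) x = comb_grad c x}.
Proof.
apply: ae_row => k; have := weak_pderiv_sum l0 k c (fun i => Vh_H1 (Vb i)).
apply: (@filterS _ (almost_everywhere mu)) => x E; rewrite mxE E summxE.
by apply: eq_bigr => i _; rewrite !mxE.
Qed.

Lemma ip_comb c i : ip a l (comb c) (b i) = c i.
Proof. exact: (ip_lincomb c i ob). Qed.

Definition rho_coef (z : Z) i : R := z 0 (lshift m i).
Definition eta_coef (z : Z) i : R := z 0 (rshift m i).

Variables (t0 t1 : R) (r_ e_ : F).
Hypotheses (t01 : t0 < t1) (Vr : V r_) (Ve : V e_).
Local Notation h := ((t1 - t0) / 2).

(** The constant coefficient of the line in time with slope [comb c] that takes the
    value u at t0. *)
Definition foot (u : F) c : F := fun x => u x + - t0 * comb c x.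
(** A representative of the gradient at the midpoint that is linear in the
    coordinates c at each point, which the chosen weak derivatives are only almost everywhere. *)
Definition grad_mid (u : F) c x := grad u x + h *: comb_grad c x.

Lemma V_foot u c : V u -> V (foot u c).
Proof. by move=> hu; apply: VhD => //; apply: VhZ => //; exact: V_comb. Qed.

Lemma foot_line u c t : line (foot u c) (comb c) t = line u (comb c) (t - t0).
Proof. by apply/funext => x; rewrite /line /foot; ring. Qed.

Lemma foot_mid u c : line (foot u c) (comb c) ((t0 + t1) / 2) = line u (comb c) h.
Proof. by rewrite foot_line; congr line; field. Qed.

Lemma L2_grad_mid u c : V u -> L2row a l (grad_mid u c).
Proof. by move=> hu; apply: L2rowD; [exact: grad_L2|apply: L2rowZ; exact: L2_comb_grad]. Qed.

Lemma grad_line_comb u c t : V u ->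
  {ae mu, forall x, grad (line u (comb c) t) x = grad u x + t *: comb_grad c x}.
Proof.
move=> hu; have := grad_line t hu (V_comb c); have := grad_comb c.
by apply: (@filterS2 _ (almost_everywhere mu)) => x E -> ; rewrite E.
Qed.

Definition state_mid (z : Z) x :=
  state (line r_ (comb (rho_coef z)) h x) (line e_ (comb (eta_coef z)) h x)
    (grad_mid r_ (rho_coef z) x) (grad_mid e_ (eta_coef z) x).

Lemma L2_state_mid z : L2row a l (state_mid z).
Proof.
apply: (@state_coord R d 'rV[R]_d (L2 mu)).
- exact: Vh_L2 (V_line h Vr (V_comb _)).
- exact: Vh_L2 (V_line h Ve (V_comb _)).
- exact: L2_grad_mid.
- exact: L2_grad_mid.
Qed.

Lemma continuous_coord_comb (j : 'I_m -> 'I_(m + m)) (c : 'I_m -> R) :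
  continuous (fun z : Z => \sum_i z 0 (j i) * c i).
Proof.
have cx k : continuous (fun z : Z => z 0 k) by exact: coord_continuous.
by apply: continuous_sumr => i z; exact: (cvgM (cx (j i) z) (cvg_cst _)).
Qed.

Lemma continuous_state_mid x : continuous (state_mid ^~ x).
Proof.
have ca (A B : R) (g : Z -> R) : continuous g -> continuous (fun z => A + B * g z).
  by move=> cg z; exact: (cvgD (cvg_cst A) (cvgM (cvg_cst B) (cg z))).
have cg (u : F) (j : 'I_m -> 'I_(m + m)) k :
    continuous (fun z : Z => (grad_mid u (fun i => z 0 (j i)) x) 0 k).
  have -> : (fun z : Z => (grad_mid u (fun i => z 0 (j i)) x) 0 k) =
     (fun z : Z => grad u x 0 k + h * \sum_i z 0 (j i) * grad (b i) x 0 k).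
    apply/funext => z; rewrite 2!mxE [X in _ + X]mxE summxE; congr (_ + _ * _).
    by apply: eq_bigr => i _; rewrite mxE.
  by apply: ca; exact: continuous_coord_comb.
apply: continuous_rV; apply: (@state_coord R d Z (fun g => continuous g)).
- by apply: ca; exact: continuous_coord_comb.
- by apply: ca; exact: continuous_coord_comb.
- exact: cg.
- exact: cg.
Qed.

Definition mu_rho_coef (z : Z) i : R :=
  gamma_rho * kin a l (grad_mid r_ (rho_coef z)) (grad (b i))
  + (t1 - t0)^-1 * work a l (f_rho f) t0 t1 (foot r_ (rho_coef z)) (comb (rho_coef z))
      (foot e_ (eta_coef z)) (comb (eta_coef z)) (b i).

Definition mu_eta_coef (z : Z) i : R :=
  gamma_eta * kin a l (grad_mid e_ (eta_coef z)) (grad (b i))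
  + (t1 - t0)^-1 * work a l (f_eta f) t0 t1 (foot r_ (rho_coef z)) (comb (rho_coef z))
      (foot e_ (eta_coef z)) (comb (eta_coef z)) (b i).

Definition basis_force (k : 'I_(m + m)) (x : 'rV[R]_d) : 'cV[R]_(d + 1) :=
  match fintype.split k with
  | inl i => force (grad (b i) x) 0
  | inr i => force 0 (b i x)
  end.

(** The function G: the chemical potentials determined by the time derivatives z. *)
Definition potentials (z : Z) : Z :=
  row_mx (\row_i mu_rho_coef z i) (\row_i mu_eta_coef z i).

(** The function T: the time derivatives produced by the potentials, with the
    mobility at the midpoint state.  The step is solved when they agree with z. *)
Definition rates (z : Z) : Z :=
  \row_k (- \sum_k' potentials z 0 k' * Qform a l L (state_mid z) (basis_force k) (basis_force k')).

Lemma L2_basis_force k : L2col a l (basis_force k).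
Proof.
rewrite /basis_force; case: fintype.split => i; apply: L2col_force.
- exact: L2gb.
- exact: L20.
- exact: L2row0.
- exact: L2b.
Qed.

Definition force_of (c c' : 'I_m -> R) x := force (comb_grad c x) (comb c' x).

Lemma force_suml n (c : 'I_n -> R) (g : 'I_n -> 'rV[R]_d) :
  force (\sum_i c i *: g i) 0 = \sum_i c i *: force (g i) 0.
Proof.
apply/colP => j; rewrite summxE forceE; under [RHS]eq_bigr do rewrite mxE forceE.
case: fintype.split => k; last by rewrite big1 // => i _; rewrite mulr0.
by rewrite summxE; apply: eq_bigr => i _; rewrite mxE.
Qed.

Lemma force_sumr n (c s : 'I_n -> R) :
  force (0 : 'rV[R]_d) (\sum_i c i * s i) = \sum_i c i *: force (0 : 'rV[R]_d) (s i).
Proof.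
apply/colP => j; rewrite summxE forceE; under [RHS]eq_bigr do rewrite mxE forceE.
case: fintype.split => k //.
by rewrite [LHS]mxE big1 // => i _; rewrite [X in _ * X]mxE mulr0.
Qed.

Lemma basis_force_l i x : basis_force (lshift m i) x = force (grad (b i) x) 0.
Proof. by rewrite /basis_force; have := unsplitK (inl i : 'I_m + 'I_m); rewrite /= => ->. Qed.

Lemma basis_force_r i x : basis_force (rshift m i) x = force 0 (b i x).
Proof. by rewrite /basis_force; have := unsplitK (inr i : 'I_m + 'I_m); rewrite /= => ->. Qed.

Lemma basis_force_sum (z : Z) x :
  \sum_k z 0 k *: basis_force k x = force_of (rho_coef z) (eta_coef z) x.
Proof.
rewrite big_split_ord /= /force_of force_add force_suml force_sumr.
by congr (_ + _); apply: eq_bigr => i _; rewrite ?basis_force_l ?basis_force_r.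
Qed.

Lemma L2_force_of c c' : L2col a l (force_of c c').
Proof. by apply: L2col_force; [exact: L2_comb_grad|exact: L2_comb]. Qed.

Lemma ratesE z k : rates z 0 k = - Qform a l L (state_mid z) (basis_force k)
  (force_of (mu_rho_coef z) (mu_eta_coef z)).
Proof.
rewrite mxE -(Qform_sumr hL (potentials z 0)); first last.
- exact: L2_basis_force.
- exact: L2_basis_force.
- exact: L2_state_mid.
congr (- Qform _ _ _ _ _ _); apply/funext => x; rewrite basis_force_sum /force_of.
congr (force _ _); [rewrite /comb_grad|rewrite /comb]; apply: eq_bigr => i _.
  by rewrite /rho_coef row_mxEl mxE.
by rewrite /eta_coef row_mxEr mxE.
Qed.

Lemma rates_dissipative : exists2 C : R, 0 <= C &
  forall z, dotv (rates z) (rates z) <= - C * dotv (potentials z) (rates z).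
Proof.
have [C C0 hC] := dissipation_controls hL L2_basis_force.
exists C => // z.
set Q := force_of (mu_rho_coef z) (mu_eta_coef z).
have := hC (state_mid z) Q (L2_state_mid z) (L2_force_of _ _).
have -> : \sum_k Qform a l L (state_mid z) (basis_force k) Q ^+ 2 = dotv (rates z) (rates z).
  by apply: eq_bigr => k _; rewrite ratesE mulrNN expr2.
move=> h1; apply: (le_trans h1); rewrite mulNr -mulrN; apply: ler_wpM2l => //.
have QE : Q = fun x => \sum_k potentials z 0 k *: basis_force k x.
  apply/funext => x; rewrite basis_force_sum /Q /force_of.
  congr (force _ _); [rewrite /comb_grad|rewrite /comb]; apply: eq_bigr => i _.
    by rewrite /rho_coef row_mxEl mxE.
  by rewrite /eta_coef row_mxEr mxE.
rewrite {1}QE (Qform_suml hL); [|exact: L2_state_mid|exact: L2_basis_force|exact: L2_force_of].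
rewrite le_eqVlt; apply/orP; left; apply/eqP; rewrite -sumrN; apply: eq_bigr => k _.
by rewrite ratesE mulrN opprK.
Qed.

Lemma family_comb (j : 'I_m -> 'I_(m + m)) : Vfamily a l vtx (fun z : Z => comb (fun i => z 0 (j i))).
Proof.
apply: (family_sum l0 cover (phi := fun i (z : Z) => z 0 (j i))) => // i.
  exact: coord_continuous.
by move=> r; exists r => z; apply: le_trans; exact: coord_norm_le.
Qed.

Lemma family_foot u (j : 'I_m -> 'I_(m + m)) : V u ->
  Vfamily a l vtx (fun z : Z => foot u (fun i => z 0 (j i))).
Proof.
move=> hu; apply: familyD => //; first exact: (family_cst cover).
by apply: familyZ => //; exact: family_comb.
Qed.

Lemma continuous_rates k : continuous (fun z => rates z 0 k).
Proof.
have cr : continuous (f_rho f) by exact: (smooth_pderiv 0 sf).1.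
have ce : continuous (f_eta f) by exact: (smooth_pderiv 1 sf).1.
have cw (g : 'rV[R]_2 -> R) i : continuous g -> continuous (fun z => work a l g t0 t1
    (foot r_ (rho_coef z)) (comb (rho_coef z)) (foot e_ (eta_coef z)) (comb (eta_coef z)) (b i)).
  move=> cg; exact: (@continuous_work R d a l l0 K vtx cover g t0 t1 cg Z _ _ _ _ (b i)
    (family_foot _ Vr) (family_comb _) (family_foot _ Ve) (family_comb _) (L2b i)).
have ck (u : F) (j : 'I_m -> 'I_(m + m)) i : V u ->
    continuous (fun z : Z => kin a l (grad_mid u (fun i => z 0 (j i))) (grad (b i))).
  move=> hu; have -> : (fun z : Z => kin a l (grad_mid u (fun i => z 0 (j i))) (grad (b i))) =
    (fun z : Z => kin a l (grad u) (grad (b i)) + h * \sum_k z 0 (j k) * kin a l (grad (b k)) (grad (b i))).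
    apply/funext => z; rewrite /grad_mid kinDl ?kinZl ?kin_suml //.
    - exact: L2_comb_grad.
    - exact: grad_L2.
    - by apply: L2rowZ; exact: L2_comb_grad.
  have cc : continuous (fun z : Z => \sum_k z 0 (j k) * kin a l (grad (b k)) (grad (b i))).
    exact: continuous_coord_comb.
  by move=> z; exact: (cvgD (cvg_cst _) (cvgM (cvg_cst h) (cc z))).
have cp k' : continuous (fun z => potentials z 0 k').
  rewrite /potentials; case: (fintype.splitP k') => [i ei|i ei].
    have -> : k' = lshift m i by apply: val_inj.
    under eq_fun do rewrite row_mxEl mxE.
    move=> z; exact: (cvgD (cvgM (cvg_cst _) (ck _ _ _ Vr z)) (cvgM (cvg_cst _) (cw _ i cr z))).
  have -> : k' = rshift m i by apply: val_inj.
  under eq_fun do rewrite row_mxEr mxE.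
  move=> z; exact: (cvgD (cvgM (cvg_cst _) (ck _ _ _ Ve z)) (cvgM (cvg_cst _) (cw _ i ce z))).
have cQ k' : continuous (fun z => Qform a l L (state_mid z) (basis_force k) (basis_force k')).
  apply: (continuous_Qform hL); [exact: L2_state_mid|exact: continuous_state_mid|
    exact: L2_basis_force|exact: L2_basis_force].
under eq_fun do rewrite mxE.
have cS : continuous (fun z => \sum_k' potentials z 0 k' * Qform a l L (state_mid z) (basis_force k) (basis_force k')).
  by apply: continuous_sumr => k' z; exact: (cvgM (cp k' z) (cQ k' z)).
by move=> z; exact: (cvgN (cS z)).
Qed.

Definition start_energy : R :=
  gamma_rho / 2 * kin a l (grad r_) (grad r_) + gamma_eta / 2 * kin a l (grad e_) (grad e_)
  + \int[mu]_x f (pt2 (r_ x) (e_ x)).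

Lemma start_energy_ge0 : 0 <= start_energy.
Proof.
rewrite /start_energy !addr_ge0 //.
- by rewrite mulr_ge0 ?kin_ge0 // divr_ge0 // ltW.
- by rewrite mulr_ge0 ?kin_ge0 // divr_ge0 // ltW.
- by apply: Rintegral_ge0 => x _.
Qed.

(** Multiplied by the length of the step, the right-hand side is the increment of
    the energy along the step. *)
Lemma potentials_coercive z : - (start_energy / (t1 - t0)) <= dotv (potentials z) z.
Proof.
have tau0 : 0 < t1 - t0 by rewrite subr_gt0.
pose c := rho_coef z; pose e := eta_coef z.
have cr : continuous (f_rho f) by exact: (smooth_pderiv 0 sf).1.
have ce : continuous (f_eta f) by exact: (smooth_pderiv 1 sf).1.
pose W g w := work a l g t0 t1 (foot r_ c) (comb c) (foot e_ e) (comb e) w.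
have E : dotv (potentials z) z =
   gamma_rho * kin a l (grad_mid r_ c) (comb_grad c) + gamma_eta * kin a l (grad_mid e_ e) (comb_grad e)
   + (t1 - t0)^-1 * (W (f_rho f) (comb c) + W (f_eta f) (comb e)).
  rewrite /dotv big_split_ord /=.
  transitivity (\sum_i mu_rho_coef z i * c i + \sum_i mu_eta_coef z i * e i).
    by congr (_ + _); apply: eq_bigr => i _; rewrite ?row_mxEl ?row_mxEr mxE.
  have lin (X Y u : 'I_m -> R) g s :
      \sum_i (g * X i + s * Y i) * u i = g * (\sum_i u i * X i) + s * (\sum_i u i * Y i).
    by rewrite !mulr_sumr -big_split; apply: eq_bigr => i _ /=; ring.
  have ek (u : F) (q : 'I_m -> R) : V u ->
      kin a l (grad_mid u q) (comb_grad q) = \sum_i q i * kin a l (grad_mid u q) (grad (b i)).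
    move=> hu; rewrite kinC kin_suml //; last exact: L2_grad_mid.
    by apply: eq_bigr => i _; rewrite kinC.
  rewrite (lin _ _ c) (lin _ _ e) -(ek _ _ Vr) -(ek _ _ Ve).
  rewrite /W (work_sum l0 cover t0 t1 cr (V_foot _ Vr) (V_comb _) (V_foot _ Ve) (V_comb _) _ L2b).
  rewrite (work_sum l0 cover t0 t1 ce (V_foot _ Vr) (V_comb _) (V_foot _ Ve) (V_comb _) _ L2b).
  by rewrite [X in _ = _ + X]mulrDr; exact: addrACA.
have kE (u : F) (q : 'I_m -> R) : V u -> - kin a l (grad u) (grad u) <=
    2 * (t1 - t0) * kin a l (grad_mid u q) (comb_grad q).
  move=> hu; rewrite -(kin_increment _ (grad_L2 hu) (L2_comb_grad q)).
  by rewrite [leRHS]addrC lerDl; exact: kin_ge0.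
have P : - (\int[mu]_x f (pt2 (r_ x) (e_ x))) <= W (f_rho f) (comb c) + W (f_eta f) (comb e).
  rewrite /W (work_potential l0 cover sf (V_foot _ Vr) (V_comb _) (V_foot _ Ve) (V_comb _) t01).
  rewrite [X in _ <= _ - X](_ : _ = \int[mu]_x f (pt2 (r_ x) (e_ x))).
    by rewrite [leRHS]addrC lerDl; apply: Rintegral_ge0 => x _.
  by apply: eq_Rintegral => x _; congr (f (pt2 _ _)); rewrite /foot; ring.
have k1 := kE _ c Vr; have k2 := kE _ e Ve.
rewrite E -mulNr ler_pdivrMr // mulrDl [X in _ <= _ + X]mulrAC mulVf ?gt_eqF // mul1r.
move: k1 k2 P; rewrite /start_energy.
move: (kin a l (grad_mid r_ c) (comb_grad c)) (kin a l (grad_mid e_ e) (comb_grad e)) => x y.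
move: (kin a l (grad r_) (grad r_)) (kin a l (grad e_) (grad e_)) => x0 y0.
move: (W _ _ + _) (\int[mu]_x _) => p q k1 k2 kp.
have h1 : gamma_rho / 2 * - x0 <= gamma_rho / 2 * (2 * (t1 - t0) * x).
  by rewrite ler_wpM2l // divr_ge0 // ltW.
have h2 : gamma_eta / 2 * - y0 <= gamma_eta / 2 * (2 * (t1 - t0) * y).
  by rewrite ler_wpM2l // divr_ge0 // ltW.
have -> : (gamma_rho * x + gamma_eta * y) * (t1 - t0) =
  gamma_rho / 2 * (2 * (t1 - t0) * x) + gamma_eta / 2 * (2 * (t1 - t0) * y) by field.
by rewrite !opprD -!mulrN; exact: lerD (lerD h1 h2) kp.
Qed.

Lemma rates_fixpoint : exists z, z = rates z.
Proof.
have [C C0 hC] := rates_dissipative.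
apply: (dissipative_fixpoint (E0 := start_energy / (t1 - t0)) continuous_rates C0 _ hC).
  by rewrite divr_ge0 ?start_energy_ge0 // subr_ge0 ltW.
exact: potentials_coercive.
Qed.

(** The equations hold for all test functions as soon as they hold for the basis,
    since every test function is almost everywhere a combination of the basis. *)
Lemma basis_test (Phi : F -> R) :
  (forall v v', V v -> V v' -> aeq a l v v' -> Phi v = Phi v') ->
  (forall c, Phi (comb c) = \sum_i c i * Phi (b i)) ->
  (forall i, Phi (b i) = 0) -> forall v, V v -> Phi v = 0.
Proof.
move=> ae lin z v hv; rewrite (ae _ _ hv (V_comb _) (span hv)) lin big1 // => i _.
by rewrite z mulr0.
Qed.

Lemma grad_aeq v v' : V v -> V v' -> aeq a l v v' -> grad v = grad v'.
Proof.
move=> hv hv' e; apply/funext => x; apply/rowP => k; rewrite !mxE.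
by rewrite (weak_pderiv_aeq l0 k (Vh_L2 hv) (Vh_L2 hv') e).
Qed.

Lemma force_grad_comb c :
  {ae mu, forall x, force (grad (comb c) x) 0 = \sum_i c i *: force (grad (b i) x) 0}.
Proof.
have := grad_comb c; apply: (@filterS _ (almost_everywhere mu)) => x ->.
exact: force_suml.
Qed.

Lemma L2_force_grad v : V v -> L2col a l (fun x => force (grad v x) 0).
Proof. by move=> hv; apply: L2col_force; [exact: grad_L2|exact: L20]. Qed.

Lemma L2_force_val v : V v -> L2col a l (fun x => force (0 : 'rV[R]_d) (v x)).
Proof. by move=> hv; apply: L2col_force; [exact: L2row0|exact: Vh_L2 hv]. Qed.

Lemma mu_equation (u : F) q (g : 'rV[R]_2 -> R) gam (Mc : 'I_m -> R) c0 c1 e0 e1 :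
  continuous g -> V u -> V c0 -> V c1 -> V e0 -> V e1 ->
  (forall i, Mc i = gam * kin a l (grad_mid u q) (grad (b i))
     + (t1 - t0)^-1 * work a l g t0 t1 c0 c1 e0 e1 (b i)) ->
  forall v, V v -> (t1 - t0) * ip a l (comb Mc) v
    - gam * ((t1 - t0) * kin a l (grad (line (foot u q) (comb q) ((t0 + t1) / 2))) (grad v))
    - work a l g t0 t1 c0 c1 e0 e1 v = 0.
Proof.
move=> cg hu h0 h1 k0 k1 Mcq.
have tau0 : t1 - t0 != 0 by rewrite gt_eqF // subr_gt0.
have Vl := V_line h hu (V_comb q).
have kE v : V v -> kin a l (grad (line (foot u q) (comb q) ((t0 + t1) / 2))) (grad v) =
    kin a l (grad_mid u q) (grad v).
  move=> hv; rewrite foot_mid; apply: kin_ae; try exact: grad_L2; first exact: L2_grad_mid.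
    exact: grad_line_comb.
  by apply: aeW.
move=> v hv; rewrite kE //; move: v hv.
apply: basis_test => [v v' hv hv' vv'|c|i].
- rewrite (grad_aeq hv hv' vv') (work_ae l0 cover t0 t1 cg h0 h1 k0 k1 (Vh_L2 hv) (Vh_L2 hv') vv').
  by rewrite (ip_ae (L2_comb Mc) (L2_comb Mc) (Vh_L2 hv) (Vh_L2 hv') (aeq_refl _ _ _) vv').
- rewrite ipC ip_suml //; last exact: L2_comb.
  rewrite (work_sum l0 cover t0 t1 cg h0 h1 k0 k1 _ L2b).
  have -> : kin a l (grad_mid u q) (grad (comb c)) = \sum_i c i * kin a l (grad (b i)) (grad_mid u q).
    rewrite -kin_suml //; last exact: L2_grad_mid.
    rewrite kinC; apply: kin_ae; try exact: L2_grad_mid; last by apply: aeW.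
    + by apply: grad_L2; exact: V_comb.
    + exact: L2_comb_grad.
    + exact: grad_comb.
  rewrite !mulr_sumr -!sumrB; apply: eq_bigr => i _.
  rewrite [ip a l (b i) _]ipC [kin a l (grad (b i)) _]kinC; ring.
rewrite ip_comb Mcq; field.
by [].
Qed.

Lemma step_exists_in_basis : exists c1 e1 mr me : F,
  step_solution t0 t1 (fun x => r_ x + - t0 * c1 x) c1 (fun x => e_ x + - t0 * e1 x) e1 mr me.
Proof.
have cr : continuous (f_rho f) by exact: (smooth_pderiv 0 sf).1.
have ce : continuous (f_eta f) by exact: (smooth_pderiv 1 sf).1.
have [z hz] := rates_fixpoint.
pose c := rho_coef z; pose e := eta_coef z.
pose M := mu_rho_coef z; pose M' := mu_eta_coef z.
exists (comb c), (comb e), (comb M), (comb M').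
pose Om := omega a l (line (foot r_ c) (comb c) ((t0 + t1) / 2)) (line (foot e_ e) (comb e) ((t0 + t1) / 2)).
have OmE : {ae mu, forall x, Om x = state_mid z x}.
  have := grad_line_comb c h Vr; have := grad_line_comb e h Ve.
  apply: (@filterS2 _ (almost_everywhere mu)) => x E1 E2.
  by rewrite /Om !foot_mid omegaE E1 E2.
have LOm : L2row a l Om.
  rewrite /Om; apply: (@state_coord R d 'rV[R]_d (L2 mu)).
  - exact: Vh_L2 (V_line _ (V_foot _ Vr) (V_comb _)).
  - exact: Vh_L2 (V_line _ (V_foot _ Ve) (V_comb _)).
  - exact: grad_L2 (V_line _ (V_foot _ Vr) (V_comb _)).
  - exact: grad_L2 (V_line _ (V_foot _ Ve) (V_comb _)).
pose Q := force_of M M'.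
have LQ : L2col a l Q by exact: L2_force_of.
have LQ' : L2col a l (fun x => force (grad (comb M) x) (comb M' x)).
  by apply: L2col_force; [exact: grad_L2 (V_comb _)|exact: L2_comb].
have QE P : L2col a l P -> Qform a l L Om P (fun x => force (grad (comb M) x) (comb M' x)) =
    Qform a l L (state_mid z) P Q.
  move=> hP; apply: (Qform_ae hL) => //; first exact: L2_state_mid.
    by apply: aeW.
  have := grad_comb M; apply: (@filterS _ (almost_everywhere mu)) => x E.
  by rewrite /Q /force_of E.
split.
- by split; [exact: V_foot|exact: V_comb|exact: V_foot|exact: V_comb].
- by split; exact: V_comb.
- move=> v hv; rewrite QE; last exact: L2_force_grad.
  move: v hv; apply: basis_test => [v v' hv hv' vv'|q|i].
  + rewrite (grad_aeq hv hv' vv').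
    by rewrite (ip_ae (L2_comb c) (L2_comb c) (Vh_L2 hv) (Vh_L2 hv') (aeq_refl _ _ _) vv').
  + rewrite ipC ip_suml //; last exact: L2_comb.
    rewrite (Qform_ae hL (L2_state_mid z) (L2_state_mid z) (L2_force_grad (V_comb q))
      (L2col_sum q (fun i => L2_force_grad (Vb i))) LQ LQ _ (force_grad_comb q)); try by apply: aeW.
    rewrite (Qform_suml hL q (L2_state_mid z) (fun i => L2_force_grad (Vb i)) LQ).
    rewrite -big_split; apply: eq_bigr => i _ /=.
    by rewrite [ip a l (b i) _]ipC mulrDr.
  rewrite ip_comb; have -> : c i = rates z 0 (lshift m i) by rewrite -hz.
  rewrite ratesE -/Q.
  have -> : basis_force (lshift m i) = fun x => force (grad (b i) x) 0.
    by apply/funext => x; exact: basis_force_l.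
  exact: addNr.
- move=> v hv; rewrite QE; last exact: L2_force_val.
  move: v hv; apply: basis_test => [v v' hv hv' vv'|q|i].
  + rewrite (ip_ae (L2_comb e) (L2_comb e) (Vh_L2 hv) (Vh_L2 hv') (aeq_refl _ _ _) vv').
    congr (_ + _); apply: (Qform_ae hL (L2_state_mid z) (L2_state_mid z) (L2_force_val hv) (L2_force_val hv') LQ LQ);
      try by apply: aeW.
    by move: vv'; apply: (@filterS _ (almost_everywhere mu)) => x ->.
  + rewrite ipC ip_suml //; last exact: L2_comb.
    have -> : (fun x => force (0 : 'rV[R]_d) (comb q x)) = fun x => \sum_i q i *: force (0 : 'rV[R]_d) (b i x).
      by apply/funext => x; exact: force_sumr.
    rewrite (Qform_suml hL q (L2_state_mid z) (fun i => L2_force_val (Vb i)) LQ).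
    rewrite -big_split; apply: eq_bigr => i _ /=.
    by rewrite [ip a l (b i) _]ipC mulrDr.
  rewrite ip_comb; have -> : e i = rates z 0 (rshift m i) by rewrite -hz.
  rewrite ratesE -/Q.
  have -> : basis_force (rshift m i) = fun x => force 0 (b i x).
    by apply/funext => x; exact: basis_force_r.
  exact: addNr.
- apply: mu_equation => //; [exact: V_foot|exact: V_comb|exact: V_foot|exact: V_comb].
- apply: mu_equation => //; [exact: V_foot|exact: V_comb|exact: V_foot|exact: V_comb].
Qed.

End Discretisation.

Lemma step_exists (t0 t1 : R) (r_ e_ : F) : t0 < t1 -> V r_ -> V e_ ->
  exists c1 e1 mr me : F,
  step_solution t0 t1 (fun x => r_ x + - t0 * c1 x) c1 (fun x => e_ x + - t0 * e1 x) e1 mr me.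
Proof.
have [m [b [ob span]]] := orthonormal_basis l0 cover.
exact: step_exists_in_basis ob span t0 t1 r_ e_.
Qed.

End Step.

(** * Mass and energy over one time step *)

Section StepConsequences.
Variables (R : realType) (d : nat) (a : 'rV[R]_d) (l : R).
Hypothesis l0 : 0 < l.
Local Notation mu := (mu_cube a l).
Local Notation F := ('rV[R]_d -> R).
Local Notation grad := (grad a l).
Variables (K : finType) (vtx : K -> 'I_d.+1 -> 'rV[R]_d).
Hypothesis cover : \bigcup_(k in [set: K]) simplex (vtx k) = cube a l.
Local Notation V := (Vh a l vtx).
Variables (L : 'rV[R]_(1 + 1 + d + d) -> 'M[R]_(d + 1)) (lam1 lam2 lam3 : R).
Hypothesis hL : mobility_assumption L lam1 lam2 lam3.
Variables (f : 'rV[R]_2 -> R) (gamma_rho gamma_eta : R).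
Hypothesis sf : smooth f.
Local Notation energy := (energy a l gamma_rho gamma_eta f).

Lemma L2row_omega r e : V r -> V e -> L2row a l (omega a l r e).
Proof.
move=> hr he; apply: (@state_coord R d 'rV[R]_d (L2 mu)).
- exact: Vh_L2 hr.
- exact: Vh_L2 he.
- exact: (grad_L2 hr).
- exact: (grad_L2 he).
Qed.

Lemma Rint_potential r e : V r -> V e -> Rintegrable mu (fun x => f (pt2 (r x) (e x))).
Proof.
move=> hr he; have V1 : V (fun=> 1) by exact: Vh_cst.
have := Rint_Vh_comp l0 cover (smooth_continuous sf) hr he (Vh_L2 V1).
by under [X in Rintegrable _ X -> _]eq_fun do rewrite mulr1.
Qed.

Lemma energyE r e : V r -> V e -> energy r e =
  gamma_rho / 2 * kin a l (grad r) (grad r) + gamma_eta / 2 * kin a l (grad e) (grad e)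
  + \int[mu]_x f (pt2 (r x) (e x)).
Proof.
move=> hr he.
have I1 := Rint_dotv (grad_L2 hr) (grad_L2 hr).
have I2 := Rint_dotv (grad_L2 he) (grad_L2 he).
rewrite /energy Rintegral_add; [|by apply: RintD; exact: RintZ|exact: Rint_potential].
by rewrite Rintegral_add ?Rintegral_scale //; exact: RintZ.
Qed.

Lemma energy_aeq r r' e e' : V r -> V r' -> V e -> V e' -> aeq a l r r' -> aeq a l e e' ->
  energy r e = energy r' e'.
Proof.
move=> hr hr' he he' rr ee; rewrite !energyE //.
rewrite (grad_aeq l0 hr hr' rr) (grad_aeq l0 he he' ee); congr (_ + _).
apply: Rintegral_ae.
- exact: Rint_measurable (Rint_potential hr he).
- exact: Rint_measurable (Rint_potential hr' he').
by move: rr ee; apply: (@filterS2 _ (almost_everywhere mu)) => x -> ->.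
Qed.

Lemma kin_line_increment c0 c1 t0 t1 : V c0 -> V c1 ->
  kin a l (grad (line c0 c1 t1)) (grad (line c0 c1 t1))
  - kin a l (grad (line c0 c1 t0)) (grad (line c0 c1 t0)) =
  2 * ((t1 - t0) * kin a l (grad (line c0 c1 ((t0 + t1) / 2))) (grad c1)).
Proof.
move=> h0 h1; have g0 := grad_L2 h0; have g1 := grad_L2 h1.
pose G t x := grad c0 x + t *: grad c1 x.
have LG t : L2row a l (G t) by apply: L2rowD => //; exact: L2rowZ.
have Lg t := grad_L2 (V_line l0 t h0 h1).
have E t := grad_line l0 t h0 h1.
have kG t : kin a l (grad (line c0 c1 t)) (grad (line c0 c1 t)) = kin a l (G t) (G t).
  exact: kin_ae (Lg t) (LG t) (Lg t) (LG t) (E t) (E t).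
have -> : kin a l (grad (line c0 c1 ((t0 + t1) / 2))) (grad c1) = kin a l (G ((t0 + t1) / 2)) (grad c1).
  by apply: (kin_ae (Lg _) (LG _) g1 g1 (E _)); apply: aeW.
rewrite !kG mulrA.
have -> : G t1 = fun x => G t0 x + (t1 - t0) *: grad c1 x.
  by apply/funext => x; rewrite /G -addrA -scalerDl [t0 + _]addrC subrK.
have -> : G ((t0 + t1) / 2) = fun x => G t0 x + ((t1 - t0) / 2) *: grad c1 x.
  apply/funext => x; rewrite /G -addrA -scalerDl.
  by have -> : (t0 + t1) / 2 = t0 + (t1 - t0) / 2 by field.
exact: kin_increment (LG t0) g1.
Qed.

Variables (t0 t1 : R) (c0 c1 e0 e1 mr me : F).
Hypothesis t01 : t0 < t1.
Hypothesis sol : step_solution a l vtx L f gamma_rho gamma_eta t0 t1 c0 c1 e0 e1 mr me.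
Local Notation Om := (omega a l (line c0 c1 ((t0 + t1) / 2)) (line e0 e1 ((t0 + t1) / 2))).
Local Notation Q := (fun x => force (grad mr x) (me x)).

Let hV := step_V sol.
Let h0 : V c0. Proof. by case: hV. Qed.
Let h1 : V c1. Proof. by case: hV. Qed.
Let k0 : V e0. Proof. by case: hV. Qed.
Let k1 : V e1. Proof. by case: hV. Qed.
Let hr : V mr. Proof. by case: (step_mu_V sol). Qed.
Let he : V me. Proof. by case: (step_mu_V sol). Qed.
Let LOm : L2row a l Om. Proof. by apply: L2row_omega; exact: V_line. Qed.
Let LQ : L2col a l Q.
Proof. by apply: L2col_force; [exact: grad_L2 hr|exact: Vh_L2 he]. Qed.

(** Test the first evolution equation with 1, whose gradient vanishes. *)
Lemma step_mass : \int[mu]_x c1 x = 0.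
Proof.
have V1 : V (fun=> 1) by exact: Vh_cst.
have := step_rho sol V1.
have -> : Qform a l L Om (fun x => force (grad (fun=> 1) x) 0) Q = 0.
  rewrite (Qform_ae hL LOm LOm (P' := fun=> 0) _ _ LQ LQ); try by apply: aeW.
  - rewrite /Qform; under eq_Rintegral do rewrite /qform trmx0 mul0mx mxE.
    by rewrite Rintegral_cst // mul0r.
  - by apply: L2col_force; [exact: grad_L2 V1|exact: L20].
  - by move=> j; under [X in L2 mu X]eq_fun do rewrite mxE; exact: L20.
  have : {ae mu, forall x, grad (fun=> 1) x = 0}.
    apply: ae_row => k; have := weak_pderiv_cst a l0 k 1.
    by apply: (@filterS _ (almost_everywhere mu)) => x E; rewrite !mxE E.
  apply: (@filterS _ (almost_everywhere mu)) => x ->.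
  by rewrite /force trmx0 raddf0 col_mx0.
by rewrite addr0 => <-; apply: eq_Rintegral => x _; rewrite mulr1.
Qed.

(** Test the equations for the potentials with the time derivatives, and the
    evolution equations with the potentials. *)
Lemma step_energy : energy (line c0 c1 t1) (line e0 e1 t1) - energy (line c0 c1 t0) (line e0 e1 t0) =
  - ((t1 - t0) * Qform a l L Om Q Q).
Proof.
have Vl t := V_line l0 t h0 h1; have Vl' t := V_line l0 t k0 k1.
rewrite !energyE //.
have P := work_potential l0 cover sf h0 h1 k0 k1 t01.
have kr := kin_line_increment t0 t1 h0 h1; have ke := kin_line_increment t0 t1 k0 k1.
have m1 := step_mu_rho sol h1; have m2 := step_mu_eta sol k1.
have d1 := step_rho sol hr; have d2 := step_eta sol he.
have -> : Qform a l L Om Q Q = Qform a l L Om (fun x => force (grad mr x) 0) Q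
    + Qform a l L Om (fun x => force 0 (me x)) Q.
  have A1 : L2col a l (fun x => force (grad mr x) 0).
    by apply: L2col_force; [exact: grad_L2 hr|exact: L20].
  have A2 : L2col a l (fun x => force (0 : 'rV[R]_d) (me x)).
    by apply: L2col_force; [exact: L2row0|exact: Vh_L2 he].
  rewrite /Qform -Rintegral_add; try exact: (Rint_qform hL).
  by apply: eq_Rintegral => x _; rewrite -qformDl -force_add.
rewrite [ip a l c1 mr]ipC in d1; rewrite [ip a l e1 me]ipC in d2.
move: d1 d2 m1 m2 P kr ke.
move: (Qform _ _ _ _ _ _) (Qform _ _ _ _ _ _) => q2 q1.
move: (ip a l mr c1) (ip a l me e1) => i1 i2.
move: (work a l _ _ _ _ _ _ _ _) (work a l _ _ _ _ _ _ _ _) => w2 w1.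
move: (\int[mu]_x f (pt2 (line c0 c1 t1 x) (line e0 e1 t1 x))) => F1.
move: (\int[mu]_x f (pt2 (line c0 c1 t0 x) (line e0 e1 t0 x))) => F0.
move: (kin a l (grad (line c0 c1 ((t0 + t1) / 2))) (grad c1)) => kr.
move: (kin a l (grad (line e0 e1 ((t0 + t1) / 2))) (grad e1)) => ke.
move: (kin a l (grad (line c0 c1 t1)) (grad (line c0 c1 t1))) => kr1.
move: (kin a l (grad (line c0 c1 t0)) (grad (line c0 c1 t0))) => kr0.
move: (kin a l (grad (line e0 e1 t1)) (grad (line e0 e1 t1))) => ke1.
move: (kin a l (grad (line e0 e1 t0)) (grad (line e0 e1 t0))) => ke0.
move=> d1 d2 m1 m2 P Er Ee.
have -> : q1 = - i1 by apply/eqP; rewrite -addr_eq0 addrC d1.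
have -> : q2 = - i2 by apply/eqP; rewrite -addr_eq0 addrC d2.
transitivity (gamma_rho / 2 * (kr1 - kr0) + gamma_eta / 2 * (ke1 - ke0) + (F1 - F0)); first ring.
rewrite Er Ee -P.
have -> : w1 = (t1 - t0) * i1 - gamma_rho * ((t1 - t0) * kr) by apply/esym/eqP; rewrite -subr_eq0 m1.
have -> : w2 = (t1 - t0) * i2 - gamma_eta * ((t1 - t0) * ke) by apply/esym/eqP; rewrite -subr_eq0 m2.
by field.
Qed.

End StepConsequences.

(** * The scheme as a family of time steps *)

Section GridEquations.
Variables (R : realType) (d : nat) (a : 'rV[R]_d) (l : R).
Hypothesis l0 : 0 < l.
Local Notation mu := (mu_cube a l).
Local Notation F := ('rV[R]_d -> R).
Local Notation grad := (grad a l).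
Variables (K : finType) (vtx : K -> 'I_d.+1 -> 'rV[R]_d).
Hypothesis cover : \bigcup_(k in [set: K]) simplex (vtx k) = cube a l.
Local Notation V := (Vh a l vtx).
Variables (L : 'rV[R]_(1 + 1 + d + d) -> 'M[R]_(d + 1)) (lam1 lam2 lam3 : R).
Hypothesis hL : mobility_assumption L lam1 lam2 lam3.
Variables (f : 'rV[R]_2 -> R) (gamma_rho gamma_eta : R).
Hypothesis sf : smooth f.
Variables (T : R) (N : nat).
Hypotheses (T0 : 0 < T) (N0 : (0 < N)%N).
Local Notation tg := (tgrid T N).
Local Notation Itv := (Itv T N).
Local Notation tau := (tau T N).
Local Notation mid := (mid T N).

Lemma state_line (p p' q q' : R) (g g' h h' : 'rV[R]_d) (t : R) :
  state (p + t * p') (q + t * q') (g + t *: g') (h + t *: h') =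
  state p q g h + t *: state p' q' g' h'.
Proof.
rewrite /state !scale_row_mx !add_row_mx.
have E (u v : R) : (u + t * v)%:M = u%:M + t *: v%:M :> 'M[R]_1.
  by rewrite raddfD /= scale_scalar_mx.
by rewrite !E.
Qed.

Lemma L2per_state r e j : V r -> V e -> L2per a l (fun x => omega a l r e x 0 j).
Proof.
move=> hr he; apply: (@state_coord R d 'rV[R]_d (L2per a l)).
- exact: Vh_L2per hr.
- exact: Vh_L2per he.
- by move=> k; under [X in L2per a l X]eq_fun do rewrite mxE; case: (weak_pderivP k (Vh_H1 hr)).
- by move=> k; under [X in L2per a l X]eq_fun do rewrite mxE; case: (weak_pderivP k (Vh_H1 he)).
Qed.

Record piecewise (rho eta mr me : R -> F) (c0 c1 e0 e1 M M' : nat -> F) : Prop := Piecewise {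
  pw_V : forall n, (0 < n <= N)%N -> [/\ V (c0 n), V (c1 n), V (e0 n) & V (e1 n)];
  pw_mu_V : forall n, (0 < n <= N)%N -> V (M n) /\ V (M' n);
  pw_rho : forall n, (0 < n <= N)%N -> forall t, Itv n t -> rho t = line (c0 n) (c1 n) t;
  pw_eta : forall n, (0 < n <= N)%N -> forall t, Itv n t -> eta t = line (e0 n) (e1 n) t;
  pw_mr : forall n, (0 < n <= N)%N -> forall t, Itv n t -> mr t = M n;
  pw_me : forall n, (0 < n <= N)%N -> forall t, Itv n t -> me t = M' n
}.

Section Piecewise.
Variables (rho eta mr me : R -> F) (c0 c1 e0 e1 M M' : nat -> F).
Hypothesis pw : piecewise rho eta mr me c0 c1 e0 e1 M M'.
Local Notation Om n := (omega a l (line (c0 n) (c1 n) (mid n)) (line (e0 n) (e1 n) (mid n))).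

Let h0 n : (0 < n <= N)%N -> V (c0 n). Proof. by case/(pw_V pw). Qed.
Let h1 n : (0 < n <= N)%N -> V (c1 n). Proof. by case/(pw_V pw). Qed.
Let k0 n : (0 < n <= N)%N -> V (e0 n). Proof. by case/(pw_V pw). Qed.
Let k1 n : (0 < n <= N)%N -> V (e1 n). Proof. by case/(pw_V pw). Qed.

(** The gradients agree everywhere and not just almost everywhere, by
    [weak_pderiv_aeq]. *)
Lemma bar_line (u : R -> F) (b0 b1 : nat -> F) :
  (forall n, (0 < n <= N)%N -> V (b0 n)) -> (forall n, (0 < n <= N)%N -> V (b1 n)) ->
  (forall n, (0 < n <= N)%N -> forall t, Itv n t -> u t = line (b0 n) (b1 n) t) ->
  forall n t, (0 < n <= N)%N -> Itv n t ->
  [/\ L2 mu (bar a l T N u t), aeq a l (bar a l T N u t) (line (b0 n) (b1 n) (mid n)) &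
      grad (bar a l T N u t) = grad (line (b0 n) (b1 n) (mid n))].
Proof.
move=> hb0 hb1 hu n t hn ht.
have Vl s m (hm : (0 < m <= N)%N) := V_line l0 s (hb0 m hm) (hb1 m hm).
have S m : (0 < m <= N)%N -> forall s, Itv m s -> L2 mu (u s) /\
    aeq a l (u s) (fun x => b0 m x + s * b1 m x).
  move=> hm s hs; rewrite (hu m hm s hs); split; first exact: Vh_L2 (Vl _ _ hm).
  exact: aeq_refl.
have [Lb eb] := bar_affine T0 N0 (fun n hn => Vh_L2per (hb0 n hn)) (fun n hn => Vh_L2per (hb1 n hn)) S hn ht.
split=> //; apply/funext => x; apply/rowP => k; rewrite !mxE.
by rewrite (weak_pderiv_aeq l0 k Lb (Vh_L2 (Vl _ _ hn)) eb).
Qed.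

(** Values and gradients of an affine function of time are affine in time up to
    null sets, so that [bar_affine] applies to every component of the state. *)
Lemma omega_bar_line n t : (0 < n <= N)%N -> Itv n t ->
  L2row a l (omega_bar a l T N rho eta t) /\
  {ae mu, forall x, omega_bar a l T N rho eta t x = Om n x}.
Proof.
move=> hn ht.
pose u j (s : R) (y : 'rV[R]_d) := omega a l (rho s) (eta s) y 0 j.
have lin m s : (0 < m <= N)%N ->
    {ae mu, forall x, omega a l (line (c0 m) (c1 m) s) (line (e0 m) (e1 m) s) x =
       omega a l (c0 m) (e0 m) x + s *: omega a l (c1 m) (e1 m) x}.
  move=> hm; have := grad_line l0 s (h0 hm) (h1 hm); have := grad_line l0 s (k0 hm) (k1 hm).
  apply: (@filterS2 _ (almost_everywhere mu)) => x E1 E2.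
  by rewrite !omegaE E1 E2 /line state_line.
have S j m : (0 < m <= N)%N -> forall s, Itv m s -> L2 mu (u j s) /\
    aeq a l (u j s) (fun x => omega a l (c0 m) (e0 m) x 0 j + s * omega a l (c1 m) (e1 m) x 0 j).
  move=> hm s hs; rewrite /u (pw_rho pw hm hs) (pw_eta pw hm hs); split.
    by have [] := L2per_state j (V_line l0 s (h0 hm) (h1 hm)) (V_line l0 s (k0 hm) (k1 hm)).
  have := lin m s hm; apply: (@filterS _ (almost_everywhere mu)) => x ->.
  by rewrite [LHS]mxE [X in _ + X]mxE.
have B j := bar_affine T0 N0 (fun n hn => L2per_state j (h0 hn) (k0 hn))
  (fun n hn => L2per_state j (h1 hn) (k1 hn)) (S j) hn ht.
split; first by move=> j; under [X in L2 mu X]eq_fun do rewrite mxE; case: (B j).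
have : {ae mu, forall x, omega_bar a l T N rho eta t x =
    omega a l (c0 n) (e0 n) x + mid n *: omega a l (c1 n) (e1 n) x}.
  apply: ae_row => j; case: (B j) => _.
  by apply: (@filterS _ (almost_everywhere mu)) => x E; rewrite mxE E [RHS]mxE [X in _ = _ + X]mxE.
by move: (lin n (mid n) hn); apply: (@filterS2 _ (almost_everywhere mu)) => x -> ->.
Qed.

Section Test.
Variables (n : nat) (v : R -> F) (phi : F).
Hypotheses (hn : (0 < n <= N)%N) (hphi : V phi) (hv : forall t, Itv n t -> v t = phi).
Local Notation Q := (fun x => force (grad (M n) x) (M' n x)).

Let n0 : (0 < n)%N. Proof. by case/andP: hn. Qed.
Let LOm : L2row a l (Om n).
Proof. by apply: L2row_omega; apply: V_line => //; [exact: h0|exact: h1|exact: k0|exact: k1]. Qed.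
Let LQ : L2col a l Q.
Proof.
have [hM hM'] := pw_mu_V pw hn.
by apply: L2col_force; [exact: grad_L2 hM|exact: Vh_L2 hM'].
Qed.

Lemma ipI_const (u : R -> F) psi : (forall t, Itv n t -> u t = psi) ->
  ipI a l T N n u v = tau * ip a l psi phi.
Proof.
move=> hu; rewrite -(Rintegral_Itv_cst T0 N0 _ n0).
by apply: Rintegral_Itv_eq => s hs; rewrite hu // hv.
Qed.

Lemma ipI_dt (u : R -> F) b0 b1 : (forall t, Itv n t -> u t = line b0 b1 t) ->
  ipI a l T N n (dt u) v = tau * ip a l b1 phi.
Proof. by move=> hu; apply: ipI_const => t; exact: (dt_affine hu). Qed.

Lemma gradI_flux : gradI a l T N n (flux a l L T N rho eta mr me) v =
  tau * Qform a l L (Om n) (fun x => force (grad phi x) 0) Q.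
Proof.
have A1 : L2col a l (fun x => force (grad phi x) 0).
  by apply: L2col_force; [exact: grad_L2 hphi|exact: L20].
rewrite -(Rintegral_Itv_cst T0 N0 _ n0); apply: Rintegral_Itv_eq => s hs.
have [Lw ew] := omega_bar_line hn hs.
rewrite -(Qform_ae hL Lw LOm A1 A1 LQ LQ ew) //; try by apply: aeW.
rewrite /flux (pw_mr pw hn hs) (pw_me pw hn hs) hv //.
by apply: eq_Rintegral => x _; exact: fluxE.
Qed.

Lemma ipI_source : ipI a l T N n (source a l L T N rho eta mr me) v =
  tau * Qform a l L (Om n) (fun x => force 0 (phi x)) Q.
Proof.
have A1 : L2col a l (fun x => force (0 : 'rV[R]_d) (phi x)).
  by apply: L2col_force; [exact: L2row0|exact: Vh_L2 hphi].
rewrite -(Rintegral_Itv_cst T0 N0 _ n0); apply: Rintegral_Itv_eq => s hs.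
have [Lw ew] := omega_bar_line hn hs.
rewrite -(Qform_ae hL Lw LOm A1 A1 LQ LQ ew) //; try by apply: aeW.
rewrite /source (pw_mr pw hn hs) (pw_me pw hn hs) hv //.
by apply: eq_Rintegral => x _; exact: (sourceE hL).
Qed.

Lemma gradI_bar (u : R -> F) (b0 b1 : nat -> F) :
  (forall n, (0 < n <= N)%N -> V (b0 n)) -> (forall n, (0 < n <= N)%N -> V (b1 n)) ->
  (forall n, (0 < n <= N)%N -> forall t, Itv n t -> u t = line (b0 n) (b1 n) t) ->
  gradI a l T N n (fun t => grad (bar a l T N u t)) v =
  tau * kin a l (grad (line (b0 n) (b1 n) (mid n))) (grad phi).
Proof.
move=> hb0 hb1 hu.
rewrite -(Rintegral_Itv_cst T0 N0 _ n0); apply: Rintegral_Itv_eq => s hs.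
by have [_ _ ->] := bar_line hb0 hb1 hu hn hs; rewrite hv.
Qed.

Lemma ipI_force (g : 'rV[R]_2 -> R) : ipI a l T N n (fun t x => g (pt2 (rho t x) (eta t x))) v =
  work a l g (tg n.-1) (tg n) (c0 n) (c1 n) (e0 n) (e1 n) phi.
Proof.
apply: Rintegral_Itv_eq => s hs.
by rewrite hv // (pw_rho pw hn hs) (pw_eta pw hn hs).
Qed.

End Test.

Lemma solution_step : 
  (forall n v, (0 < n <= N)%N -> Pk_on T N 0 V n v ->
    ipI a l T N n (dt rho) v + gradI a l T N n (flux a l L T N rho eta mr me) v = 0) ->
  (forall n v, (0 < n <= N)%N -> Pk_on T N 0 V n v ->
    ipI a l T N n (dt eta) v + ipI a l T N n (source a l L T N rho eta mr me) v = 0) ->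
  (forall n w, (0 < n <= N)%N -> Pk_on T N 0 V n w -> ipI a l T N n mr w
    - gamma_rho * gradI a l T N n (fun t => grad (bar a l T N rho t)) w
    - ipI a l T N n (fun t x => f_rho f (pt2 (rho t x) (eta t x))) w = 0) ->
  (forall n w, (0 < n <= N)%N -> Pk_on T N 0 V n w -> ipI a l T N n me w
    - gamma_eta * gradI a l T N n (fun t => grad (bar a l T N eta t)) w
    - ipI a l T N n (fun t x => f_eta f (pt2 (rho t x) (eta t x))) w = 0) ->
  forall n, (0 < n <= N)%N ->
  step_solution a l vtx L f gamma_rho gamma_eta (tg n.-1) (tg n)
    (c0 n) (c1 n) (e0 n) (e1 n) (M n) (M' n).
Proof.
move=> E1 E2 E3 E4 n hn; have n0 : (0 < n)%N by case/andP: hn.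
have P (phi : F) : V phi -> Pk_on T N 0 V n (fun=> phi) by move=> hphi; apply/Pk0P; exists phi.
have t0 : tau != 0 by rewrite gt_eqF // tau_gt0.
have can (x : R) : tau * x = 0 -> x = 0 by move/eqP; rewrite mulf_eq0 (negbTE t0) => /eqP.
split; [exact: (pw_V pw)|exact: (pw_mu_V pw)| | | |] => phi hphi.
- apply: can; rewrite mulrDr -/(mid n).
  rewrite -(@ipI_dt n (fun=> phi) phi hn (fun _ _ => erefl) rho _ _ (pw_rho pw hn)).
  by rewrite -(@gradI_flux n (fun=> phi) phi hn hphi (fun _ _ => erefl)); apply: E1 => //; exact: P.
- apply: can; rewrite mulrDr -/(mid n).
  rewrite -(@ipI_dt n (fun=> phi) phi hn (fun _ _ => erefl) eta _ _ (pw_eta pw hn)).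
  by rewrite -(@ipI_source n (fun=> phi) phi hn hphi (fun _ _ => erefl)); apply: E2 => //; exact: P.
- rewrite tgrid_sub // -/(mid n).
  rewrite -(@ipI_const n (fun=> phi) phi hn (fun _ _ => erefl) mr _ (pw_mr pw hn)).
  rewrite -(@gradI_bar n (fun=> phi) phi hn (fun _ _ => erefl) rho c0 c1 h0 h1 (pw_rho pw)).
  by rewrite -(@ipI_force n (fun=> phi) phi hn (fun _ _ => erefl)); apply: E3 => //; exact: P.
- rewrite tgrid_sub // -/(mid n).
  rewrite -(@ipI_const n (fun=> phi) phi hn (fun _ _ => erefl) me _ (pw_me pw hn)).
  rewrite -(@gradI_bar n (fun=> phi) phi hn (fun _ _ => erefl) eta e0 e1 k0 k1 (pw_eta pw)).
  by rewrite -(@ipI_force n (fun=> phi) phi hn (fun _ _ => erefl)); apply: E4 => //; exact: P.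
Qed.

Lemma step_is_solution (rho0 eta0 : F) :
  Pkc a l T N 1 V rho -> Pkc a l T N 1 V eta -> rho 0 = rho0 -> eta 0 = eta0 ->
  (forall n, (0 < n <= N)%N ->
    step_solution a l vtx L f gamma_rho gamma_eta (tg n.-1) (tg n)
      (c0 n) (c1 n) (e0 n) (e1 n) (M n) (M' n)) ->
  is_solution a l vtx gamma_rho gamma_eta L f T N rho0 eta0 rho eta mr me.
Proof.
move=> Pr Pe r0 e0' sol; split => //.
- by move=> n hn; apply/Pk0P; exists (M n); [case: (pw_mu_V pw hn)|exact: (pw_mr pw hn)].
- by move=> n hn; apply/Pk0P; exists (M' n); [case: (pw_mu_V pw hn)|exact: (pw_me pw hn)].
- move=> n v hn /Pk0P[phi hphi hv].
  rewrite (ipI_dt hn hv (pw_rho pw hn)) (gradI_flux hn hphi hv) -mulrDr.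
  by rewrite (step_rho (sol n hn) hphi) mulr0.
- move=> n v hn /Pk0P[phi hphi hv].
  rewrite (ipI_dt hn hv (pw_eta pw hn)) (ipI_source hn hphi hv) -mulrDr.
  by rewrite (step_eta (sol n hn) hphi) mulr0.
- move=> n v hn /Pk0P[phi hphi hv]; have n0 : (0 < n)%N by case/andP: hn.
  rewrite (ipI_const hn hv (pw_mr pw hn)) (gradI_bar hn hv h0 h1 (pw_rho pw)) (ipI_force hn hv).
  by have := step_mu_rho (sol n hn) hphi; rewrite tgrid_sub.
- move=> n v hn /Pk0P[phi hphi hv]; have n0 : (0 < n)%N by case/andP: hn.
  rewrite (ipI_const hn hv (pw_me pw hn)) (gradI_bar hn hv k0 k1 (pw_eta pw)) (ipI_force hn hv).
  by have := step_mu_eta (sol n hn) hphi; rewrite tgrid_sub.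
Qed.

Lemma dissipation_line n s : (0 < n <= N)%N -> Itv n s ->
  dissipation a l L (bar a l T N rho s) (bar a l T N eta s) (mr s) (me s) =
  Qform a l L (Om n) (fun x => force (grad (M n) x) (M' n x)) (fun x => force (grad (M n) x) (M' n x)).
Proof.
move=> hn hs.
have [L1 a1 g1] := bar_line h0 h1 (pw_rho pw) hn hs.
have [L2' a2 g2] := bar_line k0 k1 (pw_eta pw) hn hs.
have [hM hM'] := pw_mu_V pw hn.
have LQ : L2col a l (fun x => force (grad (M n) x) (M' n x)).
  by apply: L2col_force; [exact: grad_L2 hM|exact: Vh_L2 hM'].
have Vr := V_line l0 (mid n) (h0 hn) (h1 hn); have Ve := V_line l0 (mid n) (k0 hn) (k1 hn).
rewrite (pw_mr pw hn hs) (pw_me pw hn hs).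
apply: (Qform_ae hL) => //; last 2 first.
- by apply: aeW.
- by apply: aeW.
- apply: (@state_coord R d 'rV[R]_d (L2 mu)) => //.
  + by rewrite g1; exact: grad_L2 Vr.
  + by rewrite g2; exact: grad_L2 Ve.
- exact: (L2row_omega Vr Ve).
move: a1 a2; apply: (@filterS2 _ (almost_everywhere mu)) => x E1 E2.
rewrite /omega E1 E2; congr (row_mx (row_mx _ _) _).
  by rewrite g1.
by rewrite g2.
Qed.

End Piecewise.

End GridEquations.

(** * Traces at the nodes and interpolation in time *)

Section Interpolation.
Variables (R : realType) (d : nat) (a : 'rV[R]_d) (l : R).
Hypothesis l0 : 0 < l.
Local Notation mu := (mu_cube a l).
Local Notation F := ('rV[R]_d -> R).
Local Notation grad := (grad a l).
Variables (K : finType) (vtx : K -> 'I_d.+1 -> 'rV[R]_d).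
Hypothesis cover : \bigcup_(k in [set: K]) simplex (vtx k) = cube a l.
Local Notation V := (Vh a l vtx).
Variables (T : R) (N : nat).
Hypotheses (T0 : 0 < T) (N0 : (0 < N)%N).
Local Notation tg := (tgrid T N).
Local Notation Itv := (Itv T N).
Local Notation tau := (tau T N).
Local Notation mid := (mid T N).

Lemma tgrid0 : tg 0 = 0. Proof. by rewrite /tgrid mul0r. Qed.

Lemma tgridN : tg N = T.
Proof. by rewrite /tgrid mulrCA divff ?mulr1 // pnatr_eq0 -lt0n. Qed.

Lemma tgrid_ge0 n : 0 <= tg n.
Proof. by rewrite -tgrid0; apply: tgrid_le. Qed.

Lemma tgrid_in n : (n <= N)%N -> tg n \in `[0, T].
Proof. move=> nN; rewrite in_itv /= tgrid_ge0 /=.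
by have := tgrid_le T0 N0 nN; rewrite tgridN. Qed.

Lemma Itv_sub n s : (0 < n <= N)%N -> Itv n s -> s \in `[0, T].
Proof.
move=> /andP[n0 nN]; rewrite /Defs.Itv /= !in_itv /= => /andP[s0 s1].
rewrite (le_trans (tgrid_ge0 n.-1) (ltW s0)) /= (le_trans (ltW s1)) //.
by have := tgrid_le T0 N0 nN; rewrite tgridN.
Qed.

Lemma ip_le_H1norm v : ip a l v v <= H1norm a l v ^+ 2.
Proof.
have kv : 0 <= \int[mu]_x dotv (grad v x) (grad v x) by exact: kin_ge0.
by rewrite sqr_sqrtr ?addr_ge0 ?ip_ge0 // lerDl.
Qed.

Lemma ip_line u w s : L2 mu u -> L2 mu w ->
  ip a l (fun x => u x + s * w x) (fun x => u x + s * w x) =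
  ip a l u u + s * (2 * ip a l u w + s * ip a l w w).
Proof.
move=> hu hw; have hsw : L2 mu (fun x => s * w x) by exact: L2Z.
have hD : L2 mu (fun x => u x + s * w x) by exact: L2D.
rewrite ipDl // ipZl // [ip a l u _]ipC [ip a l w _]ipC !ipDl // !ipZl //.
by rewrite [ip a l w u]ipC; ring.
Qed.

(** Along times inside the interval converging to the end point t, the L2 norm of
    line s - u t is at most the H1 norm of u s - u t, which tends to 0, while it
    tends to the L2 norm of line t - u t. *)
Lemma node_match (u : R -> F) b0 b1 n t : Ctime a l T V u -> (0 < n <= N)%N -> V b0 -> V b1 ->
  (forall s, Itv n s -> u s = line b0 b1 s) -> t = tg n.-1 \/ t = tg n ->
  aeq a l (u t) (line b0 b1 t).
Proof.
move=> Cu hn h0 h1 hu tn; have [n0 nN] := andP hn.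
have tT : t \in `[0, T].
  by case: tn => ->; apply: tgrid_in => //; rewrite (leq_trans (leq_pred _)).
have [Vu cv] := Cu t tT.
(* The midpoint lies in the interval and t is one of its ends, so these times are
   inside it. *)
pose s_ k : R := t + k.+1%:R^-1 * (mid n - t).
have s_in k : Itv n (s_ k).
  have k0 : 0 < k.+1%:R^-1 :> R by rewrite invr_gt0.
  have k1 : k.+1%:R^-1 <= 1 :> R by rewrite invf_le1 ?ler1n.
  have g : tg n - tg n.-1 = tau by exact: tgrid_sub.
  have tp : 0 < tau by exact: tau_gt0.
  rewrite /Defs.Itv /= in_itv /= /s_.
  have -> : mid n = (tg n.-1 + tg n) / 2 by [].
  move: k0 k1; move: (k.+1%:R^-1) => q q0 q1.
  case: tn => ->.
    have -> : (tg n.-1 + tg n) / 2 - tg n.-1 = tau / 2 by rewrite -g; field.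
    by apply/andP; split; nra.
  have -> : (tg n.-1 + tg n) / 2 - tg n = - (tau / 2) by rewrite -g; field.
  by apply/andP; split; nra.
have s_lim : s_ k @[k --> \oo] --> t.
  have : s_ k @[k --> \oo] --> t + 0 * (mid n - t).
    exact: (cvgD (cvg_cst t) (cvgM (@cvg_harmonic R) (cvg_cst (mid n - t)))).
  by rewrite mul0r addr0.
have s_within : s_ k @[k --> \oo] --> within (fun s => s \in `[0, T]) (nbhs t).
  move=> A hA; have := s_lim _ hA; apply: (@filterS _ \oo) => k /= h; apply: h.
  exact: Itv_sub hn (s_in k).
have Hlim := cvg_comp _ _ s_within cv.
pose D x := line b0 b1 t x + -1 * u t x.
have VD : V D by apply: VhD => //; [exact: V_line|exact: VhZ].
have phiE s : ip a l (fun x => line b0 b1 s x - u t x) (fun x => line b0 b1 s x - u t x) =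
    ip a l D D + (s - t) * (2 * ip a l D b1 + (s - t) * ip a l b1 b1).
  have -> : (fun x => line b0 b1 s x - u t x) = (fun x => D x + (s - t) * b1 x).
    by apply/funext => x; rewrite /D /line; ring.
  exact: ip_line (Vh_L2 VD) (Vh_L2 h1).
have e0 : ip a l D D <= 0.
  pose phi s := ip a l D D + (s - t) * (2 * ip a l D b1 + (s - t) * ip a l b1 b1).
  have cphi : phi (s_ k) @[k --> \oo] --> phi t.
    have st : s_ k - t @[k --> \oo] --> t - t by exact: cvgB s_lim (cvg_cst t).
    exact: (cvgD (cvg_cst _) (cvgM st (cvgD (cvg_cst _) (cvgM st (cvg_cst _))))).
  have -> : ip a l D D = phi t by rewrite /phi subrr mul0r addr0.
  have -> : (0 : R) = 0 * 0 by rewrite mul0r.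
  apply: (ler_cvg_to cphi (cvgM Hlim Hlim)).
  apply: nearW => k /=; rewrite /phi -phiE -expr2 (hu _ (s_in k)).
  exact: ip_le_H1norm.
have /ip_eq0 : ip a l D D = 0 by apply/eqP; rewrite eq_le e0 ip_ge0.
move=> /(_ (Vh_L2 VD)); apply: (@filterS _ (almost_everywhere mu)) => x.
by rewrite /D mulN1r => /subr0_eq.
Qed.

Lemma H1norm_sum n (c : 'I_n -> R) (w : 'I_n -> F) : (forall i, V (w i)) ->
  H1norm a l (fun x => \sum_i c i * w i x) =
  Num.sqrt (\sum_i c i * \sum_j c j * (ip a l (w i) (w j) + kin a l (grad (w i)) (grad (w j)))).
Proof.
move=> hw; pose W x := \sum_i c i * w i x.
have VW : V W by exact: Vh_sum.
have L2w i := Vh_L2 (hw i); have L2g i := grad_L2 (hw i).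
pose G x := \sum_i c i *: grad (w i) x.
have LG : L2row a l G by exact: L2row_sum.
have gW : {ae mu, forall x, grad W x = G x}.
  apply: ae_row => k; have := weak_pderiv_sum l0 k c (fun i => Vh_H1 (hw i)).
  apply: (@filterS _ (almost_everywhere mu)) => x E; rewrite mxE E summxE.
  by apply: eq_bigr => i _; rewrite !mxE.
congr Num.sqrt; rewrite -[X in _ + X]/(kin a l (grad W) (grad W)).
rewrite (kin_ae (grad_L2 VW) LG (grad_L2 VW) LG gW gW).
rewrite ip_suml //; last exact: Vh_L2 VW.
rewrite kin_suml // -big_split; apply: eq_bigr => i _ /=.
rewrite -mulrDr; congr (_ * _).
rewrite ipC ip_suml // [kin a l (grad (w i)) G]kinC kin_suml // -big_split.
by apply: eq_bigr => j _ /=; rewrite -mulrDr ipC kinC.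
Qed.

(** The part of the i-th time step that has elapsed at time t.  Writing the interpolant
    with these functions gives a single formula valid on the whole time interval, which is
    continuous because they are. *)
Definition elapsed (i : nat) (t : R) : R := Num.min (Num.max (t - tg i) 0) tau.

Lemma elapsed_continuous i : continuous (elapsed i).
Proof.
move=> t; have ct : {for t, continuous (fun s : R => s - tg i)}.
  exact: (cvgB cvg_id (cvg_cst (tg i))).
have cc (c : R) : {for t, continuous (fun _ : R => c)} by exact: cvg_cst.
exact: continuous_min (continuous_max ct (cc 0)) (cc tau).
Qed.

Lemma elapsed_past i t : tg i.+1 <= t -> elapsed i t = tau.
Proof.
rewrite tgridS => h; have tp := tau_gt0 T0 N0.
have q : tau <= t - tg i by lra.
by rewrite /elapsed max_l ?(le_trans (ltW tp)) // min_r.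
Qed.

Lemma elapsed_now i t : tg i <= t <= tg i.+1 -> elapsed i t = t - tg i.
Proof.
rewrite tgridS => /andP[h h']; rewrite /elapsed max_l ?subr_ge0 // min_l //.
by rewrite lerBlDl.
Qed.

Lemma elapsed_future i t : t <= tg i -> elapsed i t = 0.
Proof.
move=> h; rewrite /elapsed max_r ?subr_le0 // min_l // ltW //.
exact: (tau_gt0 T0 N0).
Qed.

Section Interpolant.
Variables (r : F) (w : nat -> F).
Hypotheses (Vr : V r) (Vw : forall i, V (w i)).

Definition node (k : nat) : F := fun x => r x + \sum_(i < k) tau * w i x.

Definition interp (t : R) : F := fun x => r x + \sum_(i < N) elapsed i t * w i x.

Lemma V_node k : V (node k).
Proof. by apply: VhD => //; exact: Vh_sum. Qed.

Lemma interp0 : interp 0 = r.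
Proof.
apply/funext => x; rewrite /interp big1 ?addr0 // => i _.
by rewrite elapsed_future ?mul0r // tgrid_ge0.
Qed.

Lemma interp_Itv n t : (0 < n <= N)%N -> Itv n t ->
  interp t = line (fun x => node n.-1 x + - tg n.-1 * w n.-1 x) (w n.-1) t.
Proof.
case: n => // k /= kN; rewrite /Defs.Itv /= in_itv /= => /andP[t0 t1].
apply/funext => x.
have P m : \sum_(i < m) elapsed i t * w i x =
    if (m <= k)%N then \sum_(i < m) tau * w i x
    else \sum_(i < k) tau * w i x + (t - tg k) * w k x.
  elim: m => [|m IH]; first by rewrite leq0n !big_ord0.
  rewrite big_ord_recr /= IH; case: (ltngtP m k) => [mk|km|mk].
  - by rewrite big_ord_recr /= elapsed_past // (le_trans _ (ltW t0)) // tgrid_le.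
  - by rewrite elapsed_future ?mul0r ?addr0 // (le_trans (ltW t1)) // tgrid_le.
  - by rewrite mk elapsed_now // ltW //= ltW.
by rewrite /interp P leqNgt kN /= /line /node; ring.
Qed.

Lemma Pkc_interp : Pkc a l T N 1 V interp.
Proof.
split.
  move=> n hn; apply/Pk1P.
  exists (fun x => node n.-1 x + - tg n.-1 * w n.-1 x), (w n.-1); split => //.
    by apply: VhD => //; [exact: V_node|exact: VhZ].
  by move=> t ht; rewrite (interp_Itv hn ht).
move=> t _; split; first by apply: VhD => //; exact: Vh_sum.
apply: cvg_within_filter.
have -> : (fun s => H1norm a l (fun x => interp s x - interp t x)) =
  (fun s => Num.sqrt (\sum_(i < N) (elapsed i s - elapsed i t) * \sum_(j < N) (elapsed j s - elapsed j t) *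
     (ip a l (w i) (w j) + kin a l (grad (w i)) (grad (w j))))).
  apply/funext => s.
  have -> : (fun x => interp s x - interp t x) =
      (fun x => \sum_(i < N) (elapsed i s - elapsed i t) * w i x).
    apply/funext => x; rewrite /interp opprD addrACA subrr add0r -sumrB.
    by apply: eq_bigr => i _; rewrite mulrBl.
  exact: (H1norm_sum (fun i : 'I_N => elapsed i s - elapsed i t) (fun i : 'I_N => Vw i)).
set P := (X in _ (fun s => Num.sqrt (X s)) _).
have cP : continuous P.
  have ce (i : nat) : continuous (fun s => elapsed i s - elapsed i t).
    by move=> s; exact: (cvgB (@elapsed_continuous i s) (cvg_cst _)).
  apply: continuous_sumr => i.
  have cS : continuous (fun s => \sum_(j < N) (elapsed j s - elapsed j t) *
     (ip a l (w i) (w j) + kin a l (grad (w i)) (grad (w j)))).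
    by apply: continuous_sumr => j s; exact: (cvgM (ce j s) (cvg_cst _)).
  by move=> s; exact: (cvgM (ce i s) (cS s)).
have sP : Num.sqrt (P s) @[s --> t] --> Num.sqrt (P t).
  by apply: continuous_comp; [exact: cP|exact: sqrt_continuous].
move: sP; have -> : P t = 0 by rewrite /P big1 // => i _; rewrite subrr mul0r.
by rewrite sqrtr0.
Qed.

End Interpolant.

End Interpolation.

(** * Existence, mass and energy *)

Section Scheme.
Variables (R : realType) (d : nat) (a : 'rV[R]_d) (l : R).
Hypothesis l0 : 0 < l.
Local Notation mu := (mu_cube a l).
Local Notation F := ('rV[R]_d -> R).
Local Notation grad := (grad a l).
Variables (K : finType) (vtx : K -> 'I_d.+1 -> 'rV[R]_d).
Hypothesis cover : \bigcup_(k in [set: K]) simplex (vtx k) = cube a l.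
Local Notation V := (Vh a l vtx).
Variables (L : 'rV[R]_(1 + 1 + d + d) -> 'M[R]_(d + 1)) (lam1 lam2 lam3 : R).
Hypothesis hL : mobility_assumption L lam1 lam2 lam3.
Variables (f : 'rV[R]_2 -> R) (gamma_rho gamma_eta : R).
Hypotheses (sf : smooth f) (f0 : forall z, 0 <= f z).
Hypotheses (gamma_rho_gt0 : 0 < gamma_rho) (gamma_eta_gt0 : 0 < gamma_eta).
Variables (T : R) (N : nat).
Hypotheses (T0 : 0 < T) (N0 : (0 < N)%N).
Variables (rho0 eta0 : F).
Hypotheses (Vrho0 : V rho0) (Veta0 : V eta0).
Local Notation tg := (tgrid T N).
Local Notation Itv := (Itv T N).
Local Notation tau := (tau T N).
Local Notation is_solution := (is_solution a l vtx gamma_rho gamma_eta L f T N rho0 eta0).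
Local Notation energy := (energy a l gamma_rho gamma_eta f).
Local Notation step_solution := (step_solution a l vtx L f gamma_rho gamma_eta).

(** Iterate [step_exists], starting each step from the value reached by the previous
    one, and interpolate. *)
Lemma solution_exists : exists rho eta mr me, is_solution rho eta mr me.
Proof.
have /choice[q hq] : forall p : nat * (F * F), exists q : (F * F) * (F * F), V p.2.1 -> V p.2.2 ->
    step_solution (tg p.1) (tg p.1.+1) (fun x => p.2.1 x + - tg p.1 * q.1.1 x) q.1.1
      (fun x => p.2.2 x + - tg p.1 * q.1.2 x) q.1.2 q.2.1 q.2.2.
  move=> [k [r e]] /=; have [hr|nr] := pselect (V r); last by exists ((r, r), (r, r)).
  have [he|ne] := pselect (V e); last by exists ((r, r), (r, r)).
  have kk : tg k < tg k.+1 by have := tgrid_lt T0 N0 (ltn0Sn k).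
  have [c1 [e1 [mr [me h]]]] := step_exists l0 cover hL sf f0 gamma_rho_gt0 gamma_eta_gt0 kk hr he.
  by exists ((c1, e1), (mr, me)).
pose next k (p : F * F) : F * F := (fun x => p.1 x + tau * (q (k, p)).1.1 x,
                                    fun x => p.2 x + tau * (q (k, p)).1.2 x).
pose fix nd k : F * F := if k is k'.+1 then next k' (nd k') else (rho0, eta0).
have Vnd k : V (nd k).1 /\ V (nd k).2.
  elim: k => [|k [h1 h2]] //=.
  have [hV _ _ _ _ _] := hq (k, nd k) h1 h2.
  by case: hV => _ w1 _ w2; split; apply: VhD => //; exact: VhZ.
have step k : step_solution (tg k) (tg k.+1)
    (fun x => (nd k).1 x + - tg k * (q (k, nd k)).1.1 x) (q (k, nd k)).1.1
    (fun x => (nd k).2 x + - tg k * (q (k, nd k)).1.2 x) (q (k, nd k)).1.2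
    (q (k, nd k)).2.1 (q (k, nd k)).2.2.
  by have [h1 h2] := Vnd k; exact: (hq (k, nd k)).
pose w k := (q (k, nd k)).1.1; pose w' k := (q (k, nd k)).1.2.
have Vw k : V (w k) by have [[]] := step k.
have Vw' k : V (w' k) by have [[]] := step k.
have nodeE k : node T N rho0 w k = (nd k).1 /\ node T N eta0 w' k = (nd k).2.
  elim: k => [|k [IH IH']].
    by split; apply/funext => x; rewrite /node big_ord0 addr0.
  split; apply/funext => x; rewrite /node big_ord_recr addrA /=.
    by rewrite -IH.
  by rewrite -IH'.
pose pc (m : nat -> F) (t : R) x := \sum_(i < N) (if `[< Itv i.+1 t >] then m i x else 0).
have pcE m n t : (0 < n <= N)%N -> Itv n t -> pc m t = m n.-1.
  case: n => // n /= nN ht; apply/funext => x.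
  rewrite /pc (bigD1 (Ordinal nN)) //= asboolT // big1 ?addr0 // => i im.
  rewrite asboolF // => hi; have [] := Itv_inj T0 N0 (ltn0Sn _) (ltn0Sn _) hi ht.
  by move=> e; move/eqP: im; apply; exact: val_inj.
exists (interp T N rho0 w), (interp T N eta0 w'),
  (pc (fun k => (q (k, nd k)).2.1)), (pc (fun k => (q (k, nd k)).2.2)).
apply: (@step_is_solution R d a l l0 K vtx L lam1 lam2 lam3 hL f gamma_rho gamma_eta T N T0 N0 _ _ _ _
  (fun n x => node T N rho0 w n.-1 x + - tg n.-1 * w n.-1 x) (fun n => w n.-1)
  (fun n x => node T N eta0 w' n.-1 x + - tg n.-1 * w' n.-1 x) (fun n => w' n.-1)
  (fun n => (q (n.-1, nd n.-1)).2.1) (fun n => (q (n.-1, nd n.-1)).2.2)).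
- split.
  + move=> n hn; split=> //; apply: VhD => //; try exact: VhZ; exact: V_node.
  + by move=> n hn; have [_ []] := step n.-1.
  + by move=> n hn t; exact: interp_Itv.
  + by move=> n hn t; exact: interp_Itv.
  + by move=> n hn t; exact: pcE.
  + by move=> n hn t; exact: pcE.
- exact: Pkc_interp.
- exact: Pkc_interp.
- exact: interp0.
- exact: interp0.
move=> n hn; have := step n.-1; have [-> ->] := nodeE n.-1.
by rewrite prednK //; case/andP: hn.
Qed.

Section AnySolution.
Variables rho eta mr me : R -> F.
Hypothesis sol : is_solution rho eta mr me.

Lemma solution_pieces : exists c0 c1 e0 e1 M M' : nat -> F,
  piecewise a l vtx T N rho eta mr me c0 c1 e0 e1 M M'.
Proof.
have P1 (u : R -> F) : Pk T N 1 V u -> exists c : nat -> F * F, forall n, (0 < n <= N)%N ->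
    [/\ V (c n).1, V (c n).2 & forall t, Itv n t -> u t = line (c n).1 (c n).2 t].
  move=> Pu; have /choice[c hc] : forall n, exists c : F * F, (0 < n <= N)%N ->
      [/\ V c.1, V c.2 & forall t, Itv n t -> u t = line c.1 c.2 t].
    move=> n; have [hn|nn] := pselect ((0 < n <= N)%N); last by exists (rho0, rho0).
    by have /Pk1P[c0 [c1 [h0 h1 e]]] := Pu n hn; exists (c0, c1).
  by exists c.
have P0 (u : R -> F) : Pk T N 0 V u -> exists c : nat -> F, forall n, (0 < n <= N)%N ->
    V (c n) /\ forall t, Itv n t -> u t = c n.
  move=> Pu; have /choice[c hc] : forall n, exists c : F, (0 < n <= N)%N ->
      V c /\ forall t, Itv n t -> u t = c.
    move=> n; have [hn|nn] := pselect ((0 < n <= N)%N); last by exists rho0.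
    by have /Pk0P[c h e] := Pu n hn; exists c.
  by exists c.
have [c hc] := P1 _ (sol_rho sol).1; have [e he] := P1 _ (sol_eta sol).1.
have [M hM] := P0 _ (sol_mu_rho sol); have [M' hM'] := P0 _ (sol_mu_eta sol).
exists (fun n => (c n).1), (fun n => (c n).2), (fun n => (e n).1), (fun n => (e n).2), M, M'.
split=> n hn.
- by have [? ? _] := hc n hn; have [? ? _] := he n hn.
- by have [? _] := hM n hn; have [? _] := hM' n hn.
- by have [] := hc n hn.
- by have [] := he n hn.
- by have [] := hM n hn.
- by have [] := hM' n hn.
Qed.

(** On the closed interval a solution is the affine function of its open interval:
    inside by definition, at the ends by [node_match]. *)
Lemma line_on_closed_step (u : R -> F) b0 b1 n s : Ctime a l T V u -> (0 < n <= N)%N ->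
  V b0 -> V b1 -> (forall s, Itv n s -> u s = line b0 b1 s) -> tg n.-1 <= s <= tg n ->
  V (u s) /\ aeq a l (u s) (line b0 b1 s).
Proof.
move=> Cu hn h0 h1 hu /andP[s0 s1]; have [n0 nN] := andP hn; split.
  have [] // := Cu s; rewrite in_itv /= (le_trans (tgrid_ge0 T0 N0 n.-1) s0) (le_trans s1) //.
  by have := tgrid_le T0 N0 nN; rewrite tgridN.
have [s0'|s0'|e] := ltgtP (tg n.-1) s; last 2 first.
- by move: s0; rewrite leNgt s0'.
- by apply: (node_match l0 T0 N0 Cu hn h0 h1 hu); left.
have [s1'|s1'|e] := ltgtP s (tg n); last 2 first.
- by move: s1; rewrite leNgt s1'.
- by apply: (node_match l0 T0 N0 Cu hn h0 h1 hu); right.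
have hs : Itv n s by rewrite /Defs.Itv /= in_itv /= s0' s1'.
by rewrite hu //; exact: aeq_refl.
Qed.

(** The mass is constant on each closed interval of the grid, hence on [0, T]. *)
Lemma mass_conserved (t : R) : 0 < t < T -> is_derive t 1 (fun s : R => \int[mu]_x rho s x) 0.
Proof.
have [c0 [c1 [e0 [e1 [M [M' pw]]]]]] := solution_pieces.
have st := solution_step l0 hL T0 N0 pw (sol_eq_rho sol) (sol_eq_eta sol)
  (sol_eq_mu_rho sol) (sol_eq_mu_eta sol).
have mass_step n s : (0 < n <= N)%N -> tg n.-1 <= s <= tg n ->
    \int[mu]_x rho s x = \int[mu]_x c0 n x.
  move=> hn hs; have [h0 h1 _ _] := pw_V pw hn.
  have [Vs es] := line_on_closed_step (sol_rho sol).2 hn h0 h1 (pw_rho pw hn) hs.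
  have I v : V v -> Rintegrable mu v.
    by move=> hv; have := L2_Rint (mu_cube_fin a l0) (Vh_L2 hv).
  have Vl := V_line l0 s h0 h1.
  rewrite (Rintegral_ae (Rint_measurable (I _ Vs)) (Rint_measurable (I _ Vl)) es).
  rewrite Rintegral_add; [|exact: I|by apply: RintZ; exact: I].
  by rewrite Rintegral_scale ?(step_mass l0 hL (st n hn)) ?mulr0 ?addr0 //; exact: I.
have mass k : (k <= N)%N -> forall s, 0 <= s <= tg k -> \int[mu]_x rho s x = \int[mu]_x rho 0 x.
  elim: k => [_ s|k IH kN s /andP[s0 sk]].
    by rewrite tgrid0 -eq_le => /eqP <-.
  have [h|h] := leP s (tg k); first by apply: IH; [exact: ltnW|rewrite s0].
  have kk : tg k <= tg k.+1 by exact: tgrid_le.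
  have -> : \int[mu]_x rho s x = \int[mu]_x c0 k.+1 x by apply: mass_step => //=; rewrite (ltW h).
  have <- : \int[mu]_x rho (tg k) x = \int[mu]_x c0 k.+1 x by apply: mass_step => //=; rewrite lexx.
  by apply: IH; [exact: ltnW|rewrite lexx andbT tgrid_ge0].
move=> tT; apply: near_eq_is_derive (is_derive_cst (\int[mu]_x rho 0 x : R) t 1).
have : nbhs t (`]0, T[%classic : set R).
  by apply: open_nbhs_nbhs; split; [exact: interval_open|rewrite /= in_itv].
apply: filterS => s; rewrite /= in_itv /= => /andP[s0 sT].
by apply/esym; apply: (mass N) => //; rewrite tgridN // !ltW.
Qed.

Lemma energy_dissipated n : (0 < n <= N)%N ->
  energy (rho (tg n)) (eta (tg n)) - energy (rho (tg n.-1)) (eta (tg n.-1)) =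
  - \int[@lebesgue_measure R]_(s in Itv n)
      dissipation a l L (bar a l T N rho s) (bar a l T N eta s) (mr s) (me s).
Proof.
move=> hn; have [n0 nN] := andP hn.
have [c0 [c1 [e0 [e1 [M [M' pw]]]]]] := solution_pieces.
have st := solution_step l0 hL T0 N0 pw (sol_eq_rho sol) (sol_eq_eta sol)
  (sol_eq_mu_rho sol) (sol_eq_mu_eta sol) hn.
have lt := tgrid_lt T0 N0 n0.
have [h0 h1 k0 k1] := pw_V pw hn.
have E s : tg n.-1 <= s <= tg n ->
    energy (rho s) (eta s) = energy (line (c0 n) (c1 n) s) (line (e0 n) (e1 n) s).
  move=> hs.
  have [V1 a1] := line_on_closed_step (sol_rho sol).2 hn h0 h1 (pw_rho pw hn) hs.
  have [V2 a2] := line_on_closed_step (sol_eta sol).2 hn k0 k1 (pw_eta pw hn) hs.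
  exact: (energy_aeq l0 cover gamma_rho gamma_eta sf V1 (V_line l0 s h0 h1) V2 (V_line l0 s k0 k1) a1 a2).
rewrite !E ?lexx ?(ltW lt) //.
rewrite (step_energy l0 cover hL sf lt st) tgrid_sub //; congr (- _).
rewrite -(Rintegral_Itv_cst T0 N0 _ n0); apply: Rintegral_Itv_eq => s hs.
by rewrite (dissipation_line l0 hL T0 N0 pw hn hs).
Qed.

End AnySolution.

End Scheme.

Theorem theorem2 (R : realType) (d : nat) (hd : d = 2%N \/ d = 3%N)
    (a : 'rV[R]_d) (l : R) (hl : 0 < l)
    (T : R) (hT : 0 < T)
    (gamma_rho gamma_eta : R) (hgr : 0 < gamma_rho) (hge : 0 < gamma_eta)
    (L : 'rV[R]_(1 + 1 + d + d) -> 'M[R]_(d + 1)) (lam1 lam2 lam3 : R)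
    (hL : mobility_assumption L lam1 lam2 lam3)
    (f : 'rV[R]_2 -> R) (alpha C1 C2 : R)
    (hf : potential_assumption f alpha C1 C2)
    (K : finType) (vtx : K -> 'I_d.+1 -> 'rV[R]_d) (h sigma : R) (hh : 0 < h)
    (hmesh : periodic_conforming_partition a l vtx)
    (hqu : quasi_uniform vtx h sigma)
    (N : nat) (hN : (0 < N)%N)
    (rho0 eta0 : 'rV[R]_d -> R)
    (hrho0 : Vh a l vtx rho0) (heta0 : Vh a l vtx eta0) :
  (exists rho eta mu_rho mu_eta : R -> 'rV[R]_d -> R,
    is_solution a l vtx gamma_rho gamma_eta L f T N rho0 eta0
      rho eta mu_rho mu_eta) /\
  (forall rho eta mu_rho mu_eta : R -> 'rV[R]_d -> R,
    is_solution a l vtx gamma_rho gamma_eta L f T N rho0 eta0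
      rho eta mu_rho mu_eta ->
    (forall t : R, 0 < t < T ->
      is_derive t 1 (fun s : R => \int[mu_cube a l]_x rho s x) 0) /\
    (forall n : nat, (0 < n <= N)%N ->
      energy a l gamma_rho gamma_eta f (rho (tgrid T N n)) (eta (tgrid T N n))
      - energy a l gamma_rho gamma_eta f
          (rho (tgrid T N n.-1)) (eta (tgrid T N n.-1))
      = - \int[@lebesgue_measure R]_(s in Itv T N n)
            dissipation a l L (bar a l T N rho s) (bar a l T N eta s)
              (mu_rho s) (mu_eta s))).
Proof.
have cover := cells_cover hmesh; case: hf => sf f0 _ _ _.
split; first exact: (solution_exists hl cover hL sf f0 hgr hge hT hN hrho0 heta0).
move=> rho eta mr me sol; split=> [t|n].
  exact: (mass_conserved hl hL hT hN sol).
exact: (energy_dissipated hl cover hL sf hT hN sol).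
Qed.
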